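(* Let $(\boldsymbol{G}(\mathbb{H}),\tilde\Theta)$ be the $(4n+3)$-dimensional quaternionic Heisenberg group equipped with its standard qc structure. For any $f\in\mathcal{C}^\infty_o(\boldsymbol{G}(\mathbb{H}))$ (smooth with compact support) we have $$\|\nabla^2f\|_{L^2(\boldsymbol{G}(\mathbb{H}))}\ \le\ c_n\,\|\triangle f\|_{L^2(\boldsymbol{G}(\mathbb{H}))},\qquad c_n=\sqrt{1+\frac1n}.$$
   Context: Quaternionic contact (qc) manifold of dimension $4n+3$: a manifold $M$ with a codimension three distribution $H$ (the horizontal space), locally the kernel of an $\mathbb{R}^3$-valued 1-form $\eta=(\eta_1,\eta_2,\eta_3)$; a Riemannian metric $g$ on $H$; and a rank three bundle $\mathbb{Q}$ of endomorphisms of $H$ locally generated by three almost complex structures $I_1,I_2,I_3$ on $H$ with $I_1I_2=-I_2I_1=I_3$, $I_1I_2I_3=-\mathrm{id}_H$, $g(I_s\cdot,I_s\cdot)=g(\cdot,\cdot)$ and $2g(I_sX,Y)=d\eta_s(X,Y)$ for $X,Y\in H$, $s=1,2,3$ (with $d\eta(A,B)=A\eta(B)-B\eta(A)-\eta([A,B])$). Reeb vector fields $\xi_1,\xi_2,\xi_3$ are determined by $\eta_s(\xi_k)=\delta_{sk}$, $(\xi_s\lrcorner d\eta_s)_{|H}=0$, $(\xi_s\lrcorner d\eta_k)_{|H}=-(\xi_k\lrcorner d\eta_s)_{|H}$; they exist locally if $n>1$, and in dimension seven ($n=1$) their existence is part of the definition of a qc structure. Put $V=\mathrm{span}\{\xi_1,\xi_2,\xi_3\}$,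 and extend $g$ to $TM=H\oplus V$ by $V\perp H$, $g(\xi_s,\xi_k)=\delta_{sk}$. The Biquard connection is the unique connection $\nabla$ on $M$, with torsion $T(A,B)=\nabla_AB-\nabla_BA-[A,B]$, such that: (i) $\nabla$ preserves $H\oplus V$ and the $Sp(n)Sp(1)$-structure on $H$ ($\nabla g=0$, $\nabla\sigma\in\Gamma(\mathbb{Q})$ for $\sigma\in\Gamma(\mathbb{Q})$) and $T(X,Y)=-[X,Y]_{|V}$ for $X,Y\in H$; (ii) for $\xi\in V$ the endomorphism $T(\xi,\cdot)_{|H}$ of $H$ lies in $(sp(n)\oplus sp(1))^{\perp}\subset gl(4n)$, with respect to the inner product $\langle A,B\rangle=\sum_a g(Ae_a,Be_a)$; (iii) $\nabla$ on $V$ is induced by the identification $\varphi:\xi_s\mapsto I_s$ of $V$ with $sp(1)=\mathbb{Q}$, i.e. $\nabla\varphi=0$. The quaternionic Heisenberg group $\boldsymbol{G}(\mathbb{H})=\mathbb{H}^n\times\mathrm{Im}\,\mathbb{H}$ has the group law $(q_o,\omega_o)\circ(q,\omega)=(q_o+q,\ \omega_o+\omega+2\,\mathrm{Im}(q_o\bar q))$, where $q_o\bar q=\sum_\alpha q_o^\alpha\overline{q^\alpha}$. Its standard qc structure is given by the left-invariant $\mathrm{Im}\,\mathbb{H}\cong\mathbb{R}^3$-valued contact form $\tilde\Theta=(\tilde\Theta_1,\tilde\Theta_2,\tilde\Theta_3)=\frac12(d\omega-q\cdot d\bar q+dq\cdot\bar q)$, with $H=\ker\tilde\Theta$ and $g$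 the metric on $H$ obtained from the Euclidean metric of $\mathbb{H}^n$ via the projection $(q,\omega)\mapsto q$. $\{e_1,\dots,e_{4n}\}$ is a local orthonormal basis of $H$ and repeated $e_a$ are summed. For a smooth function $f$: $\nabla^2f(A,B)=A(Bf)-(\nabla_AB)f$; $|\nabla^2f|^2=\nabla^2f(e_a,e_b)\nabla^2f(e_a,e_b)$ (horizontal Hessian); the sub-Laplacian is $\triangle f=-\nabla^2f(e_a,e_a)$. The $L^2$ norms are taken with respect to $Vol_{\tilde\Theta}=\tilde\Theta_1\wedge\tilde\Theta_2\wedge\tilde\Theta_3\wedge\omega_s^{2n}$, where $2\omega_{s|H}=d\tilde\Theta_{s|H}$, $\xi\lrcorner\omega_s=0$ for $\xi\in V$ (a constant multiple of Lebesgue/Haar measure), and $\|\nabla^2f\|_{L^2}$ means the $L^2$ norm of $|\nabla^2f|$. *)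

(* Defs.v *)
From HB Require Import structures.
From mathcomp Require Import all_boot all_order all_algebra all_fingroup.
From mathcomp Require Import all_classical all_reals all_analysis.

Set Implicit Arguments.
Unset Strict Implicit.
Unset Printing Implicit Defensive.

Import Order.TTheory GRing.Theory Num.Theory.
Import numFieldNormedType.Exports.

Local Open Scope classical_set_scope.
Local Open Scope ring_scope.

(** * Lebesgue measure on R^m, as the m-fold product measure on m-tuples *)

Section tuple_lebesgue.
Variable R : realType.

Definition tcons m (x : measurableTypeR R * m.-tuple (measurableTypeR R)) :
  m.+1.-tuple (measurableTypeR R) := [tuple of x.1 :: x.2].

Lemma measurable_tcons m : measurable_fun setT (@tcons m).
Proof. exact: measurable_cons. Qed.

Section cons.
Variables (m : nat)
  (mu : {sigma_finite_measure set (m.-tuple (measurableTypeR R)) -> \bar R}).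

Let prod_lebesgue : {measure set
    (measurableTypeR R * m.-tuple (measurableTypeR R))%type -> \bar R} :=
  (@lebesgue_measure R \x mu)%E.

Definition cons_lebesgue : set (m.+1.-tuple (measurableTypeR R)) -> \bar R :=
  pushforward (@lebesgue_measure R \x mu)%E (@tcons m).

Let push_lebesgue : {measure set (m.+1.-tuple (measurableTypeR R)) -> \bar R} :=
  measure_function_pushforward__canonical__measure_function_Measure
    prod_lebesgue (@measurable_tcons m).

Let cons0 : cons_lebesgue set0 = 0%E.
Proof. exact: (measure0 push_lebesgue). Qed.

Let cons_ge0 A : (0 <= cons_lebesgue A)%E.
Proof. exact: (measure_ge0 push_lebesgue). Qed.

Let cons_sigma_additive : semi_sigma_additive cons_lebesgue.
Proof. exact: (@measure_semi_sigma_additive _ _ _ push_lebesgue). Qed.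

HB.instance Definition _ := isMeasure.Build _ _ _ cons_lebesgue
  cons0 cons_ge0 cons_sigma_additive.

Let cons_sigma_finite : sigma_finite setT cons_lebesgue.
Proof.
have /sigma_finiteP[F [TF ndF Foo]] := sigma_finiteT (@lebesgue_measure R).
have /sigma_finiteP[G [TG ndG Goo]] := sigma_finiteT mu.
pose uncons (t : m.+1.-tuple (measurableTypeR R)) :
  measurableTypeR R * m.-tuple (measurableTypeR R) :=
  (tnth t ord0, [tuple of behead t]).
have munc : measurable_fun setT uncons.
  by apply/measurable_fun_pairP; split;
    [exact: measurable_tnth|exact: measurable_behead].
have unK : cancel (@tcons m) uncons by case=> x t; congr pair; apply/val_inj.
exists (fun k => uncons @^-1` (F k `*` G k)).
  rewrite -preimage_bigcup -[LHS](preimage_setT uncons); congr (_ @^-1` _).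
  rewrite -setXTT TF TG predeqE => -[x y]; split.
    move=> [/= [k _ Fkx] [l _ Gly]]; exists (maxn k l) => //; split.
    - by move: x Fkx; exact/subsetPset/ndF/leq_maxl.
    - by move: y Gly; exact/subsetPset/ndG/leq_maxr.
  by move=> [k _ []/= ? ?]; split; exists k.
move=> k; have [mF Fk] := Foo k; have [mG Gk] := Goo k; split.
  by rewrite -[X in measurable X]setTI; apply: munc => //; exact: measurableX.
rewrite /cons_lebesgue /pushforward -comp_preimage.
rewrite (_ : uncons \o _ = id); last by apply/funext => x; exact: unK.
by rewrite preimage_id product_measure1E// lte_mul_pinfty// ge0_fin_numE.
Qed.

HB.instance Definition _ := Measure_isSigmaFinite.Build _ _ _ cons_lebesgue
  cons_sigma_finite.
End cons.

Fixpoint tuple_lebesgue m :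
    {sigma_finite_measure set (m.-tuple (measurableTypeR R)) -> \bar R} :=
  match m with
  | 0 => \d_ [tuple]
  | m'.+1 => cons_lebesgue (tuple_lebesgue m')
  end.
End tuple_lebesgue.

(** * Calculus on R^N; vectors tangent to R^N at any point are elements of R^N *)

Section calculus.
Variables (R : realType) (N : nat).
Local Notation U := 'rV[R]_N.

Fixpoint Ck (W : normedModType R) (k : nat) (f : U -> W) : Prop :=
  match k with
  | 0 => continuous f
  | k'.+1 => (forall p, differentiable f p) /\
             forall v, Ck k' (fun p => 'D_v f p)
  end.

Definition smooth (W : normedModType R) (f : U -> W) := forall k, Ck k f.

Definition compactly_supported (f : U -> R) :=
  compact (closure [set p | f p != 0]).

Definition vfield := U -> U.
Definition form1 := U -> U -> R.

(* [lie A f] is A f; for a vector field f it is taken componentwise *)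
Definition lie (W : normedModType R) (A : vfield) (f : U -> W) : U -> W :=
  fun p => 'D_(A p) f p.

Definition bracket (A B : vfield) : vfield := fun p => lie A B p - lie B A p.

Definition dform (eta : form1) (A B : vfield) : U -> R := fun p =>
  lie A (fun x => eta x (B x)) p - lie B (fun x => eta x (A x)) p
  - eta p (bracket A B p).

(* d eta at the point p: d eta being tensorial, the vectors u and v may be
   extended to constant vector fields *)
Definition dform_at (eta : form1) (p u v : U) : R :=
  dform eta (cst u) (cst v) p.

Definition is_connection (nabla : vfield -> vfield -> vfield) : Prop :=
  [/\ forall A B, smooth A -> smooth B -> smooth (nabla A B),
      forall A A' B, smooth A -> smooth A' -> smooth B ->
        nabla (A \+ A') B = nabla A B \+ nabla A' B,
      forall (h : U -> R) A B, smooth h -> smooth A -> smooth B ->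
        nabla (fun p => h p *: A p) B = fun p => h p *: nabla A B p,
      forall A B B', smooth A -> smooth B -> smooth B' ->
        nabla A (B \+ B') = nabla A B \+ nabla A B' &
      forall (h : U -> R) A B, smooth h -> smooth A -> smooth B ->
        nabla A (fun p => h p *: B p) =
          fun p => lie A h p *: B p + h p *: nabla A B p].

Definition torsion (nabla : vfield -> vfield -> vfield) (A B : vfield) :
  vfield := fun p => nabla A B p - nabla B A p - bracket A B p.

(* the Hessian of f with respect to nabla *)
Definition hessian (nabla : vfield -> vfield -> vfield) (f : U -> R)
    (A B : vfield) : U -> R :=
  fun p => lie A (lie B f) p - lie (nabla A B) f p.

End calculus.

(** * Quaternionic contact structures and the Biquard connection *)

(* Endomorphisms of R^N are matrices acting on row vectors on the right, so the
   composite S o T is T *m S.  An endomorphism of H is represented by any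
   endomorphism of the tangent space which preserves H: only its restriction
   to H matters. *)

Section quaternionic_contact.
Variables (R : realType) (N r : nat).
Local Notation U := 'rV[R]_N.

(* r is the rank of H *)
Variables (eta : 'I_3 -> form1 R N) (g : U -> U -> U -> R).
Variables (I : 'I_3 -> U -> 'M[R]_N) (xi : 'I_3 -> vfield R N).

Definition horizontal (p v : U) := forall s, eta s p v = 0.

Definition hfield (X : vfield R N) :=
  smooth X /\ forall p, horizontal p (X p).

Definition horizontal_frame (e : 'I_r -> vfield R N) :=
  (forall a, hfield (e a)) /\
  forall a b p, g p (e a p) (e b p) = (a == b)%:R.

Definition preserves_H (p : U) (S : 'M[R]_N) :=
  forall v, horizontal p v -> horizontal p (v *m S).

Record qc_almost_complex : Prop := {
  acs_smooth : forall s, smooth (I s);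
  acs_H : forall s p, preserves_H p (I s p);
  acs_sq : forall s p v, horizontal p v -> v *m I s p *m I s p = - v;
  acs_I1I2 : forall p v, horizontal p v -> v *m I 1 p *m I 0 p = v *m I 2 p;
  acs_I2I1 : forall p v, horizontal p v -> v *m I 0 p *m I 1 p = - (v *m I 2 p);
  acs_I1I2I3 : forall p v, horizontal p v ->
    v *m I 2 p *m I 1 p *m I 0 p = - v;
  acs_isometry : forall s p u v, horizontal p u -> horizontal p v ->
    g p (u *m I s p) (v *m I s p) = g p u v;
  acs_compat : forall s p u v, horizontal p u -> horizontal p v ->
    2 * g p (u *m I s p) v = dform_at (eta s) p u v }.

Record reeb_fields : Prop := {
  reeb_smooth : forall s, smooth (xi s);
  reeb_dual : forall s k p, eta s p (xi k p) = (s == k)%:R;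
  reeb_contract : forall s p v, horizontal p v ->
    dform_at (eta s) p (xi s p) v = 0;
  reeb_skew : forall s k p v, horizontal p v ->
    dform_at (eta k) p (xi s p) v = - dform_at (eta s) p (xi k p) v }.

Definition vertical (p v : U) :=
  exists c : 'I_3 -> R, v = \sum_s c s *: xi s p.

Definition vfield_V (X : vfield R N) :=
  smooth X /\ forall p, vertical p (X p).

Definition proj_V (p v : U) : U := \sum_s eta s p v *: xi s p.

Definition proj_H (p v : U) : U := v - proj_V p v.

(* the section of the bundle Q with coefficients a *)
Definition Qsection (a : 'I_3 -> U -> R) (p : U) : 'M[R]_N :=
  \sum_s a s p *: I s p.

(* phi : V -> Q, xi_s |-> I_s *)
Definition phi (X : vfield R N) : U -> 'M[R]_N :=
  Qsection (fun s p => eta s p (X p)).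

(* [nabla_endo nabla A sigma B] is (nabla_A sigma) B *)
Definition nabla_endo (nabla : vfield R N -> vfield R N -> vfield R N)
    (A : vfield R N) (sigma : U -> 'M[R]_N) (B : vfield R N) : vfield R N :=
  fun p => nabla A (fun x => B x *m sigma x) p - nabla A B p *m sigma p.

Definition in_spn (p : U) (S : 'M[R]_N) : Prop :=
  [/\ preserves_H p S,
      forall u v, horizontal p u -> horizontal p v ->
        g p (u *m S) v = - g p u (v *m S) &
      forall s v, horizontal p v -> v *m S *m I s p = v *m I s p *m S].

Definition in_sp1 (p : U) (S : 'M[R]_N) : Prop :=
  exists c : 'I_3 -> R, forall v, horizontal p v ->
    v *m S = \sum_s c s *: (v *m I s p).

Definition in_spn_sp1 (p : U) (S : 'M[R]_N) : Prop :=
  exists S0 S1, [/\ in_spn p S0, in_sp1 p S1 & S = S0 + S1].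

Record biquard_connection
    (nabla : vfield R N -> vfield R N -> vfield R N) : Prop := {
  bq_connection : is_connection nabla;
  bq_H : forall A X, smooth A -> hfield X -> hfield (nabla A X);
  bq_V : forall A X, smooth A -> vfield_V X -> vfield_V (nabla A X);
  bq_metric : forall A X Y, smooth A -> hfield X -> hfield Y -> forall p,
    lie A (fun x => g x (X x) (Y x)) p =
      g p (nabla A X p) (Y p) + g p (X p) (nabla A Y p);
  bq_Q : forall A a, smooth A -> (forall s, smooth (a s)) ->
    exists b : 'I_3 -> U -> R, (forall s, smooth (b s)) /\
      forall X, hfield X -> forall p,
        nabla_endo nabla A (Qsection a) X p = X p *m Qsection b p;
  bq_torsion_HH : forall X Y, hfield X -> hfield Y -> forall p,
    torsion nabla X Y p = - proj_V p (bracket X Y p);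
  bq_torsion_VH : forall Z X, vfield_V Z -> hfield X -> forall p,
    horizontal p (torsion nabla Z X p);
  bq_torsion_perp : forall Z e, vfield_V Z -> horizontal_frame e ->
    forall p S, in_spn_sp1 p S ->
      \sum_a g p (torsion nabla Z (e a) p) (e a p *m S) = 0;
  bq_phi : forall A Z X, smooth A -> vfield_V Z -> hfield X -> forall p,
    nabla_endo nabla A (phi Z) X p = X p *m phi (nabla A Z) p }.

Definition sub_laplacian (nabla : vfield R N -> vfield R N -> vfield R N)
    (e : 'I_r -> vfield R N) (f : U -> R) (p : U) : R :=
  - \sum_a hessian nabla f (e a) (e a) p.

Definition hessian_norm (nabla : vfield R N -> vfield R N -> vfield R N)
    (e : 'I_r -> vfield R N) (f : U -> R) (p : U) : R :=
  Num.sqrt (\sum_a \sum_b hessian nabla f (e a) (e b) p ^+ 2).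

(* the 2-form omega_s *)
Definition fund_form (s : 'I_3) (p u v : U) : R :=
  2^-1 * dform_at (eta s) p (proj_H p u) (proj_H p v).

End quaternionic_contact.

(** * The quaternionic Heisenberg group *)

(* a quaternion t + ix + jy + kz is the row (t, x, y, z) *)
Section quaternions.
Variable R : realType.

Definition qmul (x y : 'rV[R]_4) : 'rV[R]_4 := \row_k
  [:: x 0 0 * y 0 0 - x 0 1 * y 0 1 - x 0 2 * y 0 2 - x 0 3 * y 0 3;
      x 0 0 * y 0 1 + x 0 1 * y 0 0 + x 0 2 * y 0 3 - x 0 3 * y 0 2;
      x 0 0 * y 0 2 - x 0 1 * y 0 3 + x 0 2 * y 0 0 + x 0 3 * y 0 1;
      x 0 0 * y 0 3 + x 0 1 * y 0 2 - x 0 2 * y 0 1 + x 0 3 * y 0 0]`_k.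

Definition qconj (x : 'rV[R]_4) : 'rV[R]_4 := \row_k
  if k == 0 then x 0 k else - x 0 k.

Definition qim (x : 'rV[R]_4) : 'rV[R]_3 := \row_k x 0 (lift ord0 k).

End quaternions.

Section heisenberg.
Variables (R : realType) (n : nat).

(* A point (q, omega) of H^n x Im H is the row made of the 3 coordinates of
   omega, followed by the 4 coordinates of q^1, ..., the 4 coordinates of q^n. *)
Local Notation G := 'rV[R]_(3 + n * 4).

Definition omega (p : G) : 'rV[R]_3 := lsubmx p.
Definition quat (p : G) (alpha : 'I_n) : 'rV[R]_4 := row alpha (vec_mx (rsubmx p)).

Definition heis_mul (p0 p : G) : G :=
  row_mx (omega p0 + omega p +
          2 *: qim (\sum_alpha qmul (quat p0 alpha) (qconj (quat p alpha))))
         (rsubmx p0 + rsubmx p).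

(* (d omega - q . d qbar + dq . qbar) / 2, at p, applied to the vector v *)
Definition Theta_im (p v : G) : 'rV[R]_3 :=
  2^-1 *: (omega v + qim (\sum_alpha
    (- qmul (quat p alpha) (qconj (quat v alpha))
     + qmul (quat v alpha) (qconj (quat p alpha))))).

Definition Theta (s : 'I_3) : form1 R (3 + n * 4) := fun p v => Theta_im p v 0 s.

Definition heis_metric (p u v : G) : R :=
  \sum_alpha \sum_i quat u alpha 0 i * quat v alpha 0 i.

Section volume.
Variables (xi : 'I_3 -> vfield R (3 + n * 4)) (s : 'I_3).

(* Theta_1 /\ Theta_2 /\ Theta_3 /\ omega_s^(2n), evaluated on 4n + 3 vectors;
   the factor 2 ^- (2n) is the one in
   (alpha /\ beta) (v_1, ..., v_(k+l)) =
     1 / (k! l!) \sum_sigma sgn sigma * alpha (..) * beta (..) *)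
Definition vol_form (p : G) (v : 'I_(3 + n * 4) -> G) : R :=
  2 ^- (2 * n) * \sum_(sigma : 'S_(3 + n * 4)) (-1) ^+ sigma *
    (\prod_(k < 3) Theta k p (v (sigma (inord k)))) *
    \prod_(j < 2 * n) fund_form Theta xi s p
      (v (sigma (inord (3 + 2 * j)))) (v (sigma (inord (4 + 2 * j)))).

Definition vol_density (p : G) : R :=
  `|vol_form p (fun j => delta_mx 0 j)|.

Definition L2norm (F : G -> R) : \bar R :=
  ((\int[tuple_lebesgue R (3 + n * 4)]_t
      (let p : G := \row_j tnth t j in vol_density p * F p ^+ 2)%:E)
   `^ (2^-1))%E.

End volume.
End heisenberg.

(* Main.v *)
Require Import Defs.
From mathcomp Require Import all_boot all_order all_algebra all_fingroup.
From mathcomp Require Import all_classical all_reals all_analysis.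
From mathcomp Require Import measurable_realfun zify ring lra.

(** On a group R^a x R^m with left-invariant fields X_k and central fields Z_s satisfying
    [X_k, X_l] = 4 sum_s B^s_kl Z_s for matrices B^s which are skew and obey the Clifford relations
    B^s B^t + B^t B^s = -2 delta_st, integration by parts gives, with L = sum_k X_k^2,
      |Hess f|^2 = |Lf|^2 + 16 m sum_s |Z_s f|^2    in L^2,
    so that it remains to see that 4 m^2 sum_s |Z_s f|^2 <= |Lf|^2.  For functions of frequency lam in the
    central variables, Z_s acts as i lam_s, and the square of the Cauchy-Riemann operator
    X + |lam|^-1 (lam . B) i X shows that -L >= 2 m |lam|, hence |Lf|^2 >= 4 m^2 |lam|^2 |f|^2.  Instead of
    a Fourier transform, one uses the correlation function Psi(h) = int u(p) v(p + h) dp, h central: its cosine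
    transforms are positive semidefinite forms for which Z_s Z_t acts as - lam_s lam_t, and a function in
    C_c(R^a) whose cosine transforms are all nonnegative is nonnegative at 0, as the powers of the trigonometric
    polynomial 1 + sum_s (1 + cos (c h_s)) concentrate at 0.
    On the quaternionic Heisenberg group a = 3 and m = 4n, so the constant is 1 + 16 m / (4 m^2) = 1 + 1/n;
    Koszul's argument shows that the left-invariant horizontal fields are parallel along H. *)

Import Order.TTheory GRing.Theory Num.Theory.
Import numFieldNormedType.Exports.
Local Open Scope ring_scope.

Set Implicit Arguments.
Unset Strict Implicit.
Unset Printing Implicit Defensive.
Local Open Scope classical_set_scope.

(** * Integration of continuous functions with compact support on R^N *)

(** The complex structure |lam|^-1 (lam . B) depends on the frequency, and |lam| is not a
    differential operator, so no single square of a first-order operator on the group bounds sum_s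
    |Z_s f|^2: the estimate has to be made one frequency at a time. All that is asked of a frequency
    is a positive semidefinite symmetric form for which the X_k are skew and products of the Z_s act
    as scalars; letting Z_s play the part of i keeps everything real. The return to L^2 needs only
    the sign of Psi(0), where Psi is the difference of the correlations of the two sides, and this
    is weaker than Plancherel or an inversion formula. Integrals are confined to continuous
    functions with bounded support, a class stable under products, slices, partial integrals and
    translations, on which Fubini and translation invariance carry no side conditions. The
    connection, the Reeb fields and the horizontal frame are arbitrary objects with the defining
    properties: the Reeb fields are shown to be tangent to the center by inverting B^s, and the
    frame is compared with the left-invariant one by an orthogonal matrix at each point. *)

Section row_norm.
Context {R : realType}.

Lemma row_norm_leP N (p : 'rV[R]_N) (M : R) : 0 <= M ->
  reflect (forall j, `|p 0 j| <= M) (`|p| <= M).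
Proof.
move=> M0; rewrite [`|p|]/Num.Def.normr/= mx_normrE; apply: (iffP idP) => [pM j|pM].
  apply: le_trans pM.
  exact: (le_bigmax _ (fun ij : 'I_1 * 'I_N => `|p ij.1 ij.2|) (0, j)).
by apply/bigmax_leP; split=> // -[i j] _ /=; rewrite ord1.
Qed.

Lemma coord_le_norm N (p : 'rV[R]_N) j : `|p 0 j| <= `|p|.
Proof. exact: (row_norm_leP _ (normr_ge0 p) _). Qed.

End row_norm.

Section measurability.
Context {R : realType}.

Definition mkrow N (t : N.-tuple (measurableTypeR R)) : 'rV[R]_N :=
  \row_j tnth t j.

(** The sigma-algebra on tuples is the product one, generated by the coordinates. The preimage of an
    open ray is the union of the cubes with rational centre and radius 1 / (k + 1) that it contains,
    and these are countably many. *)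
Lemma measurable_continuous_row N (F : 'rV[R]_N -> R) : continuous F ->
  measurable_fun setT (fun t : N.-tuple (measurableTypeR R) => F (mkrow t)).
Proof.
move=> cF; apply: (measurability _ (RGenOInfty.measurableE R)).
move=> _ [_ [c ->] <-]; rewrite setTI.
pose box (ck : 'rV[rat]_N * nat) := [set t : N.-tuple (measurableTypeR R) |
  forall j, `|tnth t j - ratr (ck.1 0 j)| < ck.2.+1%:R^-1].
have mbox ck : measurable (box ck).
  rewrite (_ : box ck = \bigcap_(j in [set: 'I_N])
      ((fun t : N.-tuple (measurableTypeR R) => tnth t j) @^-1`
       (ball (ratr (ck.1 0 j) : R) ck.2.+1%:R^-1))); last first.
    apply/seteqP; split=> t /= h j; first by move=> _; rewrite /ball/= distrC; apply: h.
    by have := h j I; rewrite /ball/= distrC.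
  apply: fin_bigcap_measurable => // j _.
  rewrite -[X in measurable X]setTI; apply: measurable_tnth => //.
  exact: measurable_ball.
rewrite (_ : _ @^-1` _ =
    \bigcup_(ck in [set ck | box ck `<=`
       [set t | F (mkrow t) \in `]c, +oo[%classic ]]) box ck).
  rewrite bigcup_mkcond; apply: countable_bigcupT_measurable => // ck.
  by case: ifP => // _; exact: mbox.
apply/seteqP; split=> [t /= tF|t /= [ck h] /h]; last by rewrite /= inE.
have /cF : nbhs (F (mkrow t)) [set x | c < x].
  by apply: open_nbhs_nbhs; split; [exact: open_gt|move: tF; rewrite in_itv/= andbT].
move=> /nbhs_ballP[e/= e0 eF].
have [k ke] : exists k : nat, k.+1%:R^-1 < e / 2.
  have := archi_boundP (ltW (divr_gt0 (ltr0n _ 2) e0) : 0 <= 2 / e).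
  set k := Num.bound _ => hk; exists k.
  rewrite -[ltRHS]invrK ltf_pV2 ?posrE ?invr_gt0 ?divr_gt0// invf_div.
  by apply: (lt_trans hk); rewrite ltr_nat.
have /choice[r hr] : forall j, exists r : rat, `|tnth t j - ratr r| < k.+1%:R^-1.
  move=> j; have : tnth t j - k.+1%:R^-1 < tnth t j + k.+1%:R^-1.
    by rewrite ltrBlDr -addrA ltrDl addr_gt0// invr_gt0.
  move=> /rat_in_itvoo[r]; rewrite in_itv/= => /andP[h1 h2]; exists r.
  by rewrite distrC ltr_distl h1 h2.
exists (\row_j r j, k) => /=; last by move=> j; rewrite mxE.
move=> u /= hu; rewrite /= inE/= in_itv/= andbT; apply: eF; split => // i j.
rewrite ord1 /ball/= !mxE (splitr e).
have := hu j; have := hr j; rewrite mxE => h1 h2.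
apply: le_lt_trans (ler_distD (ratr (r j)) _ _) _.
by apply: ltrD; [|rewrite distrC]; exact: lt_trans ke.
Qed.

End measurability.

Section Cc.
Context {R : realType}.

(** [M] may be negative, in which case [F] vanishes identically; hence the [|M|] in later bounds. *)
Definition Cc N (F : 'rV[R]_N -> R) :=
  continuous F /\ exists M, forall p, F p != 0 -> `|p| <= M.

Definition rint N (F : 'rV[R]_N -> R) : R :=
  (\int[tuple_lebesgue R N]_t F (mkrow t))%R.

Lemma Cc0 N : Cc (fun _ : 'rV[R]_N => 0).
Proof. by split; [move=> p; exact: cst_continuous|exists 0 => p; rewrite eqxx]. Qed.

Lemma CcD N (F G : 'rV[R]_N -> R) : Cc F -> Cc G -> Cc (fun p => F p + G p).
Proof.
move=> [cF [M hM]] [cG [M' hM']]; split; first by move=> p; apply: continuousD; [exact: cF|exact: cG].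
exists (Num.max M M') => p; rewrite le_max.
have [F0|/hM->//] := eqVneq (F p) 0.
by rewrite F0 add0r => /hM' ->; rewrite orbT.
Qed.

Lemma CcMl N (g F : 'rV[R]_N -> R) : continuous g -> Cc F ->
  Cc (fun p => g p * F p).
Proof.
move=> cg [cF [M hM]]; split; first by move=> p; apply: continuousM; [exact: cg|exact: cF].
by exists M => p; rewrite mulf_eq0 negb_or => /andP[_ /hM].
Qed.

Lemma CcMr N (F g : 'rV[R]_N -> R) : Cc F -> continuous g ->
  Cc (fun p => F p * g p).
Proof. by move=> CF cg; under eq_fun do rewrite mulrC; exact: CcMl. Qed.

Lemma CcM N (F g : 'rV[R]_N -> R) : Cc F -> Cc g -> Cc (fun p => F p * g p).
Proof. by move=> CF [cg _]; exact: CcMr. Qed.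

Lemma CcZ N (a : R) (F : 'rV[R]_N -> R) : Cc F -> Cc (fun p => a * F p).
Proof. by apply: CcMl => p; exact: cst_continuous. Qed.

Lemma CcN N (F : 'rV[R]_N -> R) : Cc F -> Cc (fun p => - F p).
Proof. by move=> /(CcZ (-1)); under eq_fun do rewrite mulN1r. Qed.

Lemma Cc_sum N (J : Type) (r : seq J) (P : pred J) (F : J -> 'rV[R]_N -> R) :
  (forall j, Cc (F j)) -> Cc (fun p => \sum_(j <- r | P j) F j p).
Proof.
move=> CF; elim: r => [|j r ih].
  by under eq_fun do rewrite big_nil; exact: Cc0.
under eq_fun do rewrite big_cons.
by case: (P j) => //; exact: CcD.
Qed.

Lemma Cc_bounded N (F : 'rV[R]_N -> R) : Cc F ->
  exists2 B, 0 <= B & forall p, `|F p| <= B.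
Proof.
move=> [cF [M hM]].
have : compact (F @` [set p | `|p| <= `|M|]).
  apply: continuous_compact; first exact: continuous_subspaceT.
  apply: bounded_closed_compact; first by exists `|M|; split=> // x Mx p /= /le_trans; apply; exact: ltW.
  rewrite (_ : [set _ | _] = (fun p => `|p|) @^-1` [set x | x <= `|M|]) //.
  apply: closed_comp; last exact: closed_le.
  by move=> p _; exact: norm_continuous.
move=> /compact_bounded[B [_ hB]]; exists (`|B| + 1); first by rewrite addr_ge0.
move=> p; have [->|Fp] := eqVneq (F p) 0; first by rewrite normr0 addr_ge0.
apply: hB; first by rewrite ltr_pwDr// ler_norm.
by exists p => //=; apply: (le_trans (hM _ Fp)); exact: ler_norm.
Qed.

Definition box N (M : R) :=
  [set t : N.-tuple (measurableTypeR R) | forall j, `|tnth t j| <= M].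
Arguments box : clear implicits.

Lemma measurable_box N M : measurable (box N M).
Proof.
rewrite (_ : box N M = \bigcap_(j in [set: 'I_N])
    ((fun t : N.-tuple (measurableTypeR R) => tnth t j) @^-1` `[-M, M])).
  apply: fin_bigcap_measurable => // j _.
  by rewrite -[X in measurable X]setTI; exact: measurable_tnth.
apply/seteqP; split=> t /= h j; first by move=> _; rewrite /= in_itv/= -ler_norml; exact: h.
by have /= := h j I; rewrite ?in_itv/= -ler_norml.
Qed.

Lemma box_lt_pinfty N M : (tuple_lebesgue R N (box N M) < +oo)%E.
Proof.
elim: N => [|N ih]; first by rewrite /= diracE ltry.
rewrite [ltLHS](_ : _ = (@lebesgue_measure R \x tuple_lebesgue R N)%E
   (`[-M, M] `*` box N M)).
  rewrite product_measure1E//; last exact: measurable_box.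
  apply: lte_mul_pinfty => //.
    by rewrite ge0_fin_numE//= lebesgue_measure_itv/=; case: ifP => _; rewrite ?ltry// -EFinB ltry.
rewrite /= /cons_lebesgue /pushforward; apply: (congr1 (@lebesgue_measure R \x tuple_lebesgue R N)%E).
apply/seteqP; split=> -[x t] /=.
  move=> h; split=> [|j].
    by have := h ord0; rewrite ?in_itv/= -ler_norml (tnth_nth 0).
  by have := h (lift ord0 j); rewrite tnthS.
move=> [hx ht] j; have [k ->|->] := unliftP ord0 j.
  by rewrite tnthS; exact: ht.
by rewrite (tnth_nth 0)/= ler_norml; move: hx; rewrite in_itv.
Qed.

Lemma Cc_integrable N (F : 'rV[R]_N -> R) : Cc F ->
  (tuple_lebesgue R N).-integrable setT
    (fun t => (F (mkrow t))%:E).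
Proof.
move=> CF; have [B B0 hB] := Cc_bounded CF; have [cF [M hM]] := CF.
have := measurable_continuous_row cF => mF.
have FE : (fun t : N.-tuple (measurableTypeR R) => (F (mkrow t))%:E) =
   (fun t => (F (mkrow t))%:E) \_ (box N `|M|).
  apply/funext => t; rewrite patchE; case: ifPn => // /negP tM.
  have [->//|/hM FM] := eqVneq (F (mkrow t)) 0; exfalso; apply: tM.
  rewrite inE /= => j; have -> : tnth t j = mkrow t 0 j by rewrite mxE.
  by apply: le_trans (coord_le_norm _ _) _; apply: (le_trans FM); exact: ler_norm.
rewrite FE; apply/integrable_restrict => //; first exact: measurable_box.
rewrite setTI; apply: measurable_bounded_integrable => //.
- exact: measurable_box.
- exact: box_lt_pinfty.
- exact: measurable_funTS.
- exists B; split; first exact: num_real.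
  move=> x Bx t _ /=; apply: le_trans (ltW Bx); exact: hB.
Qed.

Lemma eq_rint N (F G : 'rV[R]_N -> R) : F =1 G -> rint F = rint G.
Proof. by move=> /funext->. Qed.

Lemma rintD N (F G : 'rV[R]_N -> R) : Cc F -> Cc G ->
  rint (fun p => F p + G p) = rint F + rint G.
Proof. by move=> CF CG; rewrite /rint RintegralD//; exact: Cc_integrable. Qed.

Lemma rintZ N a (F : 'rV[R]_N -> R) : Cc F -> rint (fun p => a * F p) = a * rint F.
Proof. by move=> CF; rewrite /rint RintegralZl//; exact: Cc_integrable. Qed.

Lemma rintN N (F : 'rV[R]_N -> R) : Cc F -> rint (fun p => - F p) = - rint F.
Proof. by move=> CF; rewrite -mulN1r -rintZ//; apply: eq_rint => p; rewrite mulN1r. Qed.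

Lemma rint0 N : rint (fun _ : 'rV[R]_N => 0) = 0.
Proof. by rewrite /rint Rintegral_cst// mul0r. Qed.

Lemma rintB N (F G : 'rV[R]_N -> R) : Cc F -> Cc G ->
  rint (fun p => F p - G p) = rint F - rint G.
Proof. by move=> CF CG; rewrite rintD ?rintN//; exact: CcN. Qed.

Lemma rint_sum N (J : Type) (r : seq J) (P : pred J) (F : J -> 'rV[R]_N -> R) :
  (forall j, Cc (F j)) ->
  rint (fun p => \sum_(j <- r | P j) F j p) = \sum_(j <- r | P j) rint (F j).
Proof.
move=> CF; elim: r => [|j r ih].
  by rewrite big_nil -[RHS](rint0 N); apply: eq_rint => p; rewrite big_nil.
under eq_rint do rewrite big_cons.
by rewrite big_cons; case: (P j) => //; rewrite rintD ?ih//; exact: Cc_sum.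
Qed.

Lemma le_rint N (F G : 'rV[R]_N -> R) : Cc F -> Cc G ->
  (forall p, F p <= G p) -> rint F <= rint G.
Proof. by move=> CF CG FG; apply: le_Rintegral => //; exact: Cc_integrable. Qed.

Lemma rint_ge0 N (F : 'rV[R]_N -> R) : (forall p, 0 <= F p) -> 0 <= rint F.
Proof. by move=> F0; apply: Rintegral_ge0. Qed.

Lemma rintE N (F : 'rV[R]_N -> R) : Cc F ->
  (\int[tuple_lebesgue R N]_t (F (mkrow t))%:E)%E = (rint F)%:E.
Proof.
by move=> CF; rewrite /rint /Rintegral fineK//; apply: integrable_fin_num => //; exact: Cc_integrable.
Qed.

Lemma continuous_rowP (T : topologicalType) N (g : T -> 'rV[R]_N) :
  (forall j, continuous (fun p => g p 0 j)) -> continuous g.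
Proof.
move=> cg p; apply/cvgrPdist_le => e e0; near=> q.
apply/row_norm_leP => [|j]; first exact: ltW.
rewrite !mxE; move: j; near: q; apply: filter_forall => j.
by have /cvgrPdist_le/(_ _ e0) := cg j p.
Unshelve. all: by end_near. Qed.

Lemma continuous_row_mx (T : topologicalType) a b (g : T -> 'rV[R]_a)
    (h : T -> 'rV[R]_b) : continuous g -> continuous h ->
  continuous (fun p => row_mx (g p) (h p)).
Proof.
move=> cg ch; apply: continuous_rowP => j; under eq_fun do rewrite mxE.
case: splitP => k _ p.
- apply: (@continuous_comp _ _ _ g (fun x : 'rV[R]_a => x 0 k)); [exact: cg|exact: coord_continuous].
- apply: (@continuous_comp _ _ _ h (fun x : 'rV[R]_b => x 0 k)); [exact: ch|exact: coord_continuous].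
Qed.

Lemma norm_row_mxl a b (x : 'rV[R]_a) (y : 'rV[R]_b) : `|x| <= `|row_mx x y|.
Proof.
apply/row_norm_leP => // j.
by have := coord_le_norm (row_mx x y) (lshift b j); rewrite row_mxEl.
Qed.

Lemma norm_row_mxr a b (x : 'rV[R]_a) (y : 'rV[R]_b) : `|y| <= `|row_mx x y|.
Proof.
apply/row_norm_leP => // j.
by have := coord_le_norm (row_mx x y) (rshift a j); rewrite row_mxEr.
Qed.

Lemma norm_row_mx_le a b (x : 'rV[R]_a) (y : 'rV[R]_b) M :
  `|x| <= M -> `|y| <= M -> `|row_mx x y| <= M.
Proof.
move=> xM yM; have M0 : 0 <= M by apply: le_trans xM.
apply/row_norm_leP => // j; rewrite mxE; case: splitP => k _.
- exact: le_trans (coord_le_norm _ _) xM.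
- exact: le_trans (coord_le_norm _ _) yM.
Qed.

Lemma Cc_comp N N' (F : 'rV[R]_N' -> R) (g : 'rV[R]_N -> 'rV[R]_N') :
  Cc F -> continuous g -> (forall M, exists M', forall p, `|g p| <= M -> `|p| <= M') ->
  Cc (fun p => F (g p)).
Proof.
move=> [cF [M hM]] cg pg; split.
  by move=> p; apply: continuous_comp; [exact: cg|exact: cF].
by have [M' hM'] := pg M; exists M' => p /hM /hM'.
Qed.

Lemma Cc_slice a b (F : 'rV[R]_(a + b) -> R) x : Cc F ->
  Cc (fun y => F (row_mx x y)).
Proof.
move=> CF; apply: Cc_comp => //.
  by apply: continuous_row_mx => p; [exact: cst_continuous|exact: cvg_id].
by move=> M; exists M => p; apply: le_trans; exact: norm_row_mxr.
Qed.

Lemma Cc_slicer a b (F : 'rV[R]_(a + b) -> R) y : Cc F ->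
  Cc (fun x => F (row_mx x y)).
Proof.
move=> CF; apply: Cc_comp => //.
  by apply: continuous_row_mx => p; [exact: cvg_id|exact: cst_continuous].
by move=> M; exists M => p; apply: le_trans; exact: norm_row_mxl.
Qed.

Lemma compact_norm_le N (M : R) : compact [set p : 'rV[R]_N | `|p| <= M].
Proof.
apply: bounded_closed_compact.
  exists M; split; first exact: num_real.
  by move=> x Mx p /= /le_trans; apply; exact: ltW.
apply: (@closed_comp _ _ (fun p : 'rV[R]_N => `|p|) [set x | x <= M]); last exact: closed_le.
by move=> p _; exact: norm_continuous.
Qed.

(** A continuous majorant of the indicator of the ball of radius [M]: it turns a constant bound on
    the ball into an integrable bound within the class [Cc]. *)
Definition tent N (M : R) (p : 'rV[R]_N) : R := Num.max 0 (M + 1 - `|p|).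

Lemma Cc_tent N M : Cc (@tent N M).
Proof.
split.
  move=> p; apply: (@continuous_max _ _ (fun=> 0) (fun q => M + 1 - `|q|)); first exact: cst_continuous.
  by apply: continuousB; [exact: cst_continuous|exact: norm_continuous].
exists (M + 1) => p; rewrite /tent; case: (leP 0 (M + 1 - `|p|)) => [h _|_]; last by rewrite eqxx.
by rewrite -subr_ge0.
Qed.

Lemma tent_ge0 N M (p : 'rV[R]_N) : 0 <= tent M p.
Proof. by rewrite /tent le_max lexx. Qed.

Lemma tent_ge1 N M (p : 'rV[R]_N) : `|p| <= M -> 1 <= tent M p.
Proof. by move=> pM; rewrite /tent le_max; apply/orP; right; rewrite -lerBlDr addrC; lra. Qed.

(** Continuity in the parameter: compactness of the ball of radius [M] makes the integrands
    uniformly close there, and both vanish outside it, so that their difference is at most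
    [e / C * tent M]. *)
Lemma Cc_rint a b (F : 'rV[R]_(a + b) -> R) : Cc F ->
  Cc (fun x : 'rV[R]_a => rint (fun y : 'rV[R]_b => F (row_mx x y))).
Proof.
move=> CF; have [cF [M hM]] := CF; split; last first.
  exists M => x; apply: contraNT; rewrite -ltNge => Mx.
  rewrite -[X in _ == X](rint0 b); apply/eqP/eq_rint => y.
  apply/eqP; apply: contraTT Mx => /hM; rewrite -leNgt; apply: le_trans.
  exact: norm_row_mxl.
move=> x; apply/(@cvgrPdist_le _ _ _ (nbhs x) _ _ _) => e e0.
(* The added 1 keeps [C] positive when [M] is so negative that the tent vanishes. *)
pose C := rint (@tent b M) + 1.
have C0 : 0 < C by rewrite ltr_wpDl// rint_ge0// => p; exact: tent_ge0.
have ne : forall y : 'rV[R]_b, [set p | `|p| <= M] y -> \forall y' \near y & x' \near x,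
    `|F (row_mx x y') - F (row_mx x' y')| <= e / C.
  move=> y _; pose G (z : 'rV[R]_b * 'rV[R]_a) :=
    F (row_mx x z.1) - F (row_mx z.2 z.1).
  have cG : continuous G.
    move=> z; apply: continuousB.
      apply: (@continuous_comp _ _ _ (fun z : 'rV[R]_b * 'rV[R]_a => row_mx x z.1) F); last exact: cF.
      by apply: continuous_row_mx => w; [exact: cst_continuous|exact: cvg_fst].
    apply: (@continuous_comp _ _ _ (fun z : 'rV[R]_b * 'rV[R]_a => row_mx z.2 z.1) F); last exact: cF.
    by apply: continuous_row_mx => w; [exact: cvg_snd|exact: cvg_fst].
  have /cvgrPdist_le/(_ _ (divr_gt0 e0 C0)) := cG (y, x).
  by apply: filterS => z; rewrite {1}/G /= subrr sub0r normrN.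
have : \forall x' \near x, [set p : 'rV[R]_b | `|p| <= M] `<=`
    (fun y => `|F (row_mx x y) - F (row_mx x' y)| <= e / C).
  have /compact_near_coveringP cov := @compact_norm_le b M.
  exact: (cov _ (nbhs x)
    (fun x' y => `|F (row_mx x y) - F (row_mx x' y)| <= e / C) _ ne).
apply: filterS => x' h.
rewrite -rintB; [|exact: Cc_slice|exact: Cc_slice].
rewrite ler_norml.
have key y : `|F (row_mx x y) - F (row_mx x' y)| <= e / C * tent M y.
  have [yM|yM] := leP `|y| M.
    by apply: le_trans (h _ yM) _; rewrite ler_peMr ?tent_ge1// divr_ge0// ltW.
  have F0 z : F (row_mx z y) = 0.
    apply/eqP; apply: contraTT yM => /hM; rewrite -leNgt; apply: le_trans.
    exact: norm_row_mxr.
  by rewrite !F0 subrr normr0 mulr_ge0 ?tent_ge0// divr_ge0// ltW.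
have CG : Cc (fun y => F (row_mx x y) - F (row_mx x' y)).
  by apply: CcD; [|apply: CcN]; exact: Cc_slice.
have CB : Cc (fun y : 'rV[R]_b => e / C * tent M y) by apply: CcZ; exact: Cc_tent.
have intB : rint (fun y : 'rV[R]_b => e / C * tent M y) <= e.
  rewrite rintZ; last exact: Cc_tent.
  rewrite mulrAC ler_pdivrMr// ler_pM2l// /C; lra.
apply/andP; split.
  apply: le_trans (_ : - rint (fun y : 'rV[R]_b => e / C * tent M y) <= _).
    by rewrite lerN2.
  rewrite -rintN//; apply: le_rint => //; first exact: CcN.
  by move=> y; have := key y; rewrite ler_norml => /andP[].
apply: le_trans intB; apply: le_rint => // y.
by have := key y; rewrite ler_norml => /andP[].
Qed.

Lemma mkrow_cons N x (t : N.-tuple (measurableTypeR R)) :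
  mkrow (tcons (x, t)) = row_mx (x%:M : 'M[R]_1) (mkrow t).
Proof.
apply/rowP => j; rewrite !mxE; case: splitP => k jk.
  rewrite !mxE ord1 eqxx mulr1n (_ : j = ord0) ?(tnth_nth 0)//.
  by apply/val_inj; rewrite /= jk ord1.
rewrite (_ : j = lift ord0 k) ?tnthS ?mxE//.
by apply/val_inj; rewrite /= jk.
Qed.

Lemma rint_cons N (F : 'rV[R]_(1 + N) -> R) : Cc F ->
  rint F = (\int[@lebesgue_measure R]_x
             rint (fun y => F (row_mx (x%:M : 'M[R]_1) y)))%R.
Proof.
move=> CF; pose G (z : measurableTypeR R * N.-tuple (measurableTypeR R)) :=
  (F (mkrow (tcons z)))%:E.
have mF : measurable_fun setT
    (fun t : N.+1.-tuple (measurableTypeR R) => (F (mkrow t))%:E).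
  by apply/measurable_EFinP; apply: measurable_continuous_row; case: CF.
have intG : ((@lebesgue_measure R) \x (tuple_lebesgue R N))%E.-integrable setT G.
  apply/integrableP; split; first exact: (measurableT_comp mF (@measurable_tcons R N)).
  have /integrableP[_] := Cc_integrable CF; apply: le_lt_trans.
  rewrite [leRHS](ge0_integral_pushforward (@measurable_tcons R N))//.
  exact/measurable_funTS/measurableT_comp.
rewrite /rint /Rintegral; congr fine.
rewrite [LHS](integral_pushforward (@measurable_tcons R N) mF)//= preimage_setT.
rewrite -(integral12_prod_meas1 intG).
apply: eq_integral => x _; rewrite /fubini_F.
have -> : (fun y => G (x, y)) =
   (fun y => (F (row_mx (x%:M : 'M[R]_1) (mkrow y)))%:E).
  by apply/funext => y; rewrite /G mkrow_cons.
exact: (rintE (Cc_slice _ CF)).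
Qed.

End Cc.

(** * Integrals of compactly supported functions on the line *)

Section line.
Context {R : realType}.
Notation mu := (@lebesgue_measure R).

Lemma Rintegral_supp (g : R -> R) (a b : R) : (forall x, x \notin `[a, b]%R -> g x = 0) ->
  (\int[mu]_x g x = \int[mu]_(x in `[a, b]) g x)%R.
Proof.
move=> g0; rewrite [RHS]Rintegral_mkcond; apply: eq_Rintegral => x _.
by rewrite patchE; case: ifPn => // xab; rewrite mem_setE in xab; rewrite g0.
Qed.

Lemma Rintegral_derive0 (g dg : R -> R) (M : R) : continuous dg ->
  (forall x : R, is_derive x 1 g (dg x)) -> (forall x, M < `|x| -> g x = 0) ->
  (\int[mu]_x dg x = 0)%R.
Proof.
move=> cdg dgE g0.
(* Positive, for a nondegenerate interval, and larger than [M], so that [g] vanishes at both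
   endpoints. *)
pose M1 := Num.max M 0 + 1.
have M10 : 0 < M1 by rewrite ltr_pwDr// le_max lexx orbT.
have MM1 : M < M1 by rewrite ltr_pwDr// le_max lexx.
have dg0 x : M1 < `|x| -> dg x = 0.
  move=> xM; have [_ <-] := dgE x.
  rewrite (@near_eq_derive _ _ _ g (cst 0)) ?derive_cst//.
  near=> y; apply: g0; near: y.
  have /cvgr_gt : (fun y : R => `|y|) @ x --> `|x| by exact: norm_continuous.
  by apply; exact: lt_trans xM.
rewrite (@Rintegral_supp _ (- M1) M1) => [|x]; last first.
  by rewrite in_itv/= -ler_norml -ltNge => /dg0.
rewrite /Rintegral.
have cg : continuous g.
  move=> x; apply/differentiable_continuous/derivable1_diffP; by have [] := dgE x.
rewrite (@continuous_FTC2 _ dg g) /=; last 4 first.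
- by rewrite gtrN.
- exact: continuous_subspaceT.
- split; first by move=> x _; by have [] := dgE x.
  + by apply: cvg_at_right_filter; exact: cg.
  + by apply: cvg_at_left_filter; exact: cg.
- by move=> x _; rewrite derive1E; by have [] := dgE x.
by rewrite !g0 ?subrr// ?normrN gtr0_norm.
Unshelve. all: by end_near. Qed.

Lemma Rintegral_shift (g : R -> R) (M c : R) : continuous g ->
  (forall x, M < `|x| -> g x = 0) ->
  (\int[mu]_x g (x + c) = \int[mu]_x g x)%R.
Proof.
move=> cg g0; pose M1 := `|M| + `|c| + 1.
have M10 : 0 < M1 by rewrite ltr_wpDl ?addr_ge0.
have [MM cc c2] : [/\ M <= `|M|, c <= `|c| & - c <= `|c|].
  by split; rewrite ?ler_norm// -normrN ler_norm.
rewrite (@Rintegral_supp _ (- M1) M1) => [|x]; last first.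
  rewrite in_itv/= -ler_norml -ltNge => xM; apply: g0.
  have := ler_normD (x + c) (- c); rewrite addrK normrN; rewrite /M1 in xM; lra.
rewrite [RHS](@Rintegral_supp _ (- M1 + c) (M1 + c)) => [|x]; last first.
  rewrite in_itv/= negb_and -!ltNge /M1 => h; apply: g0.
  by rewrite lter_normr; case/orP: h => h; apply/orP; [right|left]; lra.
have dE x : is_derive x (1 : R) (fun x => x + c) 1.
  by apply: is_derive_eq; rewrite addr0.
have dE1 : (fun x : R => x + c)^`() = cst 1.
  by apply/funext => x; rewrite derive1E; have [] := dE x.
have cF : continuous (fun x : R => x + c).
  by move=> x; apply: continuousD; [exact: cvg_id|exact: cst_continuous].
rewrite /Rintegral (@integration_by_substitution_increasing R (fun x => x + c) g (- M1) M1).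
- by rewrite dE1; congr fine; apply: eq_integral => x _ /=; rewrite mulr1.
- by rewrite ge0_cp// ltW.
- by move=> x y _ _; rewrite ltrD2r.
- by rewrite dE1 => x _; exact: cst_continuous.
- by rewrite dE1; exact: is_cvg_cst.
- by rewrite dE1; exact: is_cvg_cst.
- split; first by move=> x _; have [] := dE x.
  + by apply: cvg_at_right_filter; exact: cF.
  + by apply: cvg_at_left_filter; exact: cF.
- exact: continuous_subspaceT.
Qed.

End line.

(** * Fubini, translation invariance and integration of derivatives on R^N *)

Section fubini.
Context {R : realType}.
Notation mu := (@lebesgue_measure R).

Lemma rint_dim0 (F : 'rV[R]_0 -> R) : rint F = F 0.
Proof.
rewrite /rint /Rintegral /= integral_dirac//=; last first.
  have cF : continuous F.
    move=> p; rewrite (_ : F = fun=> F 0); first exact: cst_continuous.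
    by apply/funext => q; rewrite [q]thinmx0.
  apply/measurable_EFinP. exact: (measurable_continuous_row cF).
by rewrite indicT mul1r; congr F; apply/rowP => -[].
Qed.

Lemma rint_app a b (F : 'rV[R]_(a + b) -> R) : Cc F ->
  rint F = rint (fun x : 'rV[R]_a => rint (fun y : 'rV[R]_b => F (row_mx x y))).
Proof.
elim: a F => [|a ih] F CF.
  by rewrite rint_dim0; apply: eq_rint => y; rewrite row_thin_mx.
rewrite (rint_cons CF) (@rint_cons R a _ (Cc_rint CF)).
apply: eq_Rintegral => x _; rewrite (ih _ (Cc_slice (x%:M : 'M[R]_1) CF)).
apply: eq_rint => x'; apply: eq_rint => y.
by rewrite row_mxA castmx_id.
Qed.

Lemma mkrow_cat a b (t : a.-tuple (measurableTypeR R)) (u : b.-tuple (measurableTypeR R)) :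
  mkrow [tuple of t ++ u] = row_mx (mkrow t) (mkrow u).
Proof.
apply/rowP => j; rewrite !mxE; case: splitP => k jk; rewrite !mxE.
  by rewrite (tnth_nth 0) /= jk nth_cat size_tuple ltn_ord -tnth_nth.
by rewrite (tnth_nth 0) /= jk nth_cat size_tuple ltnNge leq_addr/= addKn -tnth_nth.
Qed.

Lemma measurable_cat a b :
  measurable_fun setT (fun z : a.-tuple (measurableTypeR R) * b.-tuple (measurableTypeR R) =>
    [tuple of z.1 ++ z.2]).
Proof.
apply/measurable_fun_tnthP => i.
case: (split_ordP i) => j ->.
  rewrite (_ : _ \o _ = (fun t : a.-tuple (measurableTypeR R) => tnth t j) \o fst).
    by apply: measurableT_comp => //; exact: measurable_tnth.
  by apply/funext => -[t u]; rewrite /= tnth_lshift.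
rewrite (_ : _ \o _ = (fun t : b.-tuple (measurableTypeR R) => tnth t j) \o snd).
  by apply: measurableT_comp => //; exact: measurable_tnth.
by apply/funext => -[t u]; rewrite /= tnth_rshift.
Qed.

Lemma Cc_swap a b (F : 'rV[R]_(a + b) -> R) : Cc F ->
  Cc (fun p : 'rV[R]_(b + a) => F (row_mx (rsubmx p) (lsubmx p))).
Proof.
move=> CF; apply: Cc_comp => //.
  by apply: continuous_row_mx; [exact: continuous_rsubmx|exact: continuous_lsubmx].
move=> M; exists M => p h; rewrite -[p]hsubmxK; apply: norm_row_mx_le.
- by apply: le_trans h; exact: norm_row_mxr.
- by apply: le_trans h; exact: norm_row_mxl.
Qed.

(** Fubini for the product of the two tuple measures; joint measurability is inherited from R^(a +
    b) through concatenation of tuples. *)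
Lemma rint_swap a b (F : 'rV[R]_(a + b) -> R) : Cc F ->
  rint (fun x : 'rV[R]_a => rint (fun y : 'rV[R]_b => F (row_mx x y))) =
  rint (fun y : 'rV[R]_b => rint (fun x : 'rV[R]_a => F (row_mx x y))).
Proof.
move=> CF.
pose G (z : a.-tuple (measurableTypeR R) * b.-tuple (measurableTypeR R)) :=
  (F (row_mx (mkrow z.1) (mkrow z.2)))%:E.
have mG : measurable_fun setT G.
  rewrite (_ : G = (fun t : (a + b).-tuple (measurableTypeR R) => (F (mkrow t))%:E) \o
     (fun z : a.-tuple (measurableTypeR R) * b.-tuple (measurableTypeR R) =>
        [tuple of z.1 ++ z.2])).
    apply: measurableT_comp; last exact: measurable_cat.
    by apply/measurable_EFinP; apply: measurable_continuous_row; case: CF.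
  by apply/funext => z; rewrite /G /= mkrow_cat.
have CA : Cc (fun p => `|F p|).
  case: CF => cF [M hM]; split.
    by move=> p; apply: (@continuous_comp _ _ _ F); [exact: cF|exact: norm_continuous].
  by exists M => p; rewrite normr_eq0 => /hM.
have intG : (tuple_lebesgue R a \x tuple_lebesgue R b)%E.-integrable setT G.
  apply/integrable12ltyP => //.
  rewrite (_ : (fun x => _) = fun x : a.-tuple (measurableTypeR R) =>
      (rint (fun y : 'rV[R]_b => `|F (row_mx (mkrow x) y)|))%:E).
    by have -> := rintE (Cc_rint CA); rewrite ltry.
  by apply/funext => x; rewrite -(rintE (Cc_slice _ CA)); apply: eq_integral => y _.
have := Fubini intG; rewrite /G /=.
under eq_integral do rewrite (rintE (Cc_slice _ CF)).
rewrite (rintE (Cc_rint CF)).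
under [RHS]eq_integral do rewrite (rintE (Cc_slicer _ CF)).
have Cs : Cc (fun y : 'rV[R]_b => rint (fun x : 'rV[R]_a => F (row_mx x y))).
  have := Cc_rint (Cc_swap CF); congr Cc; apply/funext => y; apply: eq_rint => x.
  by rewrite row_mxKl row_mxKr.
by rewrite (rintE Cs) => -[].
Qed.

Lemma Cc_shift N (F : 'rV[R]_N -> R) h : Cc F -> Cc (fun p => F (p + h)).
Proof.
move=> CF; apply: Cc_comp => //.
  by move=> p; apply: continuousD; [exact: cvg_id|exact: cst_continuous].
move=> M; exists (M + `|h|) => p pM; rewrite -lerBlDr; apply: le_trans pM.
by rewrite lerBlDr -[X in `|X| <= _](addrK h); apply: le_trans (ler_normB _ _) _.
Qed.

Lemma norm_scalar_mx11 (x : R) : `|x%:M : 'M[R]_1| = `|x|.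
Proof.
apply/eqP; rewrite eq_le; apply/andP; split.
  by apply/row_norm_leP => // j; rewrite ord1 mxE mulr1n.
by have := coord_le_norm (x%:M : 'M[R]_1) 0; rewrite mxE mulr1n.
Qed.

Lemma continuous_scalar_mx11 : continuous (fun x : R => x%:M : 'M[R]_1).
Proof.
apply: continuous_rowP => j; rewrite ord1; under eq_fun do rewrite mxE mulr1n.
by move=> x; exact: cvg_id.
Qed.

Lemma Cc_row1 (F : 'rV[R]_1 -> R) : Cc F ->
  continuous (fun x : R => F x%:M) /\ exists M, forall x : R, M < `|x| -> F x%:M = 0.
Proof.
move=> [cF [M hM]]; split.
  move=> x; apply: (@continuous_comp _ _ _ (fun x : R => x%:M : 'M[R]_1) F).
    exact: continuous_scalar_mx11.
  exact: cF.
exists M => x; rewrite -norm_scalar_mx11 => xM; apply/eqP; apply: contraTT xM => /hM.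
by rewrite -leNgt.
Qed.

Lemma rint1 (F : 'rV[R]_1 -> R) : Cc F -> rint F = (\int[mu]_x F x%:M)%R.
Proof.
move=> CF; rewrite (@rint_cons R 0 F CF); apply: eq_Rintegral => x _.
rewrite rint_dim0; congr F; apply/rowP => j; rewrite ord1 mxE.
by case: splitP => k; [rewrite ord1|case: k].
Qed.

Lemma rint_shift N (F : 'rV[R]_N -> R) h : Cc F ->
  rint (fun p => F (p + h)) = rint F.
Proof.
elim: N F h => [|N ih] F h CF.
  by rewrite !rint_dim0; congr F; rewrite !thinmx0.
rewrite (@rint_cons R N _ (Cc_shift h CF)) (@rint_cons R N F CF).
have Cx := @Cc_rint R 1 N F CF.
have [cx [M hM]] := Cc_row1 Cx.
rewrite -[RHS](Rintegral_shift (h 0 0) cx hM); apply: eq_Rintegral => x _.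
rewrite -(ih (fun y => F (row_mx (x + h 0 0)%:M y)) (rsubmx (h : 'rV[R]_(1 + N)))); last exact: (@Cc_slice R 1 N F _ CF).
apply: eq_rint => y; congr F; apply/rowP => j; rewrite !mxE.
case: splitP => k jk; rewrite !mxE.
  by rewrite ord1 !mulr1n (_ : j = 0)//; apply/val_inj; rewrite /= jk ord1.
by congr (_ + h _ _); apply/val_inj.
Qed.

(** A directional derivative only sees the restriction to a line, so it can be transported between
    functions on different spaces which agree along parametrized lines. This does the work of a
    chain rule for slices, translations and linear changes of variables. *)
Lemma is_derive_line (V W V' : normedModType R) (F : V -> W) (G : V' -> W) p v q w d :
  (forall t : R, F (t *: v + p) = G (t *: w + q)) -> is_derive p v F d -> is_derive q w G d.
Proof.
move=> FG [dF <-]; have FG0 : F p = G q by have := FG 0; rewrite !scale0r !add0r.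
have e : (fun h : R => h^-1 *: ((F \o shift p) (h *: v) - F p)) =
  (fun h : R => h^-1 *: ((G \o shift q) (h *: w) - G q)).
  by apply/funext => h; rewrite /= FG FG0.
by split; [move: dF; rewrite /derivable e|rewrite /derive e].
Qed.

(** Induction on the dimension. If the direction is not the first one, each slice at fixed first
    coordinate integrates to 0; if it is, the integrals are exchanged so that the fundamental
    theorem of calculus applies to the inner one. *)
Lemma rint_derive0 N (j : 'I_N) (F dF : 'rV[R]_N -> R) : Cc F -> Cc dF ->
  (forall p, is_derive p (delta_mx 0 j) F (dF p)) -> rint dF = 0.
Proof.
elim: N j F dF => [[]//|N ih] j F dF CF CdF dFE.
have [k jk|j0] := unliftP ord0 j.
  have dF0 x : rint (fun y => dF (row_mx (x%:M : 'M[R]_1) y)) = 0.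
    apply: (ih k (fun y => F (row_mx x%:M y)) _ (@Cc_slice R 1 N F x%:M CF) (@Cc_slice R 1 N dF x%:M CdF)) => y.
    apply: is_derive_line (dFE (row_mx x%:M y)) => t.
    congr F; apply/rowP => i; rewrite !mxE /= jk; case: splitP => l il; rewrite !mxE.
      rewrite (_ : i == _ = false) ?mulr0 ?add0r//; apply/negP => /eqP /(congr1 val)/=.
      by rewrite il ord1.
    by congr (_ * _%:R + _); rewrite -(inj_eq val_inj) /= il -(inj_eq (@ord_inj _)).
  rewrite (@rint_cons R N dF CdF); under eq_Rintegral do rewrite dF0.
  by rewrite Rintegral_cst// mul0r.
rewrite (@rint_app 1 N dF CdF) (@rint_swap 1 N dF CdF) -[RHS](rint0 N).
apply: eq_rint => y; rewrite rint1; last exact: (@Cc_slicer R 1 N dF y CdF).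
have [cd _] := Cc_row1 (@Cc_slicer R 1 N dF y CdF).
have [_ [M hM]] := Cc_row1 (@Cc_slicer R 1 N F y CF).
apply: (Rintegral_derive0 cd _ hM) => x.
apply: is_derive_line (dFE (row_mx x%:M y)) => t.
congr F; apply/rowP => i; rewrite !mxE /= j0; case: splitP => l il; rewrite ?mxE.
  have /eqP -> : i == 0 by apply/eqP/val_inj; rewrite /= il ord1.
  by rewrite ord1 !eqxx !mulr1n.
rewrite (_ : i == _ = false) ?mulr0 ?add0r//; apply/negP => /eqP /(congr1 val)/=.
by rewrite il.
Qed.

End fubini.

(** * Functions with nonnegative cosine transforms *)

Section positivity.
Context {R : realType}.
Notation mu := (@lebesgue_measure R).

(** By continuity [g] exceeds [g 0 / 2] on a ball around 0, hence dominates the step function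
    [h]. *)
Lemma Rintegral_gt0 (g : R -> R) (M : R) : continuous g -> (forall x, 0 <= g x) ->
  (forall x, M < `|x| -> g x = 0) -> 0 < g 0 -> (0 < \int[mu]_x g x)%R.
Proof.
move=> cg g0 gM g00.
have : \forall x \near (0 : R), g 0 / 2 < g x.
  have /cvgr_gt := cg (0 : R); apply.
  by rewrite ltr_pdivrMr// ltr_pMr// ltr1n.
move=> /nbhs_ballP[d /= d0 dg].
pose M1 := Num.max M 0 + d.
have M10 : 0 < M1 by rewrite ltr_wpDl// le_max lexx orbT.
have MM1 : M < M1 by rewrite ltr_pwDr// le_max lexx.
have dM1 : d <= M1 by rewrite lerDr le_max lexx orbT.
rewrite (@Rintegral_supp _ _ (- M1) M1) => [|x]; last first.
  by rewrite in_itv/= -ler_norml -ltNge => /(lt_trans MM1)/gM.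
pose h (x : R) := if `|x| < d then g 0 / 2 else 0.
have hE : h = (fun=> g 0 / 2) \_ (ball (0 : R) d).
  apply/funext => x; rewrite patchE /h.
  have [xd|xd] := boolP (`|x| < d).
    by rewrite ifT// inE -ball_normE/= sub0r normrN.
  by rewrite ifF//; apply/negbTE; rewrite notin_setE -ball_normE/= sub0r normrN; apply/negP.
have ghalf : 0 < g 0 / 2 by rewrite divr_gt0.
have segfin : (mu `[(- M1)%R, M1%R]%classic < +oo)%E.
  by rewrite lebesgue_measure_itv/=; case: ifP => _; rewrite ?ltry// -EFinB ltry.
have inth : mu.-integrable `[- M1, M1] (EFin \o h).
  apply: measurable_bounded_integrable => //.
    rewrite hE; apply/measurable_restrict => //; first exact: measurable_ball.
  exists (g 0); split; first exact: num_real.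
  move=> x gx y _ /=; rewrite /h; case: ifP => _; last by rewrite normr0 ltW// (lt_trans g00).
  by rewrite gtr0_norm// ltW// (lt_trans _ gx)// ltr_pdivrMr// ltr_pMr// ltr1n.
have intg : mu.-integrable `[- M1, M1] (EFin \o g).
  by apply: continuous_compact_integrable; [exact: segment_compact|exact: continuous_subspaceT].
have : (\int[mu]_(x in `[- M1, M1]) h x <= \int[mu]_(x in `[- M1, M1]) g x)%R.
  apply: le_Rintegral => // x _; rewrite /h; case: ifPn => // xd.
  by apply/ltW/dg; rewrite -ball_normE/= sub0r normrN.
apply: lt_le_trans; rewrite hE -Rintegral_mkcondr.
rewrite Rintegral_cst; last by apply: measurableI => //; exact: measurable_ball.
rewrite mulr_gt0// (_ : _ `&` _ = ball (0 : R) d); last first.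
  apply/setIidr => x; rewrite -ball_normE/= sub0r normrN => xd.
  by rewrite in_itv/= -ler_norml; apply: le_trans dM1; exact: ltW.
by rewrite /= lebesgue_measure_ball ?ltW//= pmulrn_lgt0.
Qed.

Lemma rint_gt0 N (F : 'rV[R]_N -> R) : Cc F -> (forall p, 0 <= F p) -> 0 < F 0 ->
  0 < rint F.
Proof.
elim: N F => [|N ih] F CF F0 F00; first by rewrite rint_dim0.
rewrite (@rint_cons R N F CF).
have [cx [M hM]] := Cc_row1 (@Cc_rint R 1 N F CF).
apply: (Rintegral_gt0 cx _ hM) => [x|]; first by apply: rint_ge0.
apply: ih => //; first exact: (@Cc_slice R 1 N F _ CF).
by rewrite -scalemx1 scale0r row_mx0.
Qed.

End positivity.

Section concentration.
Context {R : realType}.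

Definition dot N (l h : 'rV[R]_N) : R := \sum_s l 0 s * h 0 s.

Lemma continuous_sumr (T : topologicalType) (J : Type) (r : seq J) (P : pred J)
    (F : J -> T -> R) : (forall j, continuous (F j)) ->
  continuous (fun x => \sum_(j <- r | P j) F j x).
Proof.
move=> cF; elim: r => [|j r ih] x.
  by under eq_fun do rewrite big_nil; exact: cst_continuous.
under eq_fun do rewrite big_cons.
by case: (P j); [apply: continuousD; [exact: cF|exact: ih]|exact: ih].
Qed.

Lemma continuous_dot N (l : 'rV[R]_N) : continuous (dot l).
Proof.
apply: continuous_sumr => s h.
by apply: continuousM; [exact: cst_continuous|exact: coord_continuous].
Qed.

Lemma continuous_cos_dot N (l : 'rV[R]_N) : continuous (fun h => cos (dot l h)).
Proof.
by move=> h; apply: continuous_comp; [exact: continuous_dot|exact: continuous_cos].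
Qed.

Lemma dotDl N (l l' h : 'rV[R]_N) : dot (l + l') h = dot l h + dot l' h.
Proof. by rewrite /dot -big_split/=; apply: eq_bigr => s _; rewrite mxE mulrDl. Qed.

Lemma dotNl N (l h : 'rV[R]_N) : dot (- l) h = - dot l h.
Proof. by rewrite /dot -sumrN/=; apply: eq_bigr => s _; rewrite mxE mulNr. Qed.

Lemma dotDr N (l h h' : 'rV[R]_N) : dot l (h + h') = dot l h + dot l h'.
Proof. by rewrite /dot -big_split/=; apply: eq_bigr => s _; rewrite mxE mulrDr. Qed.

Lemma dotZr N a (l h : 'rV[R]_N) : dot l (a *: h) = a * dot l h.
Proof. by rewrite /dot mulr_sumr; apply: eq_bigr => s _; rewrite mxE mulrCA. Qed.

Lemma dot_deltar N (l : 'rV[R]_N) s : dot l (delta_mx 0 s) = l 0 s.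
Proof.
rewrite /dot (bigD1 s)//= mxE !eqxx mulr1 big1 ?addr0// => k ks.
by rewrite mxE (negbTE ks) mulr0.
Qed.

Lemma dot_delta N a (s : 'I_N) (h : 'rV[R]_N) : dot (a *: delta_mx 0 s) h = a * h 0 s.
Proof.
rewrite /dot (bigD1 s)//= !mxE !eqxx mulr1 big1 ?addr0// => k ks.
by rewrite !mxE (negbTE ks) mulr0 mul0r.
Qed.

(** The geometric rate [r'] of the mass near 0 must eventually beat the rate [r] of the rest. *)
Lemma le_geometric_contra (a d r r' : R) : 0 < a -> 0 < r -> r < r' ->
  ~ (forall m : nat, a * r' ^+ m <= d * r ^+ m).
Proof.
move=> a0 r0 rr' H; have r'0 := lt_trans r0 rr'.
have /cvg_geometric : `|r / r'| < 1.
  by rewrite gtr0_norm ?divr_gt0// ltr_pdivrMr// mul1r.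
move=> /(_ d) /cvgr_lt /(_ _ a0) [m _ /(_ m (leqnn m))] /=.
apply/negP; rewrite -leNgt expr_div_n mulrA ler_pdivlMr ?exprn_gt0//.
Qed.

(** Suppose [Psi 0 < 0]. Multiplication by [K] preserves nonnegativity of all cosine transforms, so
    [K ^+ m * Psi] has nonnegative integral for every [m]. But its negative part near 0 has mass at
    least of order [r' ^+ m], and its positive part at most of order [r ^+ m], with [r < r']. *)
Lemma ge0_of_cos_transform_ge0 N (Psi : 'rV[R]_N -> R) : Cc Psi ->
  (forall l, 0 <= rint (fun h => cos (dot l h) * Psi h)) -> 0 <= Psi 0.
Proof.
move=> CP HP; rewrite leNgt; apply/negP => P0.
have [B B0 hB] := Cc_bounded CP; have [cP [M hM]] := CP.
(* On the support of [Psi] this gives [|a * h 0 s| < 1], a range where the cosine decreases with the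
   absolute value; there 0 is the only maximum of [K]. *)
pose a : R := (`|M| + 1)^-1.
have a0 : 0 < a by rewrite invr_gt0 ltr_wpDl.
pose K (h : 'rV[R]_N) := 1 + \sum_s (1 + cos (a * h 0 s)).
have cK : continuous K.
  move=> h; apply: continuousD; first exact: cst_continuous.
  move: h; apply: continuous_sumr => s h.
  apply: continuousD; first exact: cst_continuous.
  apply: (@continuous_comp _ _ _ (fun h : 'rV[R]_N => a * h 0 s) (@cos R)); last exact: continuous_cos.
  by apply: continuousM; [exact: cst_continuous|exact: coord_continuous].
have cKX m : continuous (fun h => K h ^+ m).
  by move=> h; apply: (@continuous_comp _ _ _ K (fun x => x ^+ m)); [exact: cK|exact: exprn_continuous].
have CKP m : Cc (fun h => K h ^+ m * Psi h) by apply: CcMl.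
(* Product to sum: a factor [cos (a * h 0 s)] averages the transforms at the frequencies [l + a e_s]
   and [l - a e_s], and [K] has nonnegative coefficients. *)
have HK m l : 0 <= rint (fun h => cos (dot l h) * (K h ^+ m * Psi h)).
  elim: m l => [|m ih] l.
    by under eq_rint do rewrite expr0 mul1r; exact: HP.
  have Ct l' : Cc (fun h => cos (dot l' h) * (K h ^+ m * Psi h)).
    by apply: CcMl => //; exact: continuous_cos_dot.
  have E h : cos (dot l h) * (K h ^+ m.+1 * Psi h) =
      cos (dot l h) * (K h ^+ m * Psi h) + \sum_s (cos (dot l h) * (K h ^+ m * Psi h) +
        2^-1 * (cos (dot (l + a *: delta_mx 0 s) h) * (K h ^+ m * Psi h) +
        cos (dot (l - a *: delta_mx 0 s) h) * (K h ^+ m * Psi h))).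
    transitivity ((cos (dot l h) * (K h ^+ m * Psi h)) * K h).
      by rewrite exprSr; ring.
    rewrite {2}/K mulrDr mulr1 big_distrr; congr (_ + _); apply: eq_bigr => s _ /=.
    by rewrite !dotDl dotNl dot_delta cosD cosB; field.
  under eq_rint do rewrite E.
  have C2 s : Cc (fun h => cos (dot l h) * (K h ^+ m * Psi h) +
        2^-1 * (cos (dot (l + a *: delta_mx 0 s) h) * (K h ^+ m * Psi h) +
        cos (dot (l - a *: delta_mx 0 s) h) * (K h ^+ m * Psi h))).
    by apply: CcD => //; apply: CcZ; exact: CcD.
  rewrite rintD//; last exact: Cc_sum.
  rewrite rint_sum// addr_ge0// sumr_ge0// => s _.
  rewrite rintD//; last by apply: CcZ; exact: CcD.
  rewrite addr_ge0// rintZ; last exact: CcD.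
  by rewrite rintD// mulr_ge0// addr_ge0.
have K0 : K 0 = 1 + 2 * N%:R.
  rewrite /K (eq_bigr (fun=> 2)) => [|s _]; last by rewrite mxE mulr0 cos0.
  by rewrite sumr_const card_ord mulr_natr.
have K1 h : 1 <= K h.
  by rewrite /K lerDl sumr_ge0// => s _; have := cos_geN1 (a * h 0 s); lra.
have KN h : K h <= 1 + 2 * N%:R.
  rewrite -K0 /K lerD2l ler_sum// => s _; rewrite mxE mulr0 cos0 lerD2l; exact: cos_le1.
have : \forall h \near (0 : 'rV[R]_N), Psi h < Psi 0 / 2.
  by have /cvgr_lt := cP 0; apply; lra.
move=> /nbhs_ballP[d /= d0 dP].
pose d2 := Num.min d 1.
have d20 : 0 < d2 by rewrite lt_min d0 ltr01.
have ad1 : a * d2 <= 1.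
  by rewrite /a mulrC ler_pdivrMr ?ltr_wpDl// mul1r ge_min; apply/orP; right; rewrite lerDr.
(* Bound of [K] on the support away from 0: some coordinate has size at least [d2], and contributes
   at most [1 + cos (a * d2)], while the others contribute at most 2 each. The cap [d2 <= 1] keeps
   [a * d2] in the range where the cosine decreases. *)
pose r := 2 * N%:R + cos (a * d2).
have cosd : cos (a * d2) < 1.
  by rewrite -cos0 ltr_cos ?mulr_gt0// in_itv/= ?lexx ?pi_ge0//; have := @pi_ge2 R; have := mulr_gt0 a0 d20; lra.
have rK h : d2 <= `|h| -> Psi h != 0 -> K h <= r.
  move=> dh /hM hMh.
  have [s ds] : exists s, d2 <= `|h 0 s|.
    apply: contrapT => /forallNP H.
    have N0 : `|h| != 0 by rewrite gt_eqF// (lt_le_trans d20).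
    have [[i j]] := mx_norm_neq0 N0; rewrite /= ord1 => hj; apply: (H j).
    by rewrite -hj.
  rewrite /K /r (bigD1 s)//=.
  have S1 : \sum_(i < N | i != s) (1 + cos (a * h 0 i)) <= 2 * (N%:R - 1).
    apply: le_trans (_ : \sum_(i < N | i != s) 2 <= _).
      by apply: ler_sum => i _; have := cos_le1 (a * h 0 i); lra.
    rewrite sumr_const cardC1 card_ord -[X in X <= _]mulr_natr ler_pM2l//.
    by rewrite -[X in _ <= X%:R - 1](prednK (leq_ltn_trans (leq0n s) (ltn_ord s))) -natr1 addrK.
  have cs : cos (a * h 0 s) <= cos (a * d2).
    rewrite -cos_norm normrM gtr0_norm//.
    have h1 : a * `|h 0 s| <= 1.
      rewrite /a mulrC ler_pdivrMr ?ltr_wpDl// mul1r.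
      apply: le_trans (coord_le_norm _ _) _; apply: le_trans hMh _.
      by apply: le_trans (ler_norm _) _; rewrite lerDl.
    have pi2 := @pi_ge2 R; have ad0 := mulr_gt0 a0 d20.
    have h0 : 0 <= a * `|h 0 s| by rewrite mulr_ge0// ltW.
    rewrite leNgt ltr_cos; last 2 first.
    - by rewrite in_itv/=; apply/andP; split; lra.
    - by rewrite in_itv/=; apply/andP; split; lra.
    by rewrite -leNgt ler_pM2l.
  lra.
(* Midpoint between [r] and the maximum [K 0 = 1 + 2 N], so that [K] exceeds it near 0. *)
pose r' := (r + (1 + 2 * N%:R)) / 2.
have rr' : r < r' by rewrite /r' /r; lra.
have : \forall h \near (0 : 'rV[R]_N), r' < K h.
  by have /cvgr_gt := cK 0; apply; rewrite K0 /r' /r; lra.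
move=> /nbhs_ballP[d1 /= d10 dK].
pose d3 := Num.min d1 d2.
have d30 : 0 < d3 by rewrite lt_min d10.
have d2d : d2 <= d by rewrite ge_min lexx.
have d3d2 : d3 <= d2 by rewrite ge_min lexx orbT.
have d3d1 : d3 <= d1 by rewrite ge_min lexx.
have r0 : 0 < r.
  have [N0|N0] := posnP N.
    rewrite /r N0 mulr0 add0r (lt_le_trans (@cos1_gt0 R))//.
    have pi2 := @pi_ge2 R; have ad0 := mulr_gt0 a0 d20.
    by rewrite leNgt ltr_cos -?leNgt// in_itv/=; apply/andP; split; lra.
  have : 1 <= N%:R :> R by rewrite ler1n.
  by rewrite /r; have := cos_geN1 (a * d2); lra.
have r'0 : 0 < r' by exact: lt_trans rr'.
(* The shift by 1 makes [b1] a tent supported in the ball of radius [d3] and of height [d3] at 0;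
   hence the normalization [b1 / d3 <= 1] below. *)
pose b1 := @tent R N (d3 - 1); pose b2 := @tent R N M.
have b1E h : b1 h = Num.max 0 (d3 - `|h|) by rewrite /b1 /tent subrK.
apply: (@le_geometric_contra (- Psi 0 / 2 / d3 * rint b1) (B * rint b2) r r' _ r0 rr').
  rewrite mulr_gt0 ?divr_gt0//; first by rewrite oppr_gt0.
  apply: rint_gt0; [exact: Cc_tent|exact: tent_ge0|].
  by rewrite b1E normr0 subr0 lt_max d30 orbT.
move=> m; have := HK m 0.
have Cb1 : Cc b1 by exact: Cc_tent.
have Cb2 : Cc b2 by exact: Cc_tent.
(* For [|h| < d3] both [Psi h < Psi 0 / 2] and [K h > r'] hold. Elsewhere only points with
   [Psi h > 0] matter; these satisfy [|h| >= d2], hence [K h <= r]. *)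
have maj h : K h ^+ m * Psi h <= (B * r ^+ m) * b2 h - (- Psi 0 / 2 / d3 * r' ^+ m) * b1 h.
  have c0 : 0 <= - Psi 0 / 2 / d3 * r' ^+ m.
    by rewrite !mulr_ge0 ?exprn_ge0 ?invr_ge0 ?oppr_ge0 ?(ltW P0) ?(ltW d30) ?(ltW r'0).
  have Kge0 : 0 <= K h ^+ m by rewrite exprn_ge0// (le_trans ler01).
  have B2 : 0 <= (B * r ^+ m) * b2 h by rewrite !mulr_ge0 ?exprn_ge0 ?tent_ge0// ltW.
  have [hd|hd] := ltP `|h| d3.
    have Ph : Psi h < Psi 0 / 2.
      by apply: dP; rewrite -ball_normE/= sub0r normrN (lt_le_trans hd)// (le_trans d3d2).
    have Kh : r' < K h by apply: dK; rewrite -ball_normE/= sub0r normrN (lt_le_trans hd).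
    have s1 : K h ^+ m * Psi h <= r' ^+ m * (Psi 0 / 2).
      have s2 : r' ^+ m <= K h ^+ m by rewrite lerXn2r ?nnegrE ?ltW// (lt_trans r'0).
      apply: le_trans (_ : K h ^+ m * (Psi 0 / 2) <= _).
        by rewrite ler_wpM2l// ltW.
      by rewrite ler_wnM2r//; lra.
    apply: le_trans s1 _.
    have : b1 h / d3 <= 1.
      by rewrite ler_pdivrMr// mul1r b1E ge_max (ltW d30)/= gerBl.
    move=> b1d.
    have -> : - Psi 0 / 2 / d3 * r' ^+ m * b1 h = (r' ^+ m * (- Psi 0 / 2)) * (b1 h / d3).
      by field; rewrite gt_eqF.
    have X0 : 0 <= r' ^+ m * (- Psi 0 / 2).
      by rewrite !mulr_ge0 ?exprn_ge0 ?invr_ge0 ?oppr_ge0 ?(ltW P0) ?(ltW r'0).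
    by have := ler_piMr X0 b1d; lra.
  have -> : b1 h = 0 by rewrite b1E; apply/max_idPl; rewrite subr_le0.
  rewrite mulr0 subr0.
  have [Ph|Ph] := leP (Psi h) 0; first by apply: le_trans B2; rewrite mulr_ge0_le0.
  have hd2 : d2 <= `|h|.
    rewrite leNgt; apply/negP => h2.
    have : Psi h < Psi 0 / 2 by apply: dP; rewrite -ball_normE/= sub0r normrN (lt_le_trans h2).
    lra.
  have Pn0 : Psi h != 0 by rewrite gt_eqF.
  have Kr := rK h hd2 Pn0.
  apply: le_trans (_ : r ^+ m * B <= _).
    apply: ler_pM => //; first exact: ltW.
      by rewrite lerXn2r ?nnegrE ?(ltW r0)// (le_trans ler01).
    by apply: le_trans (ler_norm _) _.
  by rewrite mulrC ler_peMr ?tent_ge1 ?hM// mulr_ge0// exprn_ge0// ltW.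
have -> : rint (fun h => cos (dot 0 h) * (K h ^+ m * Psi h)) =
    rint (fun h => K h ^+ m * Psi h).
  apply: eq_rint => h; rewrite (_ : dot 0 h = 0) ?cos0 ?mul1r//.
  by rewrite /dot big1// => s _; rewrite mxE mul0r.
have CZ1 := CcZ (- Psi 0 / 2 / d3 * r' ^+ m) Cb1.
have CZ2 := CcZ (B * r ^+ m) Cb2.
move=> /le_trans /(_ (le_rint (CKP m) (CcD CZ2 (CcN CZ1)) maj)).
by rewrite rintB// !rintZ// subr_ge0 mulrAC [X in _ <= X -> _]mulrAC.
Qed.

End concentration.

(** * Smooth functions *)

Section Ck.
Context {R : realType} {N : nat}.
Local Notation U := 'rV[R]_N.
Implicit Type W : normedModType R.

Lemma CkW W k (f : U -> W) : Ck k.+1 f -> Ck k f.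
Proof.
elim: k f => [|k ih] f [df Df]; first by move=> p; exact: differentiable_continuous.
by split => // v; apply: ih.
Qed.

Lemma smoothP W (f : U -> W) : smooth f <->
  (forall p, differentiable f p) /\ forall v, smooth (fun p => 'D_v f p).
Proof.
split=> [sf|[df Df] [|k]].
- by split=> [|v k]; have [] := sf 1%N => // _ _; have [_] := sf k.+1; apply.
- by move=> p; exact: differentiable_continuous.
- by split=> // v; exact: Df.
Qed.

Lemma smooth_differentiable W (f : U -> W) p : smooth f -> differentiable f p.
Proof. by move=> /smoothP[]. Qed.

Lemma smooth_derivable W (f : U -> W) p v : smooth f -> derivable f p v.
Proof. by move=> sf; exact/diff_derivable/smooth_differentiable. Qed.

Lemma smooth_derive W (f : U -> W) v : smooth f -> smooth (fun p => 'D_v f p).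
Proof. by move=> /smoothP[_]. Qed.

Lemma smooth_continuous W (f : U -> W) : smooth f -> continuous f.
Proof. by move/(_ 0%N). Qed.

Lemma Ck_cst W k (w : W) : Ck k (fun _ : U => w).
Proof.
elim: k w => [|k ih] w /=; first by move=> p; exact: cst_continuous.
split=> [p|v]; first exact: differentiable_cst.
by under eq_fun do rewrite derive_cst; exact: ih.
Qed.

Lemma CkD W k (f g : U -> W) : Ck k f -> Ck k g -> Ck k (fun p => f p + g p).
Proof.
elim: k f g => [|k ih] f g /=.
  by move=> cf cg p; apply: continuousD; [exact: cf|exact: cg].
move=> [df Df] [dg Dg]; split=> [p|v]; first exact: differentiableD.
rewrite (_ : (fun p => _) = (fun p => 'D_v f p + 'D_v g p)); first exact: ih.
by apply/funext => p; rewrite deriveD//; exact: diff_derivable.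
Qed.

Lemma CkM k (f g : U -> R) : Ck k f -> Ck k g -> Ck k (fun p => f p * g p).
Proof.
elim: k f g => [|k ih] f g.
  by move=> cf cg p; apply: continuousM; [exact: cf|exact: cg].
move=> Cf Cg; have [df Df] := Cf; have [dg Dg] := Cg.
split=> [p|v]; first exact: differentiableM.
rewrite (_ : (fun p => _) = (fun p => f p * 'D_v g p + g p * 'D_v f p)).
  by apply: CkD; apply: ih; do ?[exact: CkW|exact: Df|exact: Dg].
by apply/funext => p; rewrite deriveM//; exact: diff_derivable.
Qed.

Lemma CkZl W k (f : U -> R) (w : W) : Ck k f -> Ck k (fun p => f p *: w).
Proof.
elim: k f => [|k ih] f /=.
  by move=> cf p; apply: continuousZ; [exact: cf|exact: cst_continuous].
move=> [df Df]; split=> [p|v]; first exact: differentiableZl.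
rewrite (_ : (fun p => _) = (fun p => 'D_v f p *: w)); first exact: ih.
apply/funext => p; rewrite deriveE; last exact: differentiableZl.
by rewrite diffZl// deriveE.
Qed.

Lemma smooth_cst W (w : W) : smooth (fun _ : U => w).
Proof. by move=> k; exact: Ck_cst. Qed.

Lemma smoothD W (f g : U -> W) : smooth f -> smooth g -> smooth (fun p => f p + g p).
Proof. by move=> sf sg k; exact: CkD. Qed.

Lemma smoothM (f g : U -> R) : smooth f -> smooth g -> smooth (fun p => f p * g p).
Proof. by move=> sf sg k; exact: CkM. Qed.

Lemma smoothZl W (f : U -> R) (w : W) : smooth f -> smooth (fun p => f p *: w).
Proof. by move=> sf k; exact: CkZl. Qed.

Lemma smooth_sum W (J : Type) (r : seq J) (P : pred J) (F : J -> U -> W) :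
  (forall j, smooth (F j)) -> smooth (fun p => \sum_(j <- r | P j) F j p).
Proof.
move=> sF; elim: r => [|j r ih].
  by under eq_fun do rewrite big_nil; exact: smooth_cst.
under eq_fun do rewrite big_cons.
by case: (P j) => //; exact: smoothD.
Qed.

Lemma derive_coord m (A : U -> 'rV[R]_m) v p j : derivable A p v ->
  'D_v (fun q => A q 0 j) p = ('D_v A p) 0 j.
Proof. by move=> dA; rewrite (derive_mx dA) mxE. Qed.

Lemma smooth_coord m (A : U -> 'rV[R]_m) j : smooth A -> smooth (fun p => A p 0 j).
Proof.
move=> sA k; elim: k A sA => [|k ih] A sA /=.
  move=> p; apply: (@continuous_comp _ _ _ A (fun q : 'rV[R]_m => q 0 j)).
    exact: smooth_continuous.
  exact: coord_continuous.
split=> [p|v].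
  apply: (@differentiable_comp _ _ _ _ A (fun q : 'rV[R]_m => q 0 j)).
    exact: smooth_differentiable.
  exact: differentiable_coord.
rewrite (_ : 'D_v _ = fun p => ('D_v A p) 0 j); last first.
  by apply/funext => p; rewrite derive_coord//; exact: smooth_derivable.
by apply: ih; exact: smooth_derive.
Qed.

Lemma smooth_row m (A : U -> 'rV[R]_m) : (forall j, smooth (fun p => A p 0 j)) -> smooth A.
Proof.
move=> sA; rewrite (_ : A = fun p => \sum_j A p 0 j *: delta_mx 0 j).
  by apply: smooth_sum => j; exact: smoothZl.
by apply/funext => p; rewrite -row_sum_delta.
Qed.

Lemma derive_proj (p v : U) j : 'D_v (fun q : U => q 0 j) p = v 0 j.
Proof. by rewrite (derive_coord j (@derivable_id _ _ p v)) derive_id. Qed.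

Lemma smooth_proj j : smooth (fun p : U => p 0 j).
Proof.
apply/smoothP; split=> [p|v]; first exact: differentiable_coord.
by under eq_fun do rewrite derive_proj; exact: smooth_cst.
Qed.

Lemma smoothZ (h : U -> R) (A : U -> 'rV[R]_N) : smooth h -> smooth A ->
  smooth (fun p => h p *: A p).
Proof.
move=> sh sA; apply: smooth_row => j; under eq_fun do rewrite mxE.
by apply: smoothM => //; exact: smooth_coord.
Qed.

Lemma deriveDdir W (f : U -> W) p u v : differentiable f p ->
  'D_(u + v) f p = 'D_u f p + 'D_v f p.
Proof. by move=> df; rewrite !deriveE// linearD. Qed.

Lemma deriveZdir W (f : U -> W) p a v : differentiable f p ->
  'D_(a *: v) f p = a *: 'D_v f p.
Proof. by move=> df; rewrite !deriveE// linearZ. Qed.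

Lemma derive_sumdir W (f : U -> W) p (J : Type) (r : seq J) (P : pred J) (u : J -> U) :
  differentiable f p ->
  'D_(\sum_(j <- r | P j) u j) f p = \sum_(j <- r | P j) 'D_(u j) f p.
Proof.
move=> df; rewrite deriveE// linear_sum; apply: eq_bigr => j _.
by rewrite deriveE.
Qed.

Lemma derive_row W (f : U -> W) p v : differentiable f p ->
  'D_v f p = \sum_j v 0 j *: 'D_(delta_mx 0 j) f p.
Proof.
move=> df; rewrite {1}(row_sum_delta v) derive_sumdir//; apply: eq_bigr => j _.
exact: deriveZdir.
Qed.

Lemma smooth_lie (A : vfield R N) (f : U -> R) : smooth A -> smooth f -> smooth (lie A f).
Proof.
move=> sA sf; rewrite (_ : lie A f = fun p => \sum_j A p 0 j * 'D_(delta_mx 0 j) f p).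
  by apply: smooth_sum => j; apply: smoothM; [exact: smooth_coord|exact: smooth_derive].
by apply/funext => p; rewrite /lie derive_row//; exact: smooth_differentiable.
Qed.

Lemma is_derive_along W (f : U -> W) (q u : U) (s : R) : differentiable f (q + s *: u) ->
  is_derive s (1 : R) (fun t : R => f (q + t *: u)) ('D_u f (q + s *: u)).
Proof.
move=> df; have : is_derive (q + s *: u) u f ('D_u f (q + s *: u)).
  by apply: derivableP; exact: diff_derivable.
apply: is_derive_line => t.
by rewrite [t *: 1]mulr1 scalerDl addrCA addrC.
Qed.

(** The mean value theorem is used twice: on the difference of [f] along two parallel segments of
    direction [u], then on ['D_u f] in the direction [v]. *)
Lemma double_difference (f : U -> R) (p u v : U) (h : R) : Ck 2 f -> 0 < h ->
  exists s t, [/\ 0 <= s <= h, 0 <= t <= h &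
   f (p + h *: u + h *: v) - f (p + h *: u) - (f (p + h *: v) - f p) =
   h ^+ 2 * 'D_v (fun q => 'D_u f q) (p + s *: u + t *: v)].
Proof.
move=> [df Df] h0.
pose g (s : R) := f (p + h *: v + s *: u) - f (p + s *: u).
pose dg (s : R) := 'D_u f (p + h *: v + s *: u) - 'D_u f (p + s *: u).
have gE s : is_derive s (1 : R) g (dg s).
  by apply: is_deriveB; apply: is_derive_along.
have cg : continuous g.
  by move=> s; apply/differentiable_continuous/derivable1_diffP; have [] := gE s.
have [s sI gs] := MVT_segment (ltW h0) (fun x _ => gE x) (continuous_subspaceT cg).
pose k (t : R) := 'D_u f (p + s *: u + t *: v).
have [dDf _] := Df u.
have kE t : is_derive t (1 : R) k ('D_v (fun q => 'D_u f q) (p + s *: u + t *: v)).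
  exact: (@is_derive_along _ (fun q => 'D_u f q)).
have ck : continuous k.
  by move=> t; apply/differentiable_continuous/derivable1_diffP; have [] := kE t.
have [t tI kt] := MVT_segment (ltW h0) (fun x _ => kE x) (continuous_subspaceT ck).
exists s, t; split; [by move: sI; rewrite in_itv|by move: tI; rewrite in_itv|].
move: gs kt; rewrite /g /dg /k !scale0r !addr0 subr0 => gs kt.
rewrite expr2 -mulrA [h * 'D_v _ _]mulrC -kt.
by rewrite mulrC [p + s *: u + _]addrAC -gs [p + h *: u + _]addrAC; ring.
Qed.

Lemma not_close_both (x y z : R) :
  `|x - z| < `|x - y| / 2 -> `|y - z| < `|x - y| / 2 -> False.
Proof. by have := ler_distD z x y; rewrite [`|z - y|]distrC; lra. Qed.

(** Schwarz's theorem. The double difference is symmetric in [u] and [v], so the two mixed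
    derivatives take a common value at two points arbitrarily close to [p]; a gap between them at
    [p] would contradict continuity. *)
Lemma derive_comm (f : U -> R) (u v : U) p : Ck 2 f ->
  'D_v (fun q => 'D_u f q) p = 'D_u (fun q => 'D_v f q) p.
Proof.
move=> Cf.
have cD (a b : U) : continuous (fun q => 'D_b (fun q => 'D_a f q) q).
  by have [_ /(_ a)[_ /(_ b)]] := Cf.
apply/eqP; rewrite -subr_eq0; apply/negPn/negP => ne.
pose e := `|'D_v (fun q => 'D_u f q) p - 'D_u (fun q => 'D_v f q) p| / 2.
have e0 : 0 < e by rewrite divr_gt0// normr_gt0.
have /cvgrPdist_lt/(_ _ e0)/nbhs_ballP[d1 /= d10 h1] := cD u v p.
have /cvgrPdist_lt/(_ _ e0)/nbhs_ballP[d2 /= d20 h2] := cD v u p.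
pose C := `|u| + `|v| + 1.
have C0 : 0 < C by rewrite ltr_wpDl ?addr_ge0.
pose d := Num.min d1 d2.
have d0 : 0 < d by rewrite lt_min d10.
(* For [s] and [t] in [0, h], the displacement [s *: u + t *: v] has norm at most
   [h * C = d / 2]. *)
pose h := d / C / 2.
have h0 : 0 < h by rewrite !divr_gt0.
have close s t : 0 <= s <= h -> 0 <= t <= h -> `|s *: u + t *: v| < d.
  move=> /andP[s0 sh] /andP[t0 th].
  apply: le_lt_trans (ler_normD _ _) _; rewrite !normrZ !ger0_norm//.
  apply: le_lt_trans (_ : h * C < _).
    apply: le_trans (lerD (ler_wpM2r (normr_ge0 _) sh) (ler_wpM2r (normr_ge0 _) th)) _.
    by rewrite -mulrDr ler_pM2l// lerDl.
  by rewrite /h mulrAC divfK ?gt_eqF// ltr_pdivrMr// ltr_pMr// ltr1n.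
have [s [t [sh th E1]]] := double_difference p u v Cf h0.
have [t' [s' [t'h s'h E2]]] := double_difference p v u Cf h0.
have : 'D_v (fun q => 'D_u f q) (p + s *: u + t *: v) =
       'D_u (fun q => 'D_v f q) (p + t' *: v + s' *: u).
  have hn : h ^+ 2 != 0 by rewrite expf_neq0 ?gt_eqF.
  apply: (mulfI hn); rewrite -[LHS]E1 -[RHS]E2 [p + h *: v + _]addrAC.
  move: (f (p + h *: u + h *: v)) (f (p + h *: u)) (f (p + h *: v)) (f p).
  by move=> x1 x2 x3 x4; ring.
have k1 := h1 (p + s *: u + t *: v).
have k2 := h2 (p + t' *: v + s' *: u).
move=> E; rewrite -E in k2; move: k1 k2; rewrite -ball_normE/=.
rewrite -!addrA !opprD !addNKr -!opprD !normrN [t' *: v + _]addrC.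
have dd1 : d <= d1 by rewrite ge_min lexx.
have dd2 : d <= d2 by rewrite ge_min lexx orbT.
move=> /(_ (lt_le_trans (close _ _ sh th) dd1)) k1.
move=> /(_ (lt_le_trans (close _ _ s'h t'h) dd2)) k2.
exact: not_close_both k1 k2.
Qed.

Lemma near_norm_gt (p : U) M : M < `|p| -> \forall q \near p, M < `|q|.
Proof. by move=> Mp; have /cvgr_gt := @norm_continuous R U p; apply. Qed.

Lemma derive_supp (f : U -> R) v M : (forall p, f p != 0 -> `|p| <= M) ->
  forall p, 'D_v f p != 0 -> `|p| <= M.
Proof.
move=> hM p; apply: contraNT; rewrite -ltNge => Mp.
rewrite (@near_eq_derive _ _ _ f (cst 0)) ?derive_cst//.
apply: filterS (near_norm_gt Mp) => q Mq.
by apply/eqP; apply: contraTT Mq => /hM; rewrite -leNgt.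
Qed.

Lemma Cc_derive (f : U -> R) v : smooth f -> Cc f -> Cc (fun p => 'D_v f p).
Proof.
move=> sf [_ [M hM]]; split; first exact/smooth_continuous/smooth_derive.
by exists M; exact: derive_supp.
Qed.

Lemma compactly_supported_Cc (f : U -> R) : smooth f -> compactly_supported f -> Cc f.
Proof.
move=> sf /compact_bounded[M [_ hM]]; split; first exact: smooth_continuous.
exists (`|M| + 1) => p fp; apply: hM; first by rewrite ltr_pwDr// ler_norm.
exact: subset_closure.
Qed.

End Ck.

(** * The algebraic identities *)

Section form_on.
Context {R : realType} {V : lmodType R} (E : V -> Prop).

(** Linearity, bilinearity and skewness are relative to a predicate [E] on the ambient module of all
    functions, since derivatives and integrals obey these laws only on test functions. *)
Record subspace_pred : Prop := {
  sub0 : E 0;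
  subD : forall u v, E u -> E v -> E (u + v);
  subZ : forall a u, E u -> E (a *: u) }.

Definition linear_on (T : V -> V) : Prop :=
  [/\ forall u, E u -> E (T u),
      forall u v, E u -> E v -> T (u + v) = T u + T v &
      forall a u, E u -> T (a *: u) = a *: T u].

Record form_on (Q : V -> V -> R) : Prop := {
  formDl : forall u v w, E u -> E v -> E w -> Q (u + v) w = Q u w + Q v w;
  formZl : forall a u w, E u -> E w -> Q (a *: u) w = a * Q u w;
  form_sym : forall u v, E u -> E v -> Q u v = Q v u }.

Definition skew_on (Q : V -> V -> R) (T : V -> V) : Prop :=
  forall u v, E u -> E v -> Q (T u) v = - Q u (T v).

Hypothesis subE : subspace_pred.

Lemma sub_sum (J : Type) (r : seq J) (P : pred J) (F : J -> V) :
  (forall j, E (F j)) -> E (\sum_(j <- r | P j) F j).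
Proof.
move=> EF; elim: r => [|j r ih]; first by rewrite big_nil; exact: sub0.
by rewrite big_cons; case: (P j) => //; exact: subD.
Qed.

Lemma linear_on0 T : linear_on T -> T 0 = 0.
Proof. by move=> [_ _ TZ]; have := TZ 0 _ (sub0 subE); rewrite !scale0r. Qed.

Lemma linear_onD T u v : linear_on T -> E u -> E v -> T (u + v) = T u + T v.
Proof. by move=> [_ TD _]; exact: TD. Qed.

Lemma linear_onZ T a u : linear_on T -> E u -> T (a *: u) = a *: T u.
Proof. by move=> [_ _ TZ]; exact: TZ. Qed.

Lemma linear_on_sum T (J : Type) (r : seq J) (P : pred J) (F : J -> V) :
  linear_on T -> (forall j, E (F j)) ->
  T (\sum_(j <- r | P j) F j) = \sum_(j <- r | P j) T (F j).
Proof.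
move=> LT EF; have [_ TD _] := LT; elim: r => [|j r ih].
  by rewrite !big_nil linear_on0.
rewrite !big_cons; case: (P j) => //; rewrite TD ?ih//; exact: sub_sum.
Qed.

Section form.
Context (Q : V -> V -> R) (fQ : form_on Q).

Lemma formDr u v w : E u -> E v -> E w -> Q w (u + v) = Q w u + Q w v.
Proof.
move=> Eu Ev Ew; have ? : E (u + v) by exact: subD.
by rewrite (form_sym fQ)// (formDl fQ)// !(form_sym fQ _ Ew).
Qed.

Lemma formZr a u w : E u -> E w -> Q w (a *: u) = a * Q w u.
Proof.
move=> Eu Ew; have ? : E (a *: u) by exact: subZ.
by rewrite (form_sym fQ)// (formZl fQ)// (form_sym fQ Eu Ew).
Qed.

Lemma form0l w : E w -> Q 0 w = 0.
Proof.
by move=> Ew; have := formZl fQ 0 (sub0 subE) Ew; rewrite scale0r mul0r.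
Qed.

Lemma form_suml (J : Type) (r : seq J) (P : pred J) (F : J -> V) w :
  (forall j, E (F j)) -> E w ->
  Q (\sum_(j <- r | P j) F j) w = \sum_(j <- r | P j) Q (F j) w.
Proof.
move=> EF Ew; elim: r => [|j r ih]; first by rewrite !big_nil form0l.
rewrite !big_cons; case: (P j) => //; rewrite (formDl fQ)// ?ih//; exact: sub_sum.
Qed.

Lemma form_sumr (J : Type) (r : seq J) (P : pred J) (F : J -> V) w :
  (forall j, E (F j)) -> E w ->
  Q w (\sum_(j <- r | P j) F j) = \sum_(j <- r | P j) Q w (F j).
Proof.
move=> EF Ew; rewrite (form_sym fQ)//; last exact: sub_sum.
by rewrite form_suml//; apply: eq_bigr => j _; rewrite (form_sym fQ).
Qed.

End form.
End form_on.

(** * Consequences of the commutation and Clifford relations *)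

Section heisenberg_algebra.
Context {R : realType} {V : lmodType R} (E : V -> Prop) (K S : finType).
Context (X : K -> V -> V) (Z : S -> V -> V) (B : S -> K -> K -> R).
Hypotheses (subE : subspace_pred E)
  (linX : forall k, linear_on E (X k)) (linZ : forall s, linear_on E (Z s))
  (XZ : forall k s f, E f -> X k (Z s f) = Z s (X k f))
  (XX : forall k l f, E f ->
     X k (X l f) - X l (X k f) = \sum_s (4 * B s k l) *: Z s f)
  (Bskew : forall s k l, B s l k = - B s k l)
  (Bcliff : forall s t j i,
     \sum_k (B s k j * B t k i + B t k j * B s k i) = 2 * ((s == t) && (j == i))%:R).

Definition lap f := \sum_k X k (X k f).

Let EX k f : E f -> E (X k f). Proof. by case: (linX k) => h _ _; exact: h. Qed.
Let EZ s f : E f -> E (Z s f). Proof. by case: (linZ s) => h _ _; exact: h. Qed.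
Let Esc a f : E f -> E (a *: f). Proof. exact: subZ. Qed.
Let Elap f : E f -> E (lap f).
Proof. by move=> Ef; apply: sub_sum => // k; do 2 apply: EX. Qed.
Hint Resolve EX EZ Esc Elap : core.

Let d : R := #|K|%:R.

(** The Clifford relation at [j = i], summed over [i]. *)
Lemma B_trace s t : \sum_k \sum_l B s k l * B t k l = (s == t)%:R * d.
Proof.
have E1 : \sum_l \sum_k (B s k l * B t k l + B t k l * B s k l) = 2 * ((s == t)%:R * d).
  under eq_bigr do rewrite Bcliff eqxx andbT.
  by rewrite sumr_const -[LHS]mulr_natr -mulrA.
apply: (@mulfI R 2); first by rewrite pnatr_eq0.
rewrite -E1 exchange_big/= mulr_sumr; apply: eq_bigr => l _.
by rewrite mulr_sumr; apply: eq_bigr => k _; ring.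
Qed.

(** Contraction with the skew matrix [B s] only sees half the commutator, [2 * B t k l] times [Z t],
    and the trace identity singles out [t = s]. *)
Lemma B_hess s f : E f ->
  \sum_k \sum_l B s k l *: X k (X l f) = (2 * d) *: Z s f.
Proof.
move=> Ef; set T := LHS.
have T2 : 2 *: T = \sum_k \sum_l B s k l *: (X k (X l f) - X l (X k f)).
  under eq_bigr do (under eq_bigr do rewrite scalerBr; rewrite sumrB).
  rewrite sumrB [X in _ - X]exchange_big/= scaler_nat mulr2n; congr (_ + _).
  rewrite -sumrN; apply: eq_bigr => k _; rewrite -sumrN; apply: eq_bigr => l _.
  by rewrite Bskew scaleNr.
apply: (@scalerI R V 2); first by rewrite pnatr_eq0.
rewrite T2; under eq_bigr do under eq_bigr do rewrite XX// scaler_sumr.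
transitivity (\sum_t (4 * \sum_k \sum_l B s k l * B t k l) *: Z t f).
  under eq_bigr do rewrite exchange_big/=.
  rewrite exchange_big/=; apply: eq_bigr => t _.
  rewrite mulr_sumr scaler_suml; apply: eq_bigr => k _.
  rewrite mulr_sumr scaler_suml; apply: eq_bigr => l _.
  by rewrite scalerA; congr (_ *: _); ring.
under eq_bigr do rewrite B_trace.
rewrite (bigD1 s)//= eqxx big1 => [|t ts]; last first.
  by rewrite eq_sym (negbTE ts) mul0r mulr0 scale0r.
by rewrite addr0 mul1r scalerA; congr (_ *: _); ring.
Qed.

Section forms.
Context (Q : V -> V -> R) (fQ : form_on E Q).
Hypotheses (skX : forall k, skew_on E Q (X k)) (skZ : forall s, skew_on E Q (Z s)).

Lemma form_hess_Z s f g : E f -> E g ->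
  \sum_k \sum_l B s k l * Q (X k (X l f)) g = 2 * d * Q (Z s f) g.
Proof.
move=> Ef Eg; rewrite -(formZl fQ) ?B_hess//; last exact: EZ.
rewrite -B_hess// (form_suml subE fQ)//; last first.
  by move=> k; apply: sub_sum => // l; apply: Esc; do 2 apply: EX.
apply: eq_bigr => k _; rewrite (form_suml subE fQ)//; last first.
  by move=> l; apply: Esc; do 2 apply: EX.
by apply: eq_bigr => l _; rewrite (formZl fQ)//; do 2 apply: EX.
Qed.

(** A Bochner formula: one [X k] is moved across the form, carried past [X l], and the error terms,
    contractions of the Hessian with [B s], are evaluated by [form_hess_Z]. The constant is 8 from
    the commutators times [2 * d] from the trace. *)
Lemma hessian_norm_form f : E f ->
  \sum_k \sum_l Q (X k (X l f)) (X k (X l f)) =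
  Q (lap f) (lap f) + 16 * d * \sum_s Q (Z s f) (Z s f).
Proof.
move=> Ef.
(* Two commutators, each contributing [4 * B s k l], since both factors [X k] pass over [X l]. *)
have comm k l : X k (X k (X l f)) =
    X l (X k (X k f)) + \sum_s (8 * B s k l) *: X k (Z s f).
  have -> : X k (X l f) = X l (X k f) + \sum_s (4 * B s k l) *: Z s f.
    by rewrite -XX// addrC subrK.
  rewrite (linear_onD (linX k)); [|by do 2 apply: EX|by apply: sub_sum => // s; apply/Esc/EZ].
  have -> : X k (X l (X k f)) = X l (X k (X k f)) + \sum_s (4 * B s k l) *: Z s (X k f).
    by rewrite -XX ?subrK 1?addrC ?subrK//; exact: EX.
  rewrite -addrA; congr (_ + _).
  rewrite (linear_on_sum subE)// => [|s]; last by apply/Esc/EZ.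
  rewrite -big_split/=; apply: eq_bigr => s _.
  rewrite (linear_onZ _ (linX k)); last exact: EZ.
  by rewrite -XZ// -scalerDl; congr (_ *: _); ring.
have step k l : Q (X k (X l f)) (X k (X l f)) =
    - Q (X l f) (X l (X k (X k f))) +
    8 * \sum_s B s k l * Q (X k (X l f)) (Z s f).
  have E1 : E (X k (X k f)) by do 2 apply: EX.
  have E2 : E (X l f) by exact: EX.
  have E3 s : E (X k (Z s f)) by apply/EX/EZ.
  rewrite skX//; last exact: EX.
  rewrite comm (formDr subE fQ)//; [|exact: EX|by apply: sub_sum => // s; exact: Esc].
  rewrite opprD; congr (_ + _).
  rewrite (form_sumr subE fQ)// => [|s]; last exact: Esc.
  rewrite mulr_sumr -sumrN; apply: eq_bigr => s _.
  by rewrite (formZr subE fQ)// (skX k E2 (EZ s Ef)); ring.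
under eq_bigr do under eq_bigr do rewrite step.
under eq_bigr do rewrite big_split/=.
rewrite big_split/=; congr (_ + _).
  rewrite exchange_big/=.
  transitivity (\sum_l - Q (X l f) (X l (lap f))).
    apply: eq_bigr => l _; rewrite sumrN; congr (- _).
    have LX := linX l.
    rewrite /lap (linear_on_sum subE)// => [|k]; last by do 2 apply: EX.
    rewrite (form_sumr subE fQ)//; last exact: EX.
    by move=> k; do 3 apply: EX.
  have EXX k : E (X k (X k f)) by do 2 apply: EX.
  have EL := Elap Ef.
  rewrite [in RHS]/lap [RHS](form_suml subE fQ)//.
  by apply: eq_bigr => l _; rewrite [RHS](skX l (EX l Ef) EL).
transitivity (8 * \sum_s \sum_k \sum_l B s k l * Q (X k (X l f)) (Z s f)).
  under eq_bigr do rewrite -mulr_sumr.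
  rewrite -mulr_sumr; congr (8 * _); rewrite [RHS]exchange_big/=.
  by apply: eq_bigr => k _; rewrite [RHS]exchange_big.
rewrite mulr_sumr mulr_sumr; apply: eq_bigr => s _.
by rewrite form_hess_Z//; [ring|exact: EZ].
Qed.

End forms.

(** * The spectral bound at a fixed central frequency *)

Section frequency.
Context (Q : V -> V -> R) (fQ : form_on E Q) (lam : S -> R).
Hypotheses (skX : forall k, skew_on E Q (X k))
  (QZZ : forall s t u v, E u -> E v -> Q (Z s u) (Z t v) = lam s * lam t * Q u v)
  (Qge0 : forall u, E u -> 0 <= Q u u).

Let nu := \sum_s lam s ^+ 2.
Let nu_ge0 : 0 <= nu. Proof. by apply: sumr_ge0 => s _; exact: sqr_ge0. Qed.
Let mu := Num.sqrt nu.
Let mu2 : mu ^+ 2 = nu. Proof. exact: sqr_sqrtr. Qed.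

Let M k j := \sum_s lam s * B s k j.

(** Twice the left side, symmetrized in [s] and [t], is the Clifford sum with weights
    [lam s * lam t]. Thus [M] is [mu] times an orthogonal matrix, the square of [mu] being [nu]. *)
Lemma M_orth j i : \sum_k M k j * M k i = nu * (j == i)%:R.
Proof.
apply: (@mulfI R 2); first by rewrite pnatr_eq0.
transitivity (\sum_s \sum_t lam s * lam t *
   \sum_k (B s k j * B t k i + B t k j * B s k i)).
  have E1 : \sum_k M k j * M k i = \sum_s \sum_t lam s * lam t * \sum_k B s k j * B t k i.
    under eq_bigr do rewrite /M big_distrlr/=.
    rewrite exchange_big/=; apply: eq_bigr => s _.
    rewrite exchange_big/=; apply: eq_bigr => t _.
    by rewrite mulr_sumr; apply: eq_bigr => k _; ring.
  rewrite mulr2n mulrDl mul1r {1}E1 [X in _ + X]E1 [X in _ + X]exchange_big/=.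
  rewrite -big_split/=; apply: eq_bigr => s _.
  rewrite -big_split/=; apply: eq_bigr => t _.
  by rewrite big_split/= mulrDr [lam t * lam s]mulrC.
rewrite /nu mulr_suml mulr_sumr; apply: eq_bigr => s _.
rewrite (bigD1 s)//= [X in _ + X]big1 => [|t ts]; last first.
  by rewrite Bcliff eq_sym (negbTE ts)/= !mulr0.
by rewrite Bcliff eqxx/= addr0; ring.
Qed.

Let energy f := \sum_k Q (X k f) (X k f).

Lemma energy_lap f : E f -> energy f = - Q (lap f) f.
Proof.
move=> Ef; rewrite /lap (form_suml subE fQ)//; last by move=> k; do 2 apply: EX.
by rewrite -sumrN; apply: eq_bigr => k _; rewrite [in RHS]skX ?opprK//; exact: EX.
Qed.

(* On functions of frequency [lam], [Y k f] is [i * mu * (J X)_k f] for a complex structure [J], so that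
   [X k f - mu^-1 *: Y k f] is the Cauchy-Riemann operator annihilating the ground states. *)
Let Y k f := \sum_s \sum_j B s k j *: X j (Z s f).

(** Nonnegativity of the squared norm of the Cauchy-Riemann operator: its cross term is a
    contraction of the Hessian with [B], hence of order zero in [f], and the norm of [Y] is computed
    by [M_orth]. At [mu = 0] the operator is undefined, but the bound is trivial. *)
Lemma energy_ge f : E f -> 2 * d * mu * Q f f <= energy f.
Proof.
move=> Ef.
have E1 s j : E (X j (Z s f)) by apply/EX/EZ.
have EYj s k : E (\sum_j B s k j *: X j (Z s f)) by apply: sub_sum => // j; exact: Esc.
have EY k : E (Y k f) by apply: sub_sum => // s.
have [mu0|mu0] := eqVneq mu 0.
  rewrite mu0 mulr0 mul0r; apply: sumr_ge0 => k _; apply: Qge0; exact: EX.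
have mu_gt0 : 0 < mu by rewrite lt0r mu0 sqrtr_ge0.
have cross : \sum_k Q (X k f) (Y k f) = 2 * d * nu * Q f f.
  transitivity (\sum_l \sum_s \sum_k B s k l * Q (X k (X l f)) (Z s f)).
    apply: eq_bigr => l _.
    rewrite (form_sumr subE fQ)//; last exact: EX.
    apply: eq_bigr => s _.
    rewrite (form_sumr subE fQ)//; [|by move=> j; exact: Esc|exact: EX].
    apply: eq_bigr => j _; rewrite (formZr subE fQ)//; last exact: EX.
    by rewrite (skX j (EX l Ef) (EZ s Ef)) Bskew; ring.
  rewrite exchange_big/=; under eq_bigr do rewrite exchange_big/=.
  transitivity (\sum_s 2 * d * (lam s ^+ 2 * Q f f)).
    apply: eq_bigr => s _; rewrite (form_hess_Z fQ s Ef (EZ s Ef)).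
    by rewrite QZZ// expr2.
  by rewrite -mulr_sumr -mulr_suml mulrA.
have QXZ s t j i : Q (X j (Z s f)) (X i (Z t f)) = lam s * lam t * Q (X j f) (X i f).
  by rewrite !XZ// QZZ//; exact: EX.
have normY : \sum_k Q (Y k f) (Y k f) = nu * energy f.
  transitivity (\sum_k \sum_j \sum_i M k j * M k i * Q (X j f) (X i f)).
    apply: eq_bigr => k _.
    have -> : Q (Y k f) (Y k f) = \sum_s \sum_j \sum_t \sum_i
       B s k j * B t k i * Q (X j (Z s f)) (X i (Z t f)).
      rewrite {1}/Y (form_suml subE fQ)//; apply: eq_bigr => s _.
      rewrite (form_suml subE fQ)//; last by move=> j; exact: Esc.
      apply: eq_bigr => j _; rewrite (formZl fQ)// /Y (form_sumr subE fQ)//.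
      rewrite mulr_sumr; apply: eq_bigr => t _.
      rewrite (form_sumr subE fQ)//; last by move=> i; exact: Esc.
      rewrite mulr_sumr; apply: eq_bigr => i _.
      by rewrite (formZr subE fQ)// mulrA.
    rewrite exchange_big/=; apply: eq_bigr => j _.
    under eq_bigr do rewrite exchange_big/=.
    rewrite exchange_big/=; apply: eq_bigr => i _.
    rewrite /M big_distrlr/= mulr_suml; apply: eq_bigr => s _.
    rewrite mulr_suml; apply: eq_bigr => t _.
    by rewrite QXZ; ring.
  rewrite exchange_big/= /energy mulr_sumr; apply: eq_bigr => j _.
  rewrite exchange_big/= (bigD1 j)//= [X in _ + X]big1 => [|i ij].
    by rewrite -mulr_suml M_orth eqxx mulr1 addr0.
  by rewrite -mulr_suml M_orth eq_sym (negbTE ij) mulr0 mul0r.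
(* Since [t ^+ 2 * nu = 1], both square terms equal [energy f], and the expansion reads 0 <= 2
   energy - 2 (2 d mu Q f f). *)
pose t := - mu^-1.
have : 0 <= \sum_k Q (X k f + t *: Y k f) (X k f + t *: Y k f).
  by apply: sumr_ge0 => k _; apply: Qge0; apply: subD => //; [exact: EX|exact: Esc].
have expand k : Q (X k f + t *: Y k f) (X k f + t *: Y k f) =
    Q (X k f) (X k f) + 2 * t * Q (X k f) (Y k f) + t ^+ 2 * Q (Y k f) (Y k f).
  have EXk : E (X k f) by exact: EX.
  have EtY : E (t *: Y k f) by exact: Esc.
  rewrite (formDl fQ)//; last exact: subD.
  rewrite !(formDr subE fQ)// !(formZl fQ)// !(formZr subE fQ)//.
  by rewrite (form_sym fQ (EY k) EXk); ring.
under eq_bigr do rewrite expand.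
rewrite !big_split/= -!mulr_sumr cross normY -/(energy f).
have -> : 2 * t * (2 * d * nu * Q f f) = - (2 * (2 * d * mu * Q f f)).
  by rewrite /t -mu2; field.
have -> : t ^+ 2 * (nu * energy f) = energy f by rewrite /t -mu2; field.
by move: (energy f) (2 * d * mu * Q f f) => x y; lra.
Qed.

(** From -L >= c to L^2 >= c^2 with [c = 2 * d * mu]: expand the square of [lap f + c *: f], and use
    the energy bound for the middle term. *)
Lemma vertical_le_lap f : E f ->
  4 * d ^+ 2 * \sum_s Q (Z s f) (Z s f) <= Q (lap f) (lap f).
Proof.
move=> Ef; have h1 := energy_ge Ef; have EL := Elap Ef.
have -> : \sum_s Q (Z s f) (Z s f) = mu ^+ 2 * Q f f.
  by rewrite mu2 /nu mulr_suml; apply: eq_bigr => s _; rewrite QZZ// expr2.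
have Ec : E ((2 * d * mu) *: f) by exact: Esc.
have : 0 <= Q (lap f + (2 * d * mu) *: f) (lap f + (2 * d * mu) *: f).
  by apply: Qge0; exact: subD.
rewrite (formDl fQ)//; last exact: subD.
rewrite !(formDr subE fQ)// !(formZl fQ)// !(formZr subE fQ)//.
rewrite (form_sym fQ Ef EL); move: h1; rewrite energy_lap// => h1.
have c0 : 0 <= 2 * d * mu by rewrite !mulr_ge0// sqrtr_ge0.
have := ler_wpM2l c0 h1.
move: (Q (lap f) (lap f)) (Q (lap f) f) (Q f f) => a b q.
have -> : 4 * d ^+ 2 * (mu ^+ 2 * q) = 2 * d * mu * (2 * d * mu * q) by ring.
move: (2 * d * mu) => c; rewrite mulrN; lra.
Qed.

End frequency.
End heisenberg_algebra.

(** * Groups of Heisenberg type *)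

Section test_functions.
Context {R : realType}.

Lemma Cc_rintl a b (F : 'rV[R]_(a + b) -> R) : Cc F ->
  Cc (fun y : 'rV[R]_b => rint (fun x : 'rV[R]_a => F (row_mx x y))).
Proof.
move=> CF; have := Cc_rint (Cc_swap CF); congr Cc; apply/funext => y.
by apply: eq_rint => x; rewrite row_mxKl row_mxKr.
Qed.

Definition test N (f : 'rV[R]_N -> R) := smooth f /\ Cc f.

Lemma testD N (f g : 'rV[R]_N -> R) : test f -> test g -> test (f + g).
Proof. by move=> [sf cf] [sg cg]; split; [exact: smoothD|exact: CcD]. Qed.

Lemma testMl N (g f : 'rV[R]_N -> R) : smooth g -> test f -> test (fun p => g p * f p).
Proof.
by move=> sg [sf cf]; split; [exact: smoothM|apply: CcMl => //; exact: smooth_continuous].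
Qed.

Lemma testM N (f g : 'rV[R]_N -> R) : test f -> test g -> test (fun p => f p * g p).
Proof. by move=> [sf cf]; exact: testMl. Qed.

Lemma testZ N (c : R) (f : 'rV[R]_N -> R) : test f -> test (c *: f).
Proof. by apply: testMl; exact: smooth_cst. Qed.

Lemma test0 N : test (0 : 'rV[R]_N -> R).
Proof. by split; [exact: smooth_cst|exact: Cc0]. Qed.

Lemma test_sum N (J : Type) (r : seq J) (P : pred J) (F : J -> 'rV[R]_N -> R) :
  (forall j, test (F j)) -> test (\sum_(j <- r | P j) F j).
Proof.
move=> TF; elim: r => [|j r ih]; first by rewrite big_nil; exact: test0.
by rewrite big_cons; case: (P j) => //; exact: testD.
Qed.

Lemma test_derive N (f : 'rV[R]_N -> R) v : test f -> test (fun p => 'D_v f p).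
Proof. by move=> [sf cf]; split; [exact: smooth_derive|exact: Cc_derive]. Qed.

Lemma rint_derive_test N (f : 'rV[R]_N -> R) j : test f ->
  rint (fun p => 'D_(delta_mx 0 j) f p) = 0.
Proof.
move=> Tf; have [sf cf] := Tf; have [_ cdf] := test_derive (delta_mx 0 j) Tf.
by apply: (rint_derive0 cf cdf) => p; apply: derivableP; exact: smooth_derivable.
Qed.

Lemma derive_translate N (f : 'rV[R]_N -> R) h v p :
  'D_v (fun x => f (x + h)) p = 'D_v f (p + h).
Proof.
rewrite /derive (_ : (fun t : R => _) =
  (fun t : R => t^-1 *: ((f \o shift (p + h)) (t *: v) - f (p + h))))//.
by apply/funext => t /=; rewrite addrA.
Qed.

Lemma Ck_translate N (f : 'rV[R]_N -> R) h k : Ck k f -> Ck k (fun x => f (x + h)).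
Proof.
elim: k f => [|k ih] f /=.
  move=> cf p; apply: (@continuous_comp _ _ _ (fun x : 'rV[R]_N => x + h) f); last exact: cf.
  by apply: continuousD; [exact: cvg_id|exact: cst_continuous].
move=> [df Df]; split=> [p|v].
  apply: (@differentiable_comp _ _ _ _ (fun x : 'rV[R]_N => x + h) f); last exact: df.
  exact: differentiableD.
rewrite (_ : 'D_v _ = fun p => 'D_v f (p + h)); first exact: (ih _ (Df v)).
by apply/funext => p; rewrite derive_translate.
Qed.

Lemma test_translate N (f : 'rV[R]_N -> R) h : test f -> test (fun x => f (x + h)).
Proof.
by move=> [sf cf]; split; [move=> k; exact: Ck_translate|exact: Cc_shift].
Qed.

End test_functions.

Section htype.
Context {R : realType} (a m : nat) (B : 'I_a -> 'I_m -> 'I_m -> R).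
Local Notation G := 'rV[R]_(a + m).

Definition dw (s : 'I_a) : G := delta_mx 0 (lshift m s).
Definition dq (k : 'I_m) : G := delta_mx 0 (rshift a k).
(** The central components of the left-invariant field equal to [dq k] at the origin, for the group
    law whose central part is w + w' + 2 B(q, q'). *)
Definition coef (s : 'I_a) (k : 'I_m) (p : G) : R :=
  \sum_j 2 * B s j k * p 0 (rshift a j).
Definition Zop (s : 'I_a) (f : G -> R) : G -> R := fun p => 'D_(dw s) f p.
Definition Xop (k : 'I_m) (f : G -> R) : G -> R :=
  fun p => 'D_(dq k) f p + \sum_s coef s k p * Zop s f p.

Lemma smooth_coef s k : smooth (coef s k).
Proof.
apply: smooth_sum => j; apply: smoothM; first exact: smooth_cst.
exact: smooth_proj.
Qed.

Lemma derive_coef s k v p :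
  'D_v (coef s k) p = \sum_j 2 * B s j k * v 0 (rshift a j).
Proof.
rewrite (_ : coef s k = \sum_j (fun p : G => 2 * B s j k * p 0 (rshift a j))).
  have dc j : derivable (fun p : G => p 0 (rshift a j) : R) p v.
    exact/smooth_derivable/smooth_proj.
  rewrite derive_sum => [|j]; last exact: derivableZ.
  apply: eq_bigr => j _.
  by rewrite (deriveZ (2 * B s j k) (dc j)) derive_proj.
by apply/funext => q; rewrite /coef fct_sumE.
Qed.

Lemma derive_coef_dq s k l p : 'D_(dq l) (coef s k) p = 2 * B s l k.
Proof.
rewrite derive_coef (bigD1 l)//= mxE !eqxx mulr1 big1 ?addr0// => j jl.
by rewrite mxE /= (inj_eq (@rshift_inj _ _)) (negbTE jl) mulr0.
Qed.

Lemma derive_coef_dw s k t p : 'D_(dw t) (coef s k) p = 0.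
Proof.
rewrite derive_coef big1// => j _.
by rewrite mxE /= eq_rlshift mulr0.
Qed.

Lemma test_Z s f : test f -> test (Zop s f).
Proof. exact: test_derive. Qed.

Lemma test_X k f : test f -> test (Xop k f).
Proof.
move=> Tf; rewrite (_ : Xop k f = (fun p => 'D_(dq k) f p) +
    \sum_s (fun p => coef s k p * Zop s f p)).
  apply: testD; first exact: test_derive.
  apply: test_sum => s; apply: testMl; [exact: smooth_coef|exact: test_Z].
by apply/funext => p; rewrite fctE fct_sumE.
Qed.

Lemma subspace_test : subspace_pred (@test R (a + m)).
Proof. by split; [exact: test0|exact: testD|exact: testZ]. Qed.

Lemma linear_Z s : linear_on (@test R (a + m)) (Zop s).
Proof.
split; first exact: test_Z.
- move=> u v [su _] [sv _]; apply/funext => p; rewrite /Zop.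
  by rewrite deriveD//; exact: smooth_derivable.
- move=> c u [su _]; apply/funext => p; rewrite /Zop.
  by rewrite deriveZ//; exact: smooth_derivable.
Qed.

Lemma linear_X k : linear_on (@test R (a + m)) (Xop k).
Proof.
split; first exact: test_X.
- move=> u v Tu Tv; have [su _] := Tu; have [sv _] := Tv.
  apply/funext => p; rewrite /Xop.
  have duv w : 'D_w (u + v) p = 'D_w u p + 'D_w v p.
    by rewrite deriveD//; exact: smooth_derivable.
  rewrite duv [RHS]addrACA -big_split/=; congr (_ + _).
  by apply: eq_bigr => s _; rewrite /Zop duv; ring.
- move=> c u [su _]; apply/funext => p; rewrite /Xop.
  have du w : 'D_w (c *: u) p = c * 'D_w u p.
    by rewrite deriveZ//; exact: smooth_derivable.
  rewrite du [RHS]mulrDr mulr_sumr; congr (_ + _); apply: eq_bigr => s _.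
  rewrite /Zop du; ring.
Qed.

Lemma derive_Xop k f v p : smooth f ->
  'D_v (Xop k f) p = 'D_v (fun q => 'D_(dq k) f q) p +
   \sum_s ('D_v (coef s k) p * Zop s f p + coef s k p * 'D_v (Zop s f) p).
Proof.
move=> sf; rewrite (_ : Xop k f = (fun p => 'D_(dq k) f p) +
    \sum_s (fun p => coef s k p * Zop s f p)); last first.
  by apply/funext => q; rewrite fctE fct_sumE.
have dc s : derivable (coef s k) p v by exact/smooth_derivable/smooth_coef.
have dZ s : derivable (Zop s f) p v by exact/smooth_derivable/smooth_derive.
have dcZ s : derivable (fun p => coef s k p * Zop s f p) p v by exact: derivableM.
rewrite deriveD; [|exact/smooth_derivable/smooth_derive|exact: derivable_sum].
congr (_ + _); rewrite derive_sum//; apply: eq_bigr => s _.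
rewrite (deriveM (dc s) (dZ s)).
by rewrite addrC [Zop s f p *: _]mulrC.
Qed.

Lemma derive_Zop w s f p : smooth f ->
  'D_w (Zop s f) p = Zop s (fun q => 'D_w f q) p.
Proof. by move=> sf; have := derive_comm (dw s) w p (sf 2%N). Qed.

Lemma XZ_comm k s f : test f -> Xop k (Zop s f) = Zop s (Xop k f).
Proof.
move=> [sf _]; apply/funext => p; rewrite [RHS]/Zop derive_Xop//.
rewrite {1}/Xop derive_Zop//; apply: congr2; first by [].
apply: eq_bigr => t _; rewrite derive_coef_dw mul0r add0r.
apply: congr2; first by [].
exact: (derive_Zop (dw t) s p sf).
Qed.

Hypothesis Bskew : forall s k l, B s l k = - B s k l.

(** The second derivatives of [f] enter as arbitrary arrays [P], [W], [Y]: they cancel by symmetry,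
    and only the derivatives of the coefficients survive, as 2 B_kl - 2 B_lk = 4 B_kl. *)
Lemma commutator_sums k l (P : 'I_m -> 'I_m -> R) (W : 'I_a -> 'I_m -> R)
    (Y : 'I_a -> 'I_a -> R) (ck cl z : 'I_a -> R) :
  P k l = P l k -> (forall s t, Y s t = Y t s) ->
  (P k l + \sum_s (2 * B s k l * z s + cl s * W s k) +
    \sum_s (ck s * W s l + \sum_t ck s * cl t * Y s t)) -
  (P l k + \sum_s (2 * B s l k * z s + ck s * W s l) +
    \sum_s (cl s * W s k + \sum_t cl s * ck t * Y s t)) =
  \sum_s 4 * B s k l * z s.
Proof.
move=> -> Ysym; rewrite !big_split/=.
have -> : \sum_s \sum_t ck s * cl t * Y s t = \sum_s \sum_t cl s * ck t * Y s t.
  rewrite exchange_big/=; apply: eq_bigr => s _; apply: eq_bigr => t _.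
  by rewrite Ysym [ck t * _]mulrC.
have -> : \sum_s 4 * B s k l * z s =
  \sum_s 2 * B s k l * z s - \sum_s 2 * B s l k * z s.
  by rewrite -sumrB; apply: eq_bigr => s _; rewrite (Bskew s k l); ring.
ring.
Qed.

Lemma XX_comm k l f : test f ->
  Xop k (Xop l f) - Xop l (Xop k f) = \sum_s (4 * B s k l) *: Zop s f.
Proof.
move=> [sf _]; apply/funext => p.
have E2 k' l' : Xop k' (Xop l' f) p =
    'D_(dq k') (fun q => 'D_(dq l') f q) p +
    \sum_s (2 * B s k' l' * Zop s f p +
             coef s l' p * 'D_(dw s) (fun q => 'D_(dq k') f q) p) +
    \sum_s (coef s k' p * 'D_(dw s) (fun q => 'D_(dq l') f q) p +
       \sum_t coef s k' p * coef t l' p * 'D_(dw s) (fun q => 'D_(dw t) f q) p).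
  rewrite {1}/Xop derive_Xop//; apply: congr2.
    apply: congr2; first by [].
    by apply: eq_bigr => s _; rewrite derive_coef_dq (derive_Zop (dq k') s p sf).
  apply: eq_bigr => s _; rewrite {1}/Zop derive_Xop// mulrDr; apply: congr2; first by [].
  rewrite mulr_sumr; apply: eq_bigr => t _.
  by rewrite derive_coef_dw mul0r add0r mulrA.
have Psym := derive_comm (dq l) (dq k) p (sf 2%N).
have Ysym s t := derive_comm (dw t) (dw s) p (sf 2%N).
rewrite fct_sumE; apply: etrans (congr2 (fun x y => x - y) (E2 k l) (E2 l k)) _.
exact: (@commutator_sums k l (fun k' l' => 'D_(dq k') (fun q => 'D_(dq l') f q) p)
  (fun s k' => 'D_(dw s) (fun q => 'D_(dq k') f q) p)
  (fun s t => 'D_(dw s) (fun q => 'D_(dw t) f q) p)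
  (fun s => coef s k p) (fun s => coef s l p) (fun s => Zop s f p) Psym Ysym).
Qed.

Definition l2form (u v : G -> R) := rint (fun p => u p * v p).

Lemma form_l2 : form_on (@test R (a + m)) l2form.
Proof.
split.
- move=> u v w [_ cu] [_ cv] [_ cw]; rewrite /l2form -rintD; [|exact: CcM..].
  by apply: eq_rint => p; rewrite fctE mulrDl.
- move=> c u w [_ cu] [_ cw]; rewrite /l2form -rintZ; last exact: CcM.
  by apply: eq_rint => p; rewrite -[LHS]mulrA.
- by move=> u v _ _; apply: eq_rint => p; rewrite mulrC.
Qed.

Lemma l2_skewD j u v : test u -> test v ->
  l2form (fun p => 'D_(delta_mx 0 j) u p) v = - l2form u (fun p => 'D_(delta_mx 0 j) v p).
Proof.
move=> Tu Tv; have [su cu] := Tu; have [sv cv] := Tv.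
have [_ cdu] := test_derive (delta_mx 0 j) Tu.
have [_ cdv] := test_derive (delta_mx 0 j) Tv.
apply/eqP; rewrite -addr_eq0 /l2form -rintD; [|exact: CcM..].
rewrite -[X in _ == X](rint_derive_test j (testM Tu Tv)); apply/eqP/eq_rint => p.
rewrite deriveM; [|exact: smooth_derivable..].
by rewrite addrC ['D_ _ u p * _]mulrC.
Qed.

Lemma l2_skewZ s : skew_on (@test R (a + m)) l2form (Zop s).
Proof. by move=> u v; exact: l2_skewD. Qed.

(** The coefficients of [X k] are constant in the central directions along which they multiply a
    derivative, so the field is divergence free. *)
Lemma l2_skewX k : skew_on (@test R (a + m)) l2form (Xop k).
Proof.
move=> u v Tu Tv; have sc s : smooth (coef s k) by exact: smooth_coef.
have cT (w : G -> R) (Tw : test w) := Tw.2.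
have Tcv s : test (fun p => coef s k p * v p) by exact: testMl.
have E1 : l2form (Xop k u) v = l2form (fun p => 'D_(dq k) u p) v +
    \sum_s l2form (Zop s u) (fun p => coef s k p * v p).
  rewrite -rint_sum => [|s]; last by apply: CcM; apply: cT => //; exact: test_Z.
  rewrite -rintD.
  - apply: eq_rint => p; rewrite mulrDl mulr_suml; congr (_ + _).
    by apply: eq_bigr => s _; ring.
  - by apply: CcM; apply: cT => //; exact: test_derive.
  - by apply: Cc_sum => s; apply: CcM; apply: cT => //; exact: test_Z.
have E2 : l2form u (Xop k v) = l2form u (fun p => 'D_(dq k) v p) +
    \sum_s l2form u (Zop s (fun p => coef s k p * v p)).
  rewrite -rint_sum => [|s]; last by apply: CcM; apply: cT => //; exact: test_Z.
  rewrite -rintD.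
  - apply: eq_rint => p; rewrite mulrDr mulr_sumr; congr (_ + _).
    apply: eq_bigr => s _; congr (_ * _).
    rewrite /Zop deriveM; [|exact: smooth_derivable|by apply: smooth_derivable; case: Tv].
    by rewrite derive_coef_dw scaler0 addr0.
  - by apply: CcM; apply: cT => //; exact: test_derive.
  - by apply: Cc_sum => s; apply: CcM; apply: cT => //; exact: test_Z.
rewrite E1 E2 l2_skewD// opprD -sumrN; congr (_ + _); apply: eq_bigr => s _.
exact: l2_skewZ.
Qed.

End htype.

Section continuous_fun.
Context {R : realType} {T : topologicalType}.
Implicit Types f g : T -> R.

Lemma continuous_funD f g : continuous f -> continuous g ->
  continuous (fun x => f x + g x).
Proof. by move=> cf cg x; apply: (@continuousD _ _ _ f g); [exact: cf|exact: cg]. Qed.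

Lemma continuous_funM f g : continuous f -> continuous g ->
  continuous (fun x => f x * g x).
Proof. by move=> cf cg x; apply: (@continuousM _ _ f g); [exact: cf|exact: cg]. Qed.

End continuous_fun.

(** * Central correlations and their cosine transforms *)

Section correlation.
Context {R : realType} (a m : nat) (B : 'I_a -> 'I_m -> 'I_m -> R).
Local Notation G := 'rV[R]_(a + m).
Local Notation Z := (@Zop R a m).
Local Notation X := (Xop B).

Definition central (h : 'rV[R]_a) : G := row_mx h 0.

Definition corr (u v : G -> R) (h : 'rV[R]_a) : R :=
  l2form u (fun p => v (p + central h)).

(** The integrand of [Jform] as one function of the translation and the point. Its support is
    bounded even when [g] is a cosine, because the factors [u] and [v] confine p and p + h. *)
Definition joint (g : 'rV[R]_a -> R) (u v : G -> R) (z : 'rV[R]_(a + (a + m))) : R :=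
  g (lsubmx z) * (u (rsubmx z) * v (rsubmx z + central (lsubmx z))).

Lemma Cc_joint (g : 'rV[R]_a -> R) (u v : G -> R) : continuous g -> Cc u -> Cc v -> Cc (joint g u v).
Proof.
move=> cg [cu [M hM]] [cv [M' hM']]; split.
  have c1 : continuous (fun z : 'rV[R]_(a + (a + m)) => g (lsubmx z)).
    by move=> z; apply: continuous_comp; [exact: continuous_lsubmx|exact: cg].
  have c2 : continuous (fun z : 'rV[R]_(a + (a + m)) => u (rsubmx z)).
    by move=> z; apply: continuous_comp; [exact: continuous_rsubmx|exact: cu].
  have c3 : continuous (fun z : 'rV[R]_(a + (a + m)) => rsubmx z + central (lsubmx z)).
    have c4 : continuous (fun z : 'rV[R]_(a + (a + m)) => central (lsubmx z)).
      by apply: continuous_row_mx => w; [exact: continuous_lsubmx|exact: cst_continuous].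
    by move=> z; apply: continuousD; [exact: continuous_rsubmx|exact: c4].
  have c5 : continuous (fun z : 'rV[R]_(a + (a + m)) => v (rsubmx z + central (lsubmx z))).
    by move=> z; apply: continuous_comp; [exact: c3|exact: cv].
  move=> z; apply: (@continuousM _ _ (fun z => g (lsubmx z))); first exact: c1.
  by apply: continuousM; [exact: c2|exact: c5].
exists (`|M| + `|M'|) => z; rewrite !mulf_eq0 !negb_or => /and3P[_ /hM h1 /hM' h2].
have h1' : `|rsubmx z| <= `|M| by apply: le_trans h1 (ler_norm _).
have h2' : `|rsubmx z + central (lsubmx z)| <= `|M'| by apply: le_trans h2 (ler_norm _).
have h3 : `|central (lsubmx z)| <= `|M| + `|M'|.
  have := ler_normB (rsubmx z + central (lsubmx z)) (rsubmx z).
  by rewrite [X in `|X|]addrC addKr addrC => /le_trans; apply; exact: lerD.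
rewrite -[z]hsubmxK; apply: norm_row_mx_le.
  by apply: le_trans h3; exact: norm_row_mxl.
by apply: le_trans h1' _; rewrite lerDl.
Qed.

Lemma jointE g u v h p : joint g u v (row_mx h p) = g h * (u p * v (p + central h)).
Proof. by rewrite /joint row_mxKl row_mxKr. Qed.

Lemma Cc_corr (u v : G -> R) : Cc u -> Cc v -> Cc (corr u v).
Proof.
move=> cu cv.
have c1 : continuous (fun _ : 'rV[R]_a => 1 : R) by move=> h; exact: cst_continuous.
have := Cc_rint (Cc_joint c1 cu cv); congr Cc; apply/funext => h.
by apply: eq_rint => p; rewrite jointE mul1r.
Qed.

Definition Jform (g : 'rV[R]_a -> R) (u v : G -> R) : R :=
  rint (fun h => g h * corr u v h).

Lemma Jform_joint (g : 'rV[R]_a -> R) (u v : G -> R) : continuous g -> Cc u -> Cc v ->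
  Jform g u v = rint (joint g u v).
Proof.
move=> cg cu cv; rewrite (rint_app (Cc_joint cg cu cv)); apply: eq_rint => h.
rewrite -rintZ; last by apply: CcM => //; exact: Cc_shift.
by apply: eq_rint => p; rewrite jointE.
Qed.

Lemma CcJ (g : 'rV[R]_a -> R) (u v : G -> R) : continuous g -> Cc u -> Cc v -> Cc (fun h => g h * corr u v h).
Proof. by move=> cg cu cv; apply: CcMl => //; exact: Cc_corr. Qed.

Lemma coef_central s k p h : coef B s k (p + central h) = coef B s k p.
Proof.
by apply: eq_bigr => j _; rewrite mxE row_mxEr mxE addr0.
Qed.

Lemma Z_translate s v h : Z s (fun p => v (p + h)) = (fun p => Z s v (p + h)).
Proof. by apply/funext => p; exact: derive_translate. Qed.

(** A central translation is also a left translation, hence commutes with left-invariant fields.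
    This makes the fields skew for [corr] at each fixed [h]. *)
Lemma X_translate k v h :
  X k (fun p => v (p + central h)) = (fun p => X k v (p + central h)).
Proof.
apply/funext => p; rewrite /Xop derive_translate; congr (_ + _).
by apply: eq_bigr => s _; rewrite Z_translate coef_central.
Qed.

Lemma corr_skewZ s u v h : test u -> test v -> corr (Z s u) v h = - corr u (Z s v) h.
Proof.
by move=> Tu Tv; rewrite /corr l2_skewZ ?Z_translate//; exact: test_translate.
Qed.

Lemma corr_skewX k u v h : test u -> test v -> corr (X k u) v h = - corr u (X k v) h.
Proof.
by move=> Tu Tv; rewrite /corr l2_skewX ?X_translate//; exact: test_translate.
Qed.

Lemma JformN (g : 'rV[R]_a -> R) u v : Cc (fun h => g h * corr u v h) ->
  rint (fun h => g h * - corr u v h) = - Jform g u v.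
Proof. by move=> C; rewrite -rintN//; apply: eq_rint => h; rewrite mulrN. Qed.

Lemma Jform_skew (T : (G -> R) -> G -> R) (g : 'rV[R]_a -> R) u v : continuous g -> Cc u -> Cc (T v) ->
  (forall h, corr (T u) v h = - corr u (T v) h) ->
  Jform g (T u) v = - Jform g u (T v).
Proof.
move=> cg cu cv skT; rewrite -JformN; last exact: CcJ.
by apply: eq_rint => h; rewrite skT.
Qed.

Lemma centralD h h' : central (h + h') = central h + central h'.
Proof. by rewrite /central add_row_mx addr0. Qed.

Lemma central_delta t s : central (t *: delta_mx 0 s) = t *: dw m s.
Proof.
apply/rowP => j; case: (split_ordP j) => i ->; rewrite !mxE.
  by rewrite (unsplitK (inl i : _ + 'I_m)) !mxE /= (inj_eq (@lshift_inj _ _)).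
by rewrite (unsplitK (inr i : 'I_a + _)) !mxE /= eq_rlshift mulr0.
Qed.

Lemma is_derive_joint (g dg : 'rV[R]_a -> R) s u v z : test u -> test v ->
  is_derive (lsubmx z) (delta_mx 0 s) g (dg (lsubmx z)) ->
  is_derive z (delta_mx 0 (lshift (a + m) s) : 'rV[R]_(a + (a + m))) (joint g u v)
   (joint dg u v z + joint g u (Z s v) z).
Proof.
move=> Tu [sv _] dgE.
pose D : 'rV[R]_(a + (a + m)) := delta_mx 0 (lshift (a + m) s).
have lD : lsubmx D = delta_mx 0 s.
  by apply/rowP => j; rewrite !mxE /= (inj_eq (@lshift_inj _ _)).
have rD : rsubmx D = 0.
  by apply/rowP => j; rewrite !mxE /= eq_rlshift.
have F1 : is_derive z D (fun z => g (lsubmx z)) (dg (lsubmx z)).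
  apply: is_derive_line dgE => t; congr g.
  by rewrite linearD linearZ /= lD.
have F2 : is_derive z D (fun z => u (rsubmx z)) 0.
  apply: (@is_derive_line _ _ _ _ (cst (u (rsubmx z))) _ z D) => t.
  by rewrite linearD linearZ /= rD scaler0 add0r.
have F3 : is_derive z D (fun z => v (rsubmx z + central (lsubmx z)))
    (Z s v (rsubmx z + central (lsubmx z))).
  have dv : is_derive (rsubmx z + central (lsubmx z)) (dw m s) v
      (Z s v (rsubmx z + central (lsubmx z))).
    by apply: derivableP; exact: smooth_derivable.
  apply: is_derive_line dv => t; congr v.
  rewrite !linearD !linearZ /= lD rD scaler0 add0r centralD central_delta.
  by rewrite [RHS]addrCA.
have F12 := is_deriveM F1 (is_deriveM F2 F3).
apply: is_derive_eq F12 _.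
rewrite /joint scaler0 addr0 addrC; congr (_ + _); exact: mulrC.
Qed.

(** [Z s v] at p + h is also the derivative of v(p + h) in [h]; integrating by parts in [h], and not
    in p, moves it to the weight [g]. *)
Lemma Jform_Z (g dg : 'rV[R]_a -> R) s u v : continuous g -> continuous dg ->
  (forall h, is_derive h (delta_mx 0 s) g (dg h)) -> test u -> test v ->
  Jform g u (Z s v) = - Jform dg u v.
Proof.
move=> cg cdg dgE Tu Tv; have [_ cu] := Tu; have [_ cv] := Tv.
have [_ cZ] := test_Z s Tv.
have c1 := Cc_joint cg cu cv; have c2 := Cc_joint cdg cu cv.
have c3 := Cc_joint cg cu cZ.
apply/eqP; rewrite -addr_eq0 addrC !Jform_joint// -rintD//; apply/eqP.
by apply: (rint_derive0 c1 (CcD c2 c3)) => z; exact: is_derive_joint.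
Qed.

Lemma is_derive_cos_dot l s (h : 'rV[R]_a) :
  is_derive h (delta_mx 0 s) (fun h => cos (dot l h)) (- l 0 s * sin (dot l h)).
Proof.
have dl : is_derive (0 : R) (1 : R) (fun t : R => cos (t * l 0 s + dot l h))
    (- l 0 s * sin (dot l h)).
  by apply: is_derive_eq; rewrite mul0r add0r addr0 scaler0 add0r /GRing.scale/=; ring.
apply: is_derive_line dl => t; congr cos.
by rewrite [t *: 1]mulr1 addr0 dotDr dotZr dot_deltar.
Qed.

Lemma is_derive_sin_dot l s (h : 'rV[R]_a) :
  is_derive h (delta_mx 0 s) (fun h => sin (dot l h)) (l 0 s * cos (dot l h)).
Proof.
have dl : is_derive (0 : R) (1 : R) (fun t : R => sin (t * l 0 s + dot l h))
    (l 0 s * cos (dot l h)).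
  by apply: is_derive_eq; rewrite mul0r add0r addr0 scaler0 add0r /GRing.scale/=; ring.
apply: is_derive_line dl => t; congr sin.
by rewrite [t *: 1]mulr1 addr0 dotDr dotZr dot_deltar.
Qed.

Lemma continuous_sin_dot (l : 'rV[R]_a) : continuous (fun h => sin (dot l h)).
Proof.
by move=> h; apply: continuous_comp; [exact: continuous_dot|exact: continuous_sin].
Qed.

Definition cosform l := Jform (fun h => cos (dot l h)).

Lemma JformZl c (g : 'rV[R]_a -> R) u v : continuous g -> Cc u -> Cc v ->
  Jform (fun h => c * g h) u v = c * Jform g u v.
Proof.
move=> cg cu cv; rewrite -rintZ; last exact: CcJ.
by apply: eq_rint => h; rewrite mulrA.
Qed.

(** [Z s] first passes to the right by skewness; then two integrations by parts in [h] turn the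
    cosine into a sine and back. *)
Lemma cosform_ZZ l s t u v : test u -> test v ->
  cosform l (Z s u) (Z t v) = l 0 s * l 0 t * cosform l u v.
Proof.
move=> Tu Tv; have cc := @continuous_cos_dot R a l; have cs := @continuous_sin_dot l.
have TZ := test_Z t Tv; have TZZ := test_Z s TZ; have [_ cu] := Tu; have [_ cv] := Tv.
rewrite /cosform Jform_skew//; [|by case: TZZ|by move=> h; exact: corr_skewZ].
have cs' : continuous (fun h => - l 0 s * sin (dot l h)).
  by move=> h; apply: (@continuousM _ _ (fun=> - l 0 s)); [exact: cst_continuous|exact: cs].
have cc' : continuous (fun h => l 0 t * cos (dot l h)).
  by move=> h; apply: (@continuousM _ _ (fun=> l 0 t)); [exact: cst_continuous|exact: cc].
rewrite (Jform_Z cc cs' (is_derive_cos_dot l s) Tu TZ) opprK.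
rewrite (JformZl (- l 0 s) cs cu TZ.2).
rewrite (Jform_Z cs cc' (is_derive_sin_dot l t) Tu Tv) (JformZl (l 0 t) cc cu cv).
by ring.
Qed.

(** After the substitution h -> h - w and the addition formula, the form is the integral over q of
    [uc q ^+ 2 + us q ^+ 2], the squared modulus of the partial Fourier transform of [u] in the
    central variables. *)
Lemma cosform_ge0 l u : Cc u -> 0 <= cosform l u u.
Proof.
move=> cu; have cc := @continuous_cos_dot R a l; have cs := @continuous_sin_dot l.
have ccu : Cc (fun z : G => cos (dot l (lsubmx z)) * u z).
  apply: CcMl => // z; apply: (@continuous_comp _ _ _ (fun z : G => lsubmx z) (fun h => cos (dot l h))).
    exact: continuous_lsubmx.
  exact: cc.
have csu : Cc (fun z : G => sin (dot l (lsubmx z)) * u z).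
  apply: CcMl => // z; apply: (@continuous_comp _ _ _ (fun z : G => lsubmx z) (fun h => sin (dot l h))).
    exact: continuous_lsubmx.
  exact: cs.
pose uc (q : 'rV[R]_m) := rint (fun h : 'rV[R]_a => cos (dot l h) * u (row_mx h q)).
pose us (q : 'rV[R]_m) := rint (fun h : 'rV[R]_a => sin (dot l h) * u (row_mx h q)).
have Cuc : Cc uc.
  have := Cc_rintl ccu; congr Cc; apply/funext => q; apply: eq_rint => h.
  by rewrite row_mxKl.
have Cus : Cc us.
  have := Cc_rintl csu; congr Cc; apply/funext => q; apply: eq_rint => h.
  by rewrite row_mxKl.
have inner w q : rint (fun h => cos (dot l h) * u (row_mx w q + central h)) =
    cos (dot l w) * uc q + sin (dot l w) * us q.
  have Cslice : Cc (fun h : 'rV[R]_a => u (row_mx h q)) by exact: Cc_slicer.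
  have C1 : Cc (fun h => cos (dot l h) * u (row_mx h q)) by exact: CcMl.
  have C2 : Cc (fun h => sin (dot l h) * u (row_mx h q)) by exact: CcMl.
  rewrite -!rintZ// -rintD; [|exact: CcZ..].
  have C3 : Cc (fun h => cos (dot l w) * (cos (dot l h) * u (row_mx h q)) +
      sin (dot l w) * (sin (dot l h) * u (row_mx h q))).
    by apply: CcD; exact: CcZ.
  rewrite -(rint_shift w C3); apply: eq_rint => h.
  rewrite /central add_row_mx addr0 [w + h]addrC.
  have -> : dot l h = dot l (h + w) - dot l w by rewrite dotDr addrK.
  by rewrite cosB; ring.
rewrite /cosform Jform_joint// (rint_app (Cc_joint cc cu cu)).
rewrite (rint_swap (Cc_joint cc cu cu)).
pose F (p : G) := u p * (cos (dot l (lsubmx p)) * uc (rsubmx p) + sin (dot l (lsubmx p)) * us (rsubmx p)).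
have CF : Cc F.
  have cr (w : 'rV[R]_m -> R) : continuous w -> continuous (fun p : G => w (rsubmx p)).
    by move=> cw p; apply: continuous_comp; [exact: continuous_rsubmx|exact: cw].
  have cl (w : 'rV[R]_a -> R) : continuous w -> continuous (fun p : G => w (lsubmx p)).
    by move=> cw p; apply: continuous_comp; [exact: continuous_lsubmx|exact: cw].
  apply: CcMr; first exact: cu.
  by apply: continuous_funD; apply: continuous_funM; [exact: (cl _ cc)|
    exact: (cr _ Cuc.1)|exact: (cl _ cs)|exact: (cr _ Cus.1)].
have -> : rint (fun p : G => rint (fun h => joint (fun h => cos (dot l h)) u u (row_mx h p))) =
    rint F.
  apply: eq_rint => p; rewrite /F -inner hsubmxK -rintZ; last first.
    apply: CcMl => //; rewrite -[p]hsubmxK.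
    have := Cc_shift (lsubmx p) (Cc_slicer (rsubmx p) cu); congr Cc.
    by apply/funext => h; rewrite /central add_row_mx addr0 addrC.
  by apply: eq_rint => h; rewrite jointE; ring.
rewrite (rint_app CF) (rint_swap CF); apply: rint_ge0 => q.
have -> : rint (fun w : 'rV[R]_a => F (row_mx w q)) = uc q ^+ 2 + us q ^+ 2.
  have Cslice : Cc (fun h : 'rV[R]_a => u (row_mx h q)) by exact: Cc_slicer.
  have C1 : Cc (fun h => cos (dot l h) * u (row_mx h q)) by exact: CcMl.
  have C2 : Cc (fun h => sin (dot l h) * u (row_mx h q)) by exact: CcMl.
  rewrite !expr2 -!rintZ// -rintD; [|exact: CcZ..].
  by apply: eq_rint => w; rewrite /F row_mxKl row_mxKr; ring.
by rewrite addr_ge0// sqr_ge0.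
Qed.

End correlation.

(** * The Hessian estimate on a group of Heisenberg type *)

Section hessian_estimate.
Context {R : realType} (a m : nat) (B : 'I_a -> 'I_m -> 'I_m -> R).
Local Notation G := 'rV[R]_(a + m).
Local Notation Z := (@Zop R a m).
Local Notation X := (Xop B).
Local Notation test := (@test R (a + m)).

Lemma corrDl (u v w : G -> R) h : Cc u -> Cc v -> Cc w ->
  corr (u + v) w h = corr u w h + corr v w h.
Proof.
move=> cu cv cw; rewrite -rintD; [|by apply: CcM => //; exact: Cc_shift..].
by apply: eq_rint => p; rewrite mulrDl.
Qed.

Lemma corrDr (u v w : G -> R) h : Cc u -> Cc v -> Cc w ->
  corr w (u + v) h = corr w u h + corr w v h.
Proof.
move=> cu cv cw; rewrite -rintD; [|by apply: CcM => //; exact: Cc_shift..].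
by apply: eq_rint => p; rewrite mulrDr.
Qed.

Lemma corrZl c (u w : G -> R) h : Cc u -> Cc w ->
  corr (c *: u) w h = c * corr u w h.
Proof.
move=> cu cw; rewrite -rintZ; last by apply: CcM => //; exact: Cc_shift.
by apply: eq_rint => p; rewrite mulrA.
Qed.

Lemma corrZr c (u w : G -> R) h : Cc u -> Cc w ->
  corr w (c *: u) h = c * corr w u h.
Proof.
move=> cu cw; rewrite -rintZ; last by apply: CcM => //; exact: Cc_shift.
by apply: eq_rint => p; rewrite mulrCA.
Qed.

(** The reflection h -> -h would show [cosform l] itself to be symmetric; adding the transposed form
    gives symmetry at once, at the cost of a factor 2. *)
Definition Qcos l (u v : G -> R) := cosform l u v + cosform l v u.

Lemma form_Qcos l : form_on test (Qcos l).
Proof.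
have cc := @continuous_cos_dot R a l.
split.
- move=> u v w [_ cu] [_ cv] [_ cw]; rewrite /Qcos addrACA; congr (_ + _).
  + rewrite -rintD; [|exact: CcJ..].
    by apply: eq_rint => h; rewrite corrDl// mulrDr.
  + rewrite -rintD; [|exact: CcJ..].
    by apply: eq_rint => h; rewrite corrDr// mulrDr.
- move=> c u w [_ cu] [_ cw]; rewrite /Qcos mulrDr; congr (_ + _).
  + rewrite -rintZ; last exact: CcJ.
    by apply: eq_rint => h; rewrite corrZl// mulrCA.
  + rewrite -rintZ; last exact: CcJ.
    by apply: eq_rint => h; rewrite corrZr// mulrCA.
- by move=> u v _ _; exact: addrC.
Qed.

Lemma Qcos_skewX l k : skew_on test (Qcos l) (X k).
Proof.
have cc := @continuous_cos_dot R a l.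
have sk u v : test u -> test v -> cosform l (X k u) v = - cosform l u (X k v).
  move=> Tu Tv; have TX := test_X B k Tv.
  apply: (Jform_skew cc Tu.2 TX.2) => h; exact: corr_skewX.
move=> u v Tu Tv; rewrite /Qcos sk// opprD; congr (_ + _).
by rewrite (sk v u)// opprK.
Qed.

Lemma Qcos_ZZ l s t u v : test u -> test v ->
  Qcos l (Z s u) (Z t v) = l 0 s * l 0 t * Qcos l u v.
Proof. by move=> Tu Tv; rewrite /Qcos !cosform_ZZ// [l 0 t * _]mulrC mulrDr. Qed.

Lemma Qcos_ge0 l u : test u -> 0 <= Qcos l u u.
Proof. by move=> [_ cu]; rewrite addr_ge0// cosform_ge0. Qed.

Hypotheses (Bskew : forall s k l, B s l k = - B s k l)
  (Bcliff : forall s t j i,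
     \sum_k (B s k j * B t k i + B t k j * B s k i) = 2 * ((s == t) && (j == i))%:R).

Lemma corr0 (u v : G -> R) : corr u v 0 = l2form u v.
Proof. by apply: eq_rint => p; rewrite /central row_mx0 addr0. Qed.

Lemma l2_vertical_le_lap f : test f ->
  4 * m%:R ^+ 2 * \sum_s l2form (Z s f) (Z s f) <= l2form (lap X f) (lap X f).
Proof.
move=> Tf; have subT := @subspace_test R a m.
have TL : test (lap X f) by apply: test_sum => k; do 2 apply: test_X.
have TZ s : test (Z s f) by exact: test_Z.
pose Psi h := corr (lap X f) (lap X f) h - 4 * m%:R ^+ 2 * \sum_s corr (Z s f) (Z s f) h.
have C1 : Cc (corr (lap X f) (lap X f)) by apply: Cc_corr; exact: TL.2.
have C2 s : Cc (corr (Z s f) (Z s f)) by apply: Cc_corr; exact: (TZ s).2.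
have C3 : Cc (fun h => 4 * m%:R ^+ 2 * \sum_s corr (Z s f) (Z s f) h).
  by apply: CcZ; exact: Cc_sum.
have CPsi : Cc Psi by apply: CcD => //; exact: CcN.
rewrite -subr_ge0 -corr0; have -> : \sum_s l2form (Z s f) (Z s f) =
  \sum_s corr (Z s f) (Z s f) 0 by apply: eq_bigr => s _; rewrite corr0.
rewrite -/(Psi 0); apply: ge0_of_cos_transform_ge0 => // l.
have cc := @continuous_cos_dot R a l.
have -> : rint (fun h => cos (dot l h) * Psi h) =
    cosform l (lap X f) (lap X f) - 4 * m%:R ^+ 2 * \sum_s cosform l (Z s f) (Z s f).
  have D1 := CcMl cc C1; have D2 s := CcMl cc (C2 s).
  rewrite -rint_sum// -rintZ; last exact: Cc_sum.
  rewrite -rintB//; last by apply: CcZ; exact: Cc_sum.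
  by apply: eq_rint => h; rewrite /Psi mulrBr mulrCA mulr_sumr.
have := vertical_le_lap subT (linear_X B) (@linear_Z R a m) (fun k s f => @XZ_comm R a m B k s f)
  (fun k l f => @XX_comm R a m B Bskew k l f)
  Bskew Bcliff (form_Qcos l) (lam := fun s => l 0 s) (Qcos_skewX l) (@Qcos_ZZ l) (@Qcos_ge0 l) Tf.
(* The factor 2 of the symmetrization appears on both sides. *)
rewrite card_ord /Qcos big_split/= mulrDr.
move: (cosform _ _ _) (4 * _ * _) => x y; lra.
Qed.

Theorem l2_hessian_le_lap f : (0 < m)%N -> test f ->
  \sum_k \sum_l l2form (X k (X l f)) (X k (X l f)) <=
  (1 + 4 / m%:R) * l2form (lap X f) (lap X f).
Proof.
move=> m0 Tf.
rewrite (hessian_norm_form (@subspace_test R a m) (linear_X B) (@linear_Z R a m)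
  (fun k s f => @XZ_comm R a m B k s f) (fun k l f => @XX_comm R a m B Bskew k l f)
  Bskew Bcliff (@form_l2 R a m) (l2_skewX B) Tf).
rewrite card_ord [X in _ <= X]mulrDl mul1r lerD2l.
have m0R : 0 < m%:R :> R by rewrite ltr0n.
(* Multiplied by 4 / m, the coefficient 4 m^2 becomes 16 m, the weight of the vertical terms in
   [hessian_norm_form]. *)
have := l2_vertical_le_lap Tf; rewrite -(ler_pM2l (divr_gt0 (ltr0n R 4) m0R)).
apply: le_trans; rewrite le_eqVlt; apply/orP; left; apply/eqP.
by move: (\sum_s _) => x; field; rewrite gt_eqF.
Qed.

End hessian_estimate.

(** * The quaternionic Heisenberg group *)

Section quaternion_matrices.
Context {R : realType}.

(* [beta s i j] is the [s]-th imaginary coordinate of [e_i * conj e_j], where [e_0, .., e_3] are the units 1, i, j, k *)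
Definition beta (s : 'I_3) (i j : 'I_4) : R :=
  nth 0 (nth [::] (nth [::]
    [:: [:: [:: 0; -1; 0; 0]; [:: 1; 0; 0; 0]; [:: 0; 0; 0; -1]; [:: 0; 0; 1; 0]];
        [:: [:: 0; 0; -1; 0]; [:: 0; 0; 0; 1]; [:: 1; 0; 0; 0]; [:: 0; -1; 0; 0]];
        [:: [:: 0; 0; 0; -1]; [:: 0; 0; -1; 0]; [:: 0; 1; 0; 0]; [:: 1; 0; 0; 0]]]
    s) i) j.

Lemma betaE s (x y : 'rV[R]_4) :
  qmul x (qconj y) 0 (lift ord0 s) = \sum_i \sum_j beta s i j * x 0 i * y 0 j.
Proof.
rewrite !big_ord_recl !big_ord0 /qmul /qconj !mxE /=.
(* The indices in [qmul] are numerals of the ring ['I_4], while expanding the sums produces iterated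
   lifts. *)
have l1 : lift ord0 ord0 = 1%R :> 'I_4 by exact: val_inj.
have l2 : lift ord0 (lift ord0 ord0) = 2%:R :> 'I_4 by exact: val_inj.
have l3 : lift ord0 (lift ord0 (lift ord0 ord0)) = 3%:R :> 'I_4 by exact: val_inj.
rewrite l3 l2 l1.
case: s => [[|[|[|//]]] s3]; rewrite /beta /=; ring.
Qed.

Lemma beta_skew s i j : beta s j i = - beta s i j.
Proof.
by case: s => [[|[|[|//]]] s3]; case: i => [[|[|[|[|//]]]] i4];
  case: j => [[|[|[|[|//]]]] j4]; rewrite /beta /= ?oppr0 ?opprK.
Qed.

Lemma beta_clifford s t j i :
  \sum_k (beta s k j * beta t k i + beta t k j * beta s k i) =
  2 * ((s == t) && (j == i))%:R.
Proof.
rewrite !big_ord_recl big_ord0.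
by case: s => [[|[|[|//]]] s3]; case: t => [[|[|[|//]]] t3];
  case: i => [[|[|[|[|//]]]] i4];
  case: j => [[|[|[|[|//]]]] j4]; rewrite /beta -?val_eqE /=; ring.
Qed.

Context (n : nat).
Local Notation G := 'rV[R]_(3 + n * 4).

(** The inverse of [mxvec_index]: quaternionic slot and real component of a flat coordinate. *)
Definition qindex (k : 'I_(n * 4)) : 'I_n * 'I_4 :=
  enum_val (cast_ord (esym (mxvec_cast n 4)) k).

Lemma mxvec_indexK alpha i : qindex (mxvec_index alpha i) = (alpha, i).
Proof. by rewrite /qindex /mxvec_index cast_ordK enum_rankK. Qed.

Lemma qindex_inj : injective qindex.
Proof. by move=> k l /enum_val_inj /cast_ord_inj. Qed.

Lemma sum_mxvec (F : 'I_(n * 4) -> R) :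
  \sum_k F k = \sum_alpha \sum_i F (mxvec_index alpha i).
Proof.
rewrite pair_bigA /= (reindex _ (curry_mxvec_bij _ _)) /=.
by apply: eq_bigr => -[].
Qed.

(** Block diagonal, one block [beta s] per quaternionic coordinate: the matrix of the [s]-th
    component of Im (q . conj q'). *)
Definition Bm (s : 'I_3) (k l : 'I_(n * 4)) : R :=
  ((qindex k).1 == (qindex l).1)%:R * beta s (qindex k).2 (qindex l).2.

Lemma Bm_skew s k l : Bm s l k = - Bm s k l.
Proof. by rewrite /Bm eq_sym beta_skew mulrN. Qed.

Lemma Bm_clifford s t j i :
  \sum_k (Bm s k j * Bm t k i + Bm t k j * Bm s k i) =
  2 * ((s == t) && (j == i))%:R.
Proof.
case/mxvec_indexP: j => g j; case/mxvec_indexP: i => d i.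
have -> : (mxvec_index g j == mxvec_index d i) = (g == d) && (j == i).
  by rewrite -(inj_eq qindex_inj) !mxvec_indexK.
rewrite sum_mxvec /Bm.
under eq_bigr do under eq_bigr do rewrite !mxvec_indexK /=.
rewrite (bigD1 g)//= [X in _ + X]big1 => [|al ag]; last first.
  by rewrite big1// => l _; rewrite (negbTE ag) mulr0n !(mul0r, mulr0) addr0.
rewrite eqxx addr0; have [_|gd] := eqVneq g d.
  by under eq_bigr do rewrite !mulr1n !mul1r; rewrite beta_clifford.
by rewrite /= andbF mulr0 big1// => l _; rewrite mulr0n !(mul0r, mulr0) addr0.
Qed.

Lemma quatE (p : G) alpha i : quat p alpha 0 i = p 0 (rshift 3 (mxvec_index alpha i)).
Proof. by rewrite /quat !mxE. Qed.

Definition bform (s : 'I_3) (p v : G) : R :=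
  \sum_k \sum_l Bm s k l * p 0 (rshift 3 k) * v 0 (rshift 3 l).

Lemma bformE s (p v : G) : bform s p v =
  \sum_alpha \sum_i \sum_j beta s i j * quat p alpha 0 i * quat v alpha 0 j.
Proof.
rewrite /bform sum_mxvec; apply: eq_bigr => al _; apply: eq_bigr => i _.
rewrite sum_mxvec (bigD1 al)//= [X in _ + X]big1 => [|g gal]; last first.
  by rewrite big1// => l _; rewrite /Bm !mxvec_indexK/= eq_sym (negbTE gal) mulr0n !mul0r.
by rewrite addr0; apply: eq_bigr => j _; rewrite /Bm !mxvec_indexK eqxx/= mulr1n mul1r !quatE.
Qed.

Lemma bform_skew s p v : bform s v p = - bform s p v.
Proof.
rewrite /bform exchange_big/= -sumrN; apply: eq_bigr => k _.
by rewrite -sumrN; apply: eq_bigr => l _; rewrite Bm_skew; ring.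
Qed.

(** With x = q . conj v, the bracket in the contact form is - x + conj x = - 2 Im x. *)
Lemma ThetaE s (p v : G) :
  Theta s p v = 2^-1 * v 0 (lshift (n * 4) s) - bform s p v.
Proof.
rewrite /Theta /Theta_im !mxE summxE.
under eq_bigr do rewrite mxE [X in X + _]mxE !betaE.
by rewrite big_split/= sumrN -!bformE bform_skew; field.
Qed.

Lemma heis_metricE (p u v : G) :
  heis_metric p u v = \sum_k u 0 (rshift 3 k) * v 0 (rshift 3 k).
Proof.
rewrite sum_mxvec; apply: eq_bigr => al _; apply: eq_bigr => i _.
by rewrite !quatE.
Qed.

End quaternion_matrices.

(** * The left-invariant frame, the Reeb fields and the Biquard connection *)

Section left_invariant_frame.
Context {R : realType} (n : nat).
Local Notation G := 'rV[R]_(3 + n * 4).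
Local Notation X := (Xop (@Bm R n)).

(** The operator [X k] as a vector field. *)
Definition Ef (k : 'I_(n * 4)) : vfield R (3 + n * 4) := fun p =>
  dq 3 k + \sum_s coef (@Bm R n) s k p *: dw (n * 4) s.

Lemma Ef_q k p j : Ef k p 0 (rshift 3 j) = (j == k)%:R.
Proof.
rewrite /Ef /dq mxE mxE summxE (inj_eq (@rshift_inj _ _)) big1 ?addr0// => s _.
by rewrite /dw !mxE eq_rlshift mulr0.
Qed.

Lemma Ef_w k p s : Ef k p 0 (lshift (n * 4) s) = coef (@Bm R n) s k p.
Proof.
rewrite /Ef /dq mxE mxE summxE eq_lrshift add0r (bigD1 s)//= big1 => [|t ts].
  by rewrite /dw !mxE !eqxx mulr1 addr0.
by rewrite /dw !mxE (inj_eq (@lshift_inj _ _)) eq_sym (negbTE ts) mulr0.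
Qed.

Lemma lie_Ef k (f : G -> R) p : differentiable f p -> lie (Ef k) f p = X k f p.
Proof.
move=> df; rewrite /lie /Ef deriveDdir// derive_sumdir//; congr (_ + _).
by apply: eq_bigr => s _; rewrite deriveZdir.
Qed.

Lemma bform_Ef s k p q : bform s q (Ef k p) = \sum_j Bm s j k * q 0 (rshift 3 j).
Proof.
apply: eq_bigr => j _; rewrite (bigD1 k)//= big1 => [|l lk].
  by rewrite Ef_q eqxx mulr1 addr0.
by rewrite Ef_q (negbTE lk) mulr0.
Qed.

Lemma horizontal_Ef k p : horizontal (@Theta R n) p (Ef k p).
Proof.
move=> s; rewrite ThetaE Ef_w bform_Ef /coef.
under [X in 2^-1 * X]eq_bigr do rewrite -mulrA.
by rewrite -mulr_sumr mulrA mulVf ?mul1r ?subrr// pnatr_eq0.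
Qed.

Lemma horizontal_expand p v : horizontal (@Theta R n) p v ->
  v = \sum_k v 0 (rshift 3 k) *: Ef k p.
Proof.
move=> hv; apply/rowP => j; rewrite summxE.
case: (split_ordP j) => i ->; last first.
  rewrite (bigD1 i)//= big1 => [|k ki].
    by rewrite mxE Ef_q eqxx mulr1 addr0.
  by rewrite mxE Ef_q eq_sym (negbTE ki) mulr0.
have /eqP := hv i; rewrite ThetaE subr_eq0 => /eqP hvi.
have -> : v 0 (lshift (n * 4) i) = 2 * bform i p v.
  by rewrite -hvi mulrA mulfV ?mul1r// pnatr_eq0.
rewrite /bform exchange_big/= mulr_sumr; apply: eq_bigr => k _.
rewrite mxE Ef_w /coef !mulr_sumr; apply: eq_bigr => l _; ring.
Qed.

Lemma smooth_Ef k : smooth (Ef k).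
Proof.
apply: smoothD; first exact: smooth_cst.
by apply: smooth_sum => s; apply: smoothZl; exact: smooth_coef.
Qed.

Lemma hfield_Ef k : hfield (@Theta R n) (Ef k).
Proof. by split; [exact: smooth_Ef|move=> p; exact: horizontal_Ef]. Qed.

Lemma metric_Ef p v k : heis_metric p v (Ef k p) = v 0 (rshift 3 k).
Proof.
rewrite heis_metricE (bigD1 k)//= big1 => [|l lk].
  by rewrite Ef_q eqxx mulr1 addr0.
by rewrite Ef_q (negbTE lk) mulr0.
Qed.

Lemma heis_metricC (p u v : G) : heis_metric p u v = heis_metric p v u.
Proof. by rewrite !heis_metricE; apply: eq_bigr => k _; rewrite mulrC. Qed.

Lemma bracket_Ef_q k l p j : bracket (Ef k) (Ef l) p 0 (rshift 3 j) = 0.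
Proof.
have lie0 k' l' : lie (Ef k') (Ef l') p 0 (rshift 3 j) = 0.
  rewrite /lie -derive_coord; last exact/smooth_derivable/smooth_Ef.
  rewrite (_ : (fun q => _) = cst (j == l')%:R) ?derive_cst//.
  by apply/funext => q; rewrite Ef_q.
by rewrite /bracket mxE (lie0 k l) mxE (lie0 l k) subr0.
Qed.

Lemma derive_Theta s (u v p : G) :
  'D_u (fun x => Theta s x v) p = - bform s u v.
Proof.
rewrite (_ : (fun x => _) = (cst (2^-1 * v 0 (lshift (n * 4) s)) : G -> R) +
   \sum_k (- (\sum_l Bm s k l * v 0 (rshift 3 l))) *: (fun x : G => x 0 (rshift 3 k))).
  have dk k : derivable (fun x : G => x 0 (rshift 3 k) : R) p u.
    exact/smooth_derivable/smooth_proj.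
  rewrite deriveD; [|exact: derivable_cst|by apply: derivable_sum => k; exact: derivableZ].
  rewrite derive_cst add0r derive_sum => [|k]; last exact: derivableZ.
  rewrite /bform -sumrN; apply: eq_bigr => k _.
  rewrite (deriveZ _ (dk k)) derive_proj /GRing.scale/= mulNr mulr_suml.
  by congr (- _); apply: eq_bigr => l _; ring.
apply/funext => x; rewrite ThetaE fctE fct_sumE /bform -sumrN; congr (_ + _).
apply: eq_bigr => k _; rewrite -[RHS]/(_ * _) mulNr mulr_suml.
by congr (- _); apply: eq_bigr => l _; ring.
Qed.

(** Constant fields commute, and [Theta] depends on the point only through [- bform]; by skewness
    the two derivatives add up. *)
Lemma dform_Theta s (p u v : G) : dform_at (@Theta R n s) p u v = - (2 * bform s u v).
Proof.
have -> : dform_at (@Theta R n s) p u v = 'D_u (fun x => Theta s x v) p -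
  'D_v (fun x => Theta s x u) p - Theta s p ('D_u (cst v) p - 'D_v (cst u) p) by [].
have -> : 'D_u (cst v) p - 'D_v (cst u) p = 0 :> G by rewrite !derive_cst subrr.
rewrite (derive_Theta s u v p) (derive_Theta s v u p) ThetaE mxE mulr0 /bform [X in _ - (_ - X)]big1 => [|k _]; last first.
  by rewrite big1// => l _; rewrite mxE mulr0.
rewrite -/(bform s u v) -/(bform s v u) bform_skew; ring.
Qed.

Lemma rowB2 N (u v w : 'rV[R]_N) j : (u - v - w) 0 j = u 0 j - v 0 j - w 0 j.
Proof. by rewrite !mxE. Qed.

Lemma rowN N (u : 'rV[R]_N) j : (- u) 0 j = - u 0 j.
Proof. by rewrite mxE. Qed.

Context (xi : 'I_3 -> vfield R (3 + n * 4)).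
Hypothesis hxi : reeb_fields (@Theta R n) xi.

(** The vanishing of the contraction of d Theta_s with xi_s on H says that B^s kills the q-part of
    xi_s, and B^s is invertible by the Clifford relation with s = t. *)
Lemma xi_q s p j : xi s p 0 (rshift 3 j) = 0.
Proof.
have H l : \sum_k Bm s l k * xi s p 0 (rshift 3 k) = 0.
  have /eqP := reeb_contract hxi s (@horizontal_Ef l p).
  rewrite dform_Theta oppr_eq0 mulf_eq0 pnatr_eq0/= bform_Ef => /eqP h.
  transitivity (- \sum_k Bm s k l * xi s p 0 (rshift 3 k)); last by rewrite h oppr0.
  by rewrite -sumrN; apply: eq_bigr => k _; rewrite Bm_skew mulNr.
apply: (@mulfI R 2); first by rewrite pnatr_eq0.
rewrite mulr0.
transitivity (\sum_k (2 * ((s == s) && (j == k))%:R) * xi s p 0 (rshift 3 k)).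
  rewrite (bigD1 j)//= big1 ?addr0 ?eqxx/= ?mulr1// => k kj.
  by rewrite eq_sym (negbTE kj) /= mulr0 mul0r.
under eq_bigr do rewrite -Bm_clifford mulr_suml.
rewrite exchange_big/= big1// => l _.
transitivity (2 * Bm s l j * \sum_k Bm s l k * xi s p 0 (rshift 3 k)).
  by rewrite mulr_sumr; apply: eq_bigr => k _; ring.
by rewrite H mulr0.
Qed.

Lemma proj_V_q p v j : proj_V (@Theta R n) xi p v 0 (rshift 3 j) = 0.
Proof. by rewrite summxE big1// => s _; rewrite mxE xi_q mulr0. Qed.

Context (I : 'I_3 -> G -> 'M[R]_(3 + n * 4))
  (nabla : vfield R (3 + n * 4) -> vfield R (3 + n * 4) -> vfield R (3 + n * 4)).
Hypothesis hnabla :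
  biquard_connection (4 * n) (@Theta R n) (@heis_metric R n) I xi nabla.

(* Koszul: the Christoffel symbols are symmetric in the first two indices, since the bracket of [Ef i] and
   [Ef j] is vertical, and skew in the last two, since the frame is orthonormal. *)
Lemma nabla_Ef i j : nabla (Ef i) (Ef j) = fun=> 0.
Proof.
pose c i j k p := nabla (Ef i) (Ef j) p 0 (rshift 3 k).
have skew i' j' k' p : c i' j' k' p = - c i' k' j' p.
  have := bq_metric hnabla (smooth_Ef i') (hfield_Ef j') (hfield_Ef k') p.
  rewrite metric_Ef heis_metricC metric_Ef /lie.
  rewrite (_ : (fun x => _) = cst (k' == j')%:R); last first.
    by apply/funext => x; rewrite metric_Ef Ef_q.
  by rewrite derive_cst => /eqP; rewrite eq_sym addr_eq0 => /eqP.
have symm i' j' k' p : c i' j' k' p = c j' i' k' p.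
  have /rowP/(_ (rshift 3 k')) := bq_torsion_HH hnabla (hfield_Ef i') (hfield_Ef j') p.
  rewrite rowB2 rowN bracket_Ef_q proj_V_q !oppr0 addr0 => /eqP.
  by rewrite subr_eq0 => /eqP.
have [_ hor] := bq_H hnabla (smooth_Ef i) (hfield_Ef j).
apply/funext => p; rewrite (horizontal_expand (hor p)) big1// => k _.
suff c0 : c i j k p = 0 by rewrite -/(c i j k p) c0 scale0r.
have : c i j k p = - c i j k p.
  (* The six-step cycle c_ijk = - c_ikj = - c_kij = c_kji = c_jki = - c_jik = - c_ijk. *)
  by rewrite {1}skew symm skew opprK symm skew symm.
by move=> /eqP; rewrite -addr_eq0 -mulr2n mulrn_eq0/= => /eqP.
Qed.

Let nabla_conn := bq_connection hnabla.

Lemma nabla_sumr A (J : Type) (r : seq J) (F : J -> vfield R (3 + n * 4)) :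
  smooth A -> (forall j, smooth (F j)) ->
  nabla A (fun p => \sum_(j <- r) F j p) = fun p => \sum_(j <- r) nabla A (F j) p.
Proof.
have [_ _ _ addr _] := nabla_conn => sA sF.
elim: r => [|j r ih].
  have s0 : smooth (fun _ : G => 0 : G) by exact: smooth_cst.
  have E : (fun p : G => \sum_(j <- [::]) F j p) = fun=> 0.
    by apply/funext => p; rewrite big_nil.
  rewrite E; apply/funext => p; rewrite big_nil.
  have := addr _ _ _ sA s0 s0; rewrite (_ : _ \+ _ = fun=> 0); last first.
    by apply/funext => q /=; rewrite addr0.
  by move=> /(congr1 (fun F => F p))/= /eqP; rewrite -subr_eq0 opprD addNKr oppr_eq0 => /eqP.
rewrite (_ : (fun p => _) = F j \+ (fun p => \sum_(j <- r) F j p)); last first.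
  by apply/funext => p; rewrite big_cons.
rewrite addr//; last exact: smooth_sum.
by rewrite ih; apply/funext => p; rewrite big_cons.
Qed.

Lemma nabla_suml A (J : Type) (r : seq J) (F : J -> vfield R (3 + n * 4)) :
  smooth A -> (forall j, smooth (F j)) ->
  nabla (fun p => \sum_(j <- r) F j p) A = fun p => \sum_(j <- r) nabla (F j) A p.
Proof.
have [_ addl _ _ _] := nabla_conn => sA sF.
elim: r => [|j r ih].
  have s0 : smooth (fun _ : G => 0 : G) by exact: smooth_cst.
  have E : (fun p : G => \sum_(j <- [::]) F j p) = fun=> 0.
    by apply/funext => p; rewrite big_nil.
  rewrite E; apply/funext => p; rewrite big_nil.
  have := addl _ _ _ s0 s0 sA; rewrite (_ : _ \+ _ = fun=> 0); last first.
    by apply/funext => q /=; rewrite addr0.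
  by move=> /(congr1 (fun F => F p))/= /eqP; rewrite -subr_eq0 opprD addNKr oppr_eq0 => /eqP.
rewrite (_ : (fun p => _) = F j \+ (fun p => \sum_(j <- r) F j p)); last first.
  by apply/funext => p; rewrite big_cons.
rewrite addl//; last exact: smooth_sum.
by rewrite ih; apply/funext => p; rewrite big_cons.
Qed.

Lemma hfieldE A : hfield (@Theta R n) A ->
  A = fun p => \sum_k A p 0 (rshift 3 k) *: Ef k p.
Proof. by move=> [_ hA]; apply/funext => p; exact: horizontal_expand. Qed.

(** Tensoriality in [A] makes each [Ef k] parallel along every horizontal field; the Leibniz rule
    leaves only derivatives of the coefficients of [C]. *)
Lemma nabla_hfield A C p : hfield (@Theta R n) A -> hfield (@Theta R n) C ->
  nabla A C p = \sum_k lie A (fun q => C q 0 (rshift 3 k)) p *: Ef k p.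
Proof.
move=> hA hC; have [sA _] := hA; have [sC _] := hC.
have [_ _ linl _ leib] := nabla_conn.
have sCk k : smooth (fun q => C q 0 (rshift 3 k)) by exact: smooth_coord.
have sAk k : smooth (fun q => A q 0 (rshift 3 k)) by exact: smooth_coord.
have nAE k : nabla A (Ef k) = fun=> 0.
  rewrite (hfieldE hA) nabla_suml; last 2 first.
  - exact: smooth_Ef.
  - by move=> j; apply: smoothZ; [exact: sAk|exact: smooth_Ef].
  apply/funext => q; rewrite big1// => j _.
  by rewrite (linl _ _ _ (sAk j) (smooth_Ef j) (smooth_Ef k)) nabla_Ef scaler0.
rewrite {1}(hfieldE hC) nabla_sumr//; last first.
  by move=> k; apply: smoothZ; [exact: sCk|exact: smooth_Ef].
apply: eq_bigr => k _; rewrite (leib _ _ _ (sCk k) sA (smooth_Ef k)).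
by rewrite nAE scaler0 addr0.
Qed.

Lemma lie_hfield A (f : G -> R) p : hfield (@Theta R n) A -> differentiable f p ->
  lie A f p = \sum_k A p 0 (rshift 3 k) * X k f p.
Proof.
move=> [_ hA] df; rewrite /lie (horizontal_expand (hA p)) derive_sumdir//.
apply: eq_bigr => k _; rewrite deriveZdir// -lie_Ef//.
by congr (_ * _); rewrite -(horizontal_expand (hA p)).
Qed.

(** The terms that differentiate the coefficients of [C] cancel against [nabla A C], so the
    horizontal Hessian has matrix X_j X_k f in the left-invariant frame. *)
Lemma hessian_hfield (f : G -> R) A C p : smooth f ->
  hfield (@Theta R n) A -> hfield (@Theta R n) C ->
  hessian nabla f A C p =
  \sum_j \sum_k A p 0 (rshift 3 j) * C p 0 (rshift 3 k) * X j (X k f) p.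
Proof.
move=> sf hA hC; have [sA _] := hA; have [sC _] := hC.
have sCk k : smooth (fun q => C q 0 (rshift 3 k)) by exact: smooth_coord.
have sX k : smooth (X k f).
  rewrite (_ : X k f = lie (Ef k) f); first by apply: smooth_lie => //; exact: smooth_Ef.
  by apply/funext => q; rewrite lie_Ef//; exact: smooth_differentiable.
have dX k : derivable (X k f) p (A p) by exact: smooth_derivable.
have dCk k : derivable (fun q => C q 0 (rshift 3 k) : R) p (A p).
  exact/smooth_derivable/sCk.
have lCE : lie C f = \sum_k (fun q => C q 0 (rshift 3 k) : R) * X k f.
  apply/funext => q; rewrite lie_hfield//; last exact: smooth_differentiable.
  by rewrite fct_sumE.
have E1 : lie A (lie C f) p = \sum_k
    (C p 0 (rshift 3 k) * lie A (X k f) p +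
     X k f p * lie A (fun q => C q 0 (rshift 3 k)) p).
  rewrite lCE /lie derive_sum => [|k]; last exact: derivableM.
  by apply: eq_bigr => k _; rewrite (deriveM (dCk k) (dX k)).
have E2 : lie (nabla A C) f p = \sum_k
     X k f p * lie A (fun q => C q 0 (rshift 3 k)) p.
  rewrite {1}/lie nabla_hfield// derive_sumdir; last exact: smooth_differentiable.
  apply: eq_bigr => k _; rewrite deriveZdir; last exact: smooth_differentiable.
  rewrite mulrC; congr (_ * _); rewrite -lie_Ef//; exact: smooth_differentiable.
rewrite /hessian E1 E2 big_split/= addrK exchange_big/=; apply: eq_bigr => k _.
rewrite lie_hfield//; last exact: smooth_differentiable.
by rewrite mulr_sumr; apply: eq_bigr => j _; ring.
Qed.

End left_invariant_frame.

Section orthogonal_change.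
Context {R : realType}.

(** The frame is indexed by [4 * n] and the coordinates by [n * 4], so the matrix is square only up
    to a propositional equality of sizes. *)
Lemma mulmx1_trC m1 m2 (O : 'M[R]_(m1, m2)) : m1 = m2 -> O *m O^T = 1%:M ->
  O^T *m O = 1%:M.
Proof. by move=> e; case: m2 / e O => O; exact: mulmx1C. Qed.

Lemma sum_sqr_mxtrace m1 m2 (A : 'M[R]_(m1, m2)) :
  \sum_a \sum_b A a b ^+ 2 = \tr (A *m A^T).
Proof.
by apply: eq_bigr => a _; rewrite mxE; apply: eq_bigr => b _; rewrite mxE expr2.
Qed.

Lemma sum_sqr_conj m1 m2 (O : 'M[R]_(m1, m2)) (H : 'M[R]_m2) : O^T *m O = 1%:M ->
  \sum_a \sum_b (O *m H *m O^T) a b ^+ 2 = \sum_j \sum_k H j k ^+ 2.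
Proof.
move=> OO; rewrite !sum_sqr_mxtrace !trmx_mul trmxK.
rewrite -!mulmxA (mulmxA O^T O) OO mul1mx mxtrace_mulC -!mulmxA OO mulmx1.
by [].
Qed.

Lemma mxtrace_conj m1 m2 (O : 'M[R]_(m1, m2)) (H : 'M[R]_m2) : O^T *m O = 1%:M ->
  \tr (O *m H *m O^T) = \tr H.
Proof. by move=> OO; rewrite mxtrace_mulC mulmxA OO mul1mx. Qed.

End orthogonal_change.

(** * Constancy of the volume density *)

Section volume_density.
Context {R : realType} (n : nat).
Local Notation G := 'rV[R]_(3 + n * 4).
Context (xi : 'I_3 -> vfield R (3 + n * 4)).
Hypothesis hxi : reeb_fields (@Theta R n) xi.

Lemma proj_H_q p v j : proj_H (@Theta R n) xi p v 0 (rshift 3 j) = v 0 (rshift 3 j).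
Proof. by rewrite /proj_H mxE rowN proj_V_q// oppr0 addr0. Qed.

Lemma bform_ext s (u v u' v' : G) :
  (forall j, u 0 (rshift 3 j) = u' 0 (rshift 3 j)) ->
  (forall j, v 0 (rshift 3 j) = v' 0 (rshift 3 j)) -> bform s u v = bform s u' v'.
Proof.
move=> uE vE; apply: eq_bigr => k _; rewrite uE.
by apply: eq_bigr => l _; rewrite vE.
Qed.

Lemma fund_formE s p u v : fund_form (@Theta R n) xi s p u v = - bform s u v.
Proof.
have -> : bform s u v = bform s (proj_H (@Theta R n) xi p u) (proj_H (@Theta R n) xi p v).
  by apply: bform_ext => j; rewrite proj_H_q.
by rewrite /fund_form dform_Theta mulrN mulrA mulVf ?pnatr_eq0// mul1r.
Qed.

Lemma bform_vert_r s (u : G) t : bform s u (delta_mx 0 (lshift (n * 4) t)) = 0.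
Proof.
rewrite /bform big1// => k _; rewrite big1// => l _.
by rewrite mxE /= eq_rlshift mulr0.
Qed.

Lemma bform_vert_l s (u : G) t : bform s (delta_mx 0 (lshift (n * 4) t)) u = 0.
Proof. by rewrite bform_skew bform_vert_r oppr0. Qed.

Lemma vertical_index (i : 'I_(3 + n * 4)) : (i < 3)%N -> exists t, i = lshift (n * 4) t.
Proof. by move=> i3; exists (Ordinal i3); exact: val_inj. Qed.

(** By finiteness [sigma] maps [C] onto [C], and no other point can enter it. *)
Lemma perm_stable_compl (T : finType) (sigma : {perm T}) (C : {set T}) i :
  (forall j, j \in C -> sigma j \in C) -> i \notin C -> sigma i \notin C.
Proof.
move=> stab iC; apply/negP => siC.
have e : sigma @: C = C.
  apply/eqP; rewrite eqEcard card_imset ?leqnn ?andbT; last exact: perm_inj.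
  by apply/fintype.subsetP => _ /imsetP[j jC ->]; exact: stab.
by move: siC; rewrite -{1}e mem_imset ?(negbTE iC)//; exact: perm_inj.
Qed.

(** The forms [Theta] are constant on vertical vectors; the 2-form is constant and vanishes on them.
    Either [sigma] puts the three vertical vectors in the first three slots, or one of them falls
    into a 2-form and both products are 0. *)
Lemma vol_term_cst (s : 'I_3) (sigma : 'S_(3 + n * 4)) (p p' : G) :
  let v := fun j => delta_mx 0 j : G in
  (\prod_(k < 3) Theta k p (v (sigma (inord k)))) *
    \prod_(j < 2 * n) fund_form (@Theta R n) xi s p
      (v (sigma (inord (3 + 2 * j)))) (v (sigma (inord (4 + 2 * j)))) =
  (\prod_(k < 3) Theta k p' (v (sigma (inord k)))) *
    \prod_(j < 2 * n) fund_form (@Theta R n) xi s p'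
      (v (sigma (inord (3 + 2 * j)))) (v (sigma (inord (4 + 2 * j)))).
Proof.
move=> v.
have WE q : \prod_(j < 2 * n) fund_form (@Theta R n) xi s q
      (v (sigma (inord (3 + 2 * j)))) (v (sigma (inord (4 + 2 * j)))) =
    \prod_(j < 2 * n) - bform s
      (v (sigma (inord (3 + 2 * j)))) (v (sigma (inord (4 + 2 * j)))).
  by apply: eq_bigr => j _; exact: fund_formE.
rewrite [X in _ * X = _](WE p) [X in _ = _ * X](WE p'); clear WE.
have [all3|] := boolP [forall k : 'I_3, (sigma (inord k) < 3)%N].
  apply: (congr2 (fun x y => x * y)); last by [].
  apply: eq_bigr => k _.
  have [t ->] := vertical_index (forallP all3 k).
  by rewrite !ThetaE !bform_vert_r.
rewrite negb_forall => /existsP[k].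
rewrite -leqNgt => k3.
suff [j sj3 j3] : exists2 j : 'I_(3 + n * 4), (sigma j < 3)%N & (3 <= j)%N.
  have [t st] := vertical_index sj3.
  have jN := ltn_ord j.
  (* The slot [j] is one of the two arguments of the 2-form number (j - 3) / 2. *)
  have jn : ((j - 3) %/ 2 < 2 * n)%N by lia.
  suff b0 : bform s (v (sigma (inord (3 + 2 * ((j - 3) %/ 2)))))
     (v (sigma (inord (4 + 2 * ((j - 3) %/ 2))))) = 0.
    set W := \prod_(_ < 2 * n) _.
    have -> : W = 0 by rewrite /W (bigD1 (Ordinal jn))//= b0 oppr0 mul0r.
    by rewrite !mulr0.
  have [j_odd|j_even] : (4 + 2 * ((j - 3) %/ 2) = j \/ 3 + 2 * ((j - 3) %/ 2) = j)%N.
  - by lia.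
  - by rewrite j_odd inord_val st bform_vert_r.
  - by rewrite j_even inord_val st bform_vert_l.
(* Otherwise [sigma] would preserve the slots [j >= 3], hence also their complement, which
   contradicts the choice of [k]. *)
apply: contrapT => /forall2NP H.
pose C := [set j : 'I_(3 + n * 4) | (3 <= j)%N]%SET.
have stab j : j \in C -> sigma j \in C.
  by rewrite !inE => j3; case: (H j) => // /negP; rewrite -leqNgt.
have := @perm_stable_compl _ sigma C (inord k) stab.
rewrite !inE k3 -ltnNge inordK; last by rewrite (leq_trans (ltn_ord k))// leq_addr.
by move=> /(_ (ltn_ord k)).
Qed.

Lemma vol_density_cst s (p p' : G) : vol_density xi s p = vol_density xi s p'.
Proof.
rewrite /vol_density; apply: (congr1 (fun x : R => `|x|)).
apply: (congr1 (fun x : R => 2 ^- (2 * n) * x)); apply: eq_bigr => sigma _.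
rewrite -[LHS]mulrA -[RHS]mulrA; apply: (congr1 (fun x : R => (-1) ^+ sigma * x)).
exact: vol_term_cst.
Qed.

End volume_density.

(** * Norms in an arbitrary orthonormal frame, and the final estimate *)

Section sobolev.
Context {R : realType} (n : nat).
Local Notation G := 'rV[R]_(3 + n * 4).
Local Notation X := (Xop (@Bm R n)).
Context (I : 'I_3 -> G -> 'M[R]_(3 + n * 4)) (xi : 'I_3 -> vfield R (3 + n * 4))
  (nabla : vfield R (3 + n * 4) -> vfield R (3 + n * 4) -> vfield R (3 + n * 4))
  (e : 'I_(4 * n) -> vfield R (3 + n * 4)).
Hypotheses (hxi : reeb_fields (@Theta R n) xi)
  (hnabla : biquard_connection (4 * n) (@Theta R n) (@heis_metric R n) I xi nabla)
  (he : horizontal_frame (@Theta R n) (@heis_metric R n) e).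

Let O p : 'M[R]_(4 * n, n * 4) := \matrix_(a, k) e a p 0 (rshift 3 k).
Let H f p : 'M[R]_(n * 4) := \matrix_(j, k) X j (X k f) p.

Lemma frame_orth p : (O p)^T *m O p = 1%:M.
Proof.
apply: mulmx1_trC; first by rewrite mulnC.
apply/matrixP => a b; have [_ orth] := he.
rewrite [RHS]mxE -(orth a b p) heis_metricE [LHS]mxE.
by apply: eq_bigr => k _; rewrite !mxE.
Qed.

Lemma hessian_frame f p a b : smooth f ->
  hessian nabla f (e a) (e b) p = (O p *m H f p *m (O p)^T) a b.
Proof.
move=> sf; have [he1 _] := he.
rewrite (hessian_hfield hxi hnabla p sf (he1 a) (he1 b)) mxE exchange_big/=.
apply: eq_bigr => k _; rewrite !mxE mulr_suml; apply: eq_bigr => j _.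
by rewrite !mxE; ring.
Qed.

Lemma hessian_normE f p : smooth f ->
  hessian_norm nabla e f p ^+ 2 = \sum_j \sum_k X j (X k f) p ^+ 2.
Proof.
move=> sf; rewrite sqr_sqrtr; last first.
  by apply: sumr_ge0 => a _; apply: sumr_ge0 => b _; exact: sqr_ge0.
under eq_bigr do under eq_bigr do rewrite hessian_frame//.
rewrite sum_sqr_conj; last exact: frame_orth.
by apply: eq_bigr => j _; apply: eq_bigr => k _; rewrite mxE.
Qed.

Lemma sub_laplacianE f p : smooth f -> sub_laplacian nabla e f p = - lap X f p.
Proof.
move=> sf; rewrite /sub_laplacian; congr (- _).
under eq_bigr do rewrite hessian_frame//.
rewrite -/(\tr _) mxtrace_conj; last exact: frame_orth.
by rewrite /lap fct_sumE; apply: eq_bigr => k _; rewrite mxE.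
Qed.

Lemma integral_scaled N c (F : 'rV[R]_N -> R) : Cc F ->
  (\int[tuple_lebesgue R N]_t (c * F (mkrow t))%:E)%E = (c * rint F)%:E.
Proof. by move=> CF; rewrite (rintE (CcZ c CF)) rintZ. Qed.

Lemma L2normE s (F : G -> R) : Cc (fun p => F p ^+ 2) ->
  L2norm xi s F = (Num.sqrt (vol_density xi s 0 * rint (fun p => F p ^+ 2)))%:E.
Proof.
move=> CF; rewrite /L2norm.
rewrite (_ : \int[_]_t _ = (vol_density xi s 0 * rint (fun p => F p ^+ 2))%:E)%E; last first.
  apply: etrans (integral_scaled (vol_density xi s 0) CF); apply: eq_integral => t _.
  exact: (congr1 (fun c => (c * F (mkrow t) ^+ 2)%:E) (vol_density_cst hxi s (mkrow t) 0)).
by rewrite poweR_EFin powR12_sqrt// mulr_ge0// ?normr_ge0// rint_ge0// => p; exact: sqr_ge0.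
Qed.

End sobolev.

Theorem corollary6p2 (R : realType) (n : nat) (n_gt0 : (0 < n)%N)
  (I : 'I_3 -> 'rV[R]_(3 + n * 4) -> 'M[R]_(3 + n * 4))
  (xi : 'I_3 -> vfield R (3 + n * 4))
  (nabla : vfield R (3 + n * 4) -> vfield R (3 + n * 4) -> vfield R (3 + n * 4))
  (e : 'I_(4 * n) -> vfield R (3 + n * 4))
  (s : 'I_3)
  (hI : qc_almost_complex (@Theta R n) (@heis_metric R n) I)
  (hxi : reeb_fields (@Theta R n) xi)
  (hnabla : biquard_connection (4 * n) (@Theta R n) (@heis_metric R n) I xi nabla)
  (he : horizontal_frame (@Theta R n) (@heis_metric R n) e)
  (f : 'rV[R]_(3 + n * 4) -> R)
  (smooth_f : smooth f) (supp_f : compactly_supported f) :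
  (L2norm xi s (hessian_norm nabla e f) <=
     (Num.sqrt (1 + n%:R^-1))%:E * L2norm xi s (sub_laplacian nabla e f))%E.
Proof.
have Tf : test f by split=> //; exact: compactly_supported_Cc.
have TXX k l : test (Xop (@Bm R n) k (Xop (@Bm R n) l f)) by do 2 apply: test_X.
have TL : test (lap (Xop (@Bm R n)) f) by exact: test_sum.
have EH : (fun p => hessian_norm nabla e f p ^+ 2) =
    fun p => \sum_j \sum_k Xop (@Bm R n) j (Xop (@Bm R n) k f) p ^+ 2.
  by apply/funext => p; rewrite (hessian_normE hxi hnabla he).
have EL : (fun p => sub_laplacian nabla e f p ^+ 2) =
    fun p => lap (Xop (@Bm R n)) f p * lap (Xop (@Bm R n)) f p.
  by apply/funext => p; rewrite (sub_laplacianE hxi hnabla he)// sqrrN expr2.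
have CXX j k : Cc (fun p => Xop (@Bm R n) j (Xop (@Bm R n) k f) p ^+ 2).
  by under eq_fun do rewrite expr2; exact: (testM (TXX j k) (TXX j k)).2.
have CL : Cc (fun p => sub_laplacian nabla e f p ^+ 2).
  by rewrite EL; exact: (testM TL TL).2.
have CH : Cc (fun p => hessian_norm nabla e f p ^+ 2).
  by rewrite EH; do 2 apply: Cc_sum => ?.
rewrite !L2normE// -EFinM lee_fin -sqrtrM; last by rewrite addr_ge0.
(* The constant volume density is a common nonnegative factor of both integrals. *)
apply: ler_wsqrtr; rewrite mulrCA ler_wpM2l ?normr_ge0//.
have := l2_hessian_le_lap (@Bm_skew R n) (@Bm_clifford R n) _ Tf.
rewrite muln_gt0 n_gt0 => /(_ isT); rewrite EL.
have -> : 4 / (n * 4)%:R = n%:R^-1 :> R.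
  by rewrite natrM; field; rewrite pnatr_eq0 -lt0n.
apply: le_trans; rewrite le_eqVlt; apply/orP; left; apply/eqP.
rewrite EH rint_sum => [|j]; last exact: Cc_sum.
by apply: eq_bigr => j _; rewrite rint_sum.
Qed.
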